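(* Let $T>0$, $A\in\mathbb{C}^{d,d}$, let $H\in\mathbb{C}^{d,d}$ be self-adjoint and $L_1,\ldots,L_n\in\mathbb{C}^{d,d}$. Let $Z$ be the $\mathbb{C}^d$-valued solution of $$Z_t = Z_0 + \int_0^t (GZ_s + D(Z_s))\,ds + \sum_{k=1}^n \int_0^t E_k(Z_s)\,dW_s^k,\qquad \|Z_0\|=1,$$ and for each $M\in\mathbb{N}$ let $(\hat Z_m^M)_{m=0,\ldots,M}$ be the projected Euler-exponential scheme (defined, together with $G,D,E_k$, in the context). Suppose that there is a constant $K(T)>0$, independent of $M$ and $B$, such that for all $B\in\mathbb{C}^{d,d}$ and all $M\in\mathbb{N}$ $$|\mathbf{E}\langle Z_0,BZ_0\rangle-\mathbf{E}\langle\hat Z_0^M,B\hat Z_0^M\rangle|\le\|B\|\,K(T)\,\frac{T}{M}.$$ If the law of $\xi_0^1$ has compact support, then there is a constant $K(T)>0$ (possibly different), independent of $M$, such that for all $M\in\mathbb{N}$ $$|\mathbf{E}\langle Z_T,AZ_T\rangle-\mathbf{E}\langle\hat Z_M^M,A\hat Z_M^M\rangle|\le K(T)\,\frac{T}{M}.$$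
   Context: $W=(W^1,\ldots,W^n)$ is an $n$-dimensional (real) $(\mathfrak{F}_t)$-Brownian motion on a filtered probability space $(\Omega,\mathfrak{F},\mathbf{P},(\mathfrak{F}_t)_{t\ge0})$ satisfying the usual hypotheses, and $Z_0$ is $\mathfrak{F}_0$-measurable. $\langle x,y\rangle=\sum_{k=1}^d\overline{x^k}y^k$ on $\mathbb{C}^d$, with the associated norm $\|\cdot\|$; for matrices $\|B\|=\big(\sum_{k,j}|B^{k,j}|^2\big)^{1/2}$. For $z\in\mathbb{C}^d$, $$G=-iH-\tfrac12\sum_{k=1}^nL_k^*L_k,\qquad D(z)=\sum_{k=1}^n\big(\mathrm{Re}\langle z,L_kz\rangle\,L_kz-\tfrac12(\mathrm{Re}\langle z,L_kz\rangle)^2z\big),\qquad E_k(z)=L_kz-\mathrm{Re}\langle z,L_kz\rangle\,z .$$ Scheme. For $M\in\mathbb{N}$ let $\xi_m^k$, $m=0,\ldots,M-1$, $k=1,\ldots,n$, be i.i.d. real random variables with symmetric law (not depending on $M$), variance $1$ and finite moments of any order. Let $\hat Z_0^M$ be a $\mathbb{C}^d$-valued random variable independent of all the $\xi_m^k$ with $\|\hat Z_0^M\|=1$, and for $m=0,\ldots,M-1$ define $$\hat Z_{m+1}^M=p\!\left(\exp\!\left(G\tfrac{T}{M}\right)\left(\hat Z_m^M+D(\hat Z_m^M)\tfrac{T}{M}+\sqrt{\tfrac{T}{M}}\sum_{k=1}^nE_k(\hat Z_m^M)\,\xi_m^k\right)\right),$$ where $p(0)=0$ and $p(z)=z/\|z\|$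 for $z\ne0$. *)

(* Defs.v *)
From HB Require Import structures.
From mathcomp Require Import all_boot all_order all_algebra.
From mathcomp Require Import all_classical all_reals all_analysis measurable_realfun.
From mathcomp Require Export complex.

Set Implicit Arguments.
Unset Strict Implicit.
Unset Printing Implicit Defensive.

Import Order.TTheory GRing.Theory Num.Theory.
Import numFieldNormedType.Exports.
Import ComplexField.

Local Open Scope classical_set_scope.
Local Open Scope ring_scope.
Local Open Scope sesquilinear_scope.

Section linear_algebra.
Context {R : realType} {d : nat}.
Local Notation C := R[i].
Implicit Types (z x y : 'cV[C]_d) (A B : 'M[C]_d).

Definition dotc x y : C := \sum_(k < d) (x k 0)^* * y k 0.

Definition vnorm z : R := Num.sqrt (complex.Re (dotc z z)).

Definition frob B : R :=
  Num.sqrt (\sum_(k < d) \sum_(j < d) Normc.normc (B k j) ^+ 2).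

Definition expmx A : 'M[C]_d :=
  limn (series (fun k => (k`!%:R)^-1 *: A ^+ k)).

Definition vproj z : 'cV[C]_d :=
  if z == 0 then 0 else (((vnorm z)^-1)%:C)%C *: z.

(* The real coordinates of z under C^d = R^(2d): the index (k, false) gives
   the real part and (k, true) the imaginary part of the k-th component.
   Measurability, path continuity and integrals of C^d-valued functions are
   all understood coordinatewise. *)
Definition rcoord (i : 'I_d * bool) z : R :=
  if i.2 then complex.Im (z i.1 0) else complex.Re (z i.1 0).

End linear_algebra.

Section coefficients.
Context {R : realType} {d n : nat}.
Local Notation C := R[i].
Variables (H : 'M[C]_d) (L : 'I_n -> 'M[C]_d).
Implicit Types z : 'cV[C]_d.

Definition Gcoef : 'M[C]_d :=
  - ('i%C *: H) - 2%:R^-1 *: \sum_(k < n) (L k) ^t* *m L k.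

Definition Rell (k : 'I_n) z : R := complex.Re (dotc z (L k *m z)).

Definition Dcoef z : 'cV[C]_d :=
  \sum_(k < n) ((Rell k z)%:C%C *: (L k *m z)
                - (2%:R^-1 * Rell k z ^+ 2)%:C%C *: z).

Definition Ecoef (k : 'I_n) z : 'cV[C]_d := L k *m z - (Rell k z)%:C%C *: z.

(* h is the step size, x m k the value of the (m, k)-th driving noise and z the
   initial value; everything is evaluated at a fixed sample point. *)
Fixpoint scheme (h : R) (x : nat -> 'I_n -> R) z (m : nat) : 'cV[C]_d :=
  if m is m'.+1 then
    let y := scheme h x z m' in
    vproj (expmx (h%:C%C *: Gcoef) *m
      (y + h%:C%C *: Dcoef y
         + (Num.sqrt h)%:C%C *: \sum_(k < n) (x m' k)%:C%C *: Ecoef k y))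
  else z.

End coefficients.

Section probability.
Context {R : realType} {disp : measure_display} {Omega : measurableType disp}.
Variable P : probability Omega R.

Definition cexpect (X : Omega -> R[i]) : R[i] :=
  (fine 'E_P[fun w => complex.Re (X w)] +i* fine 'E_P[fun w => complex.Im (X w)])%C.

Definition sigma_gen (I : Type) (X : I -> Omega -> R) : set (set Omega) :=
  <<s \bigcup_(i in [set: I]) preimage_set_system setT (X i) measurable >>.

Definition indep_sys (F G : set (set Omega)) : Prop :=
  forall A B, F A -> G B -> P (A `&` B) = (P A * P B)%E.

(* Some B i may be setT, so the product rule for subfamilies is included. *)
Definition indep_rvs (I : finType) (X : I -> Omega -> R) : Prop :=
  forall B : I -> set R, (forall i, measurable (B i)) ->
    P (\bigcap_(i in [set: I]) X i @^-1` B i)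
      = (\prod_(i : I) P (X i @^-1` B i))%E.

Definition cvg_prob0 (Y : nat -> Omega -> \bar R) : Prop :=
  (forall j, measurable_fun setT (Y j)) /\
  forall eps : R, 0 < eps ->
    (fun j => P [set w | (eps%:E <= Y j w)%E]) @ \oo --> 0%E.

Definition meas_wrt (F : set (set Omega)) (X : Omega -> R) : Prop :=
  forall B, measurable B -> F (X @^-1` B).

(* Filtrations and processes are indexed by all of R; only the indices t >= 0
   are ever constrained. *)
Definition usual_filtration (F : R -> set (set Omega)) : Prop :=
  [/\ forall t, 0 <= t -> sigma_algebra setT (F t) /\ F t `<=` measurable,
      forall s t, 0 <= s -> s <= t -> F s `<=` F t,
      forall t, 0 <= t -> \bigcap_(s in [set s | t < s]) F s `<=` F t,
      measure_is_complete P &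
      forall N, P.-negligible N -> F 0 N].

Variable F : R -> set (set Omega).

Definition brownian (n : nat) (W : 'I_n -> R -> Omega -> R) : Prop :=
  [/\ {ae P, forall w, forall k, W k 0 w = 0},
      {ae P, forall w, forall k,
        {within `[0, +oo[, continuous (fun t : R => W k t w)}},
      forall k t, 0 <= t -> meas_wrt (F t) (W k t) &
      forall s t, 0 <= s -> s < t ->
        let dW := fun k w => W k t w - W k s w in
        [/\ indep_sys (F s) (sigma_gen dW),
            indep_rvs dW &
            forall k B, measurable B ->
              P (dW k @^-1` B) = normal_prob 0 (Num.sqrt (t - s)) B]].

Record simple_process := SimpleProcess {
  sp_size : nat;
  sp_time : nat -> R;
  sp_coef : nat -> Omega -> R;
  sp_time_ge0 : 0 <= sp_time 0;
  sp_time_nd : forall i, sp_time i <= sp_time i.+1;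
  sp_coef_meas : forall i, meas_wrt (F (sp_time i)) (sp_coef i);
  sp_coef_bdd : forall i, exists c : R, forall w, `|sp_coef i w| <= c }.

Definition sp_val (S : simple_process) (t : R) (w : Omega) : R :=
  \sum_(i < sp_size S)
    sp_coef S i w * \1_(`]sp_time S i, sp_time S i.+1]%classic) t.

Definition sp_int (S : simple_process) (B : R -> Omega -> R) (t : R)
    (w : Omega) : R :=
  \sum_(i < sp_size S) sp_coef S i w *
    (B (Num.min (sp_time S i.+1) t) w - B (Num.min (sp_time S i) t) w).

(* J is (a version of) the Ito integral of X over [0, t] against the real
   Brownian motion B: it is the limit in probability of the integrals of simple
   processes S_j such that the integral of (S_j - X)^2 over [0, t] tends to 0
   in probability. *)
Definition ito_integral (B X : R -> Omega -> R) (t : R) (J : Omega -> R) :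
    Prop :=
  meas_wrt (F t) J /\
  exists S : nat -> simple_process,
    cvg_prob0 (fun j w => \int[lebesgue_measure]_(s in `[0%R, t])
                            ((sp_val (S j) s w - X s w) ^+ 2)%:E)%E /\
    cvg_prob0 (fun j w => (`|sp_int (S j) B t w - J w|)%:E).

Definition sde_solution (n d : nat) (W : 'I_n -> R -> Omega -> R)
    (H : 'M[R[i]]_d) (L : 'I_n -> 'M[R[i]]_d)
    (Z0 : Omega -> 'cV[R[i]]_d) (Z : R -> Omega -> 'cV[R[i]]_d) : Prop :=
  [/\ forall i t, 0 <= t -> meas_wrt (F t) (fun w => rcoord i (Z t w)),
      {ae P, forall w, forall i,
        {within `[0, +oo[, continuous (fun t : R => rcoord i (Z t w))}} &
      forall t, 0 <= t ->
        exists J : 'I_n -> 'I_d * bool -> Omega -> R,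
          (forall k i, ito_integral (W k)
             (fun s w => rcoord i (Ecoef L k (Z s w))) t (J k i)) /\
          {ae P, forall w, forall i,
             rcoord i (Z t w) = rcoord i (Z0 w)
               + Rintegral lebesgue_measure `[0, t]
                   (fun s => rcoord i (Gcoef H L *m Z s w + Dcoef L (Z s w)))
               + \sum_(k < n) J k i w}].

End probability.

Section noise.
Context {R : realType}.
Variable nu : probability R R.

Definition noise_law : Prop :=
  [/\ forall B, measurable B -> nu ((fun x : R => - x) @^-1` B) = nu B,
      ('V_nu[(fun x : R => x)] = 1)%E &
      forall p : nat, nu.-integrable setT (fun x : R => (x ^+ p)%:E)].

Definition msupport : set R :=
  [set x | forall U : set R, open U -> U x -> (0 < nu U)%E].

End noise.

(* Main.v *)
Require Import Defs.
From HB Require Import structures.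
From mathcomp Require Import all_boot all_order all_algebra.
From mathcomp Require Import all_classical all_reals all_analysis measurable_realfun.
From mathcomp Require Import ring lra.
Set Implicit Arguments.
Unset Strict Implicit.
Unset Printing Implicit Defensive.
Import Order.TTheory GRing.Theory Num.Theory.
Import numFieldNormedType.Exports.
Import ComplexField.
Local Open Scope classical_set_scope.
Local Open Scope ring_scope.
Local Open Scope sesquilinear_scope.

(** Although the equation is nonlinear, its generator maps the quadratic form of
    an observable [B] to the quadratic form of [lindblad B]: the terms of degree
    four and six in the drift cancel against those of the quadratic variation
    ([generator_quadratic]). So the observable evolves by a linear equation, whose
    Euler method [evol] is of first order, and both expectations in the claim are
    compared with those of the Euler iterates of [A] at the initial values.
    Everything is done in the real coordinates [to_real], with complex matrices
    acting through [realify].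

    For the scheme, one step reproduces one Euler step of the observable up to
    [O(h ^+ 2)] ([weak_step_Ex]). The step is expanded in the square root of [h];
    as the noise is tangential to the unit sphere, the squared norm moves only at
    order [h], and the projection is expanded around norm 1 ([sphproj_quad]). The
    terms of orders 1/2 and 3/2 have zero mean, by independence and vanishing odd
    moments, and the correction due to the projection has zero mean because the
    generator annihilates the squared norm ([dissipative]). Since the Euler
    iterates are stable, the local errors add up to [O(h)] ([weak_chain_Ex]).

    For the solution, no Ito formula is used. The same estimate holds for the
    scheme driven by the normalised increments of [W], on every refinement of the
    mesh, with constants that do not depend on the refinement. This chain
    converges in probability to the solution ([brown_chain_cvg]), and all vectors
    lie in the unit ball, so the estimate passes to the limit ([exact_weak]). The
    convergence is shown through Euler sums whose coefficients are frozen at the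
    solution itself: they are close to the solution by the definition of the
    integrals in the equation ([ito_close], [frozen_close]), and close to the
    chain in mean square by a discrete Gronwall argument ([strong_step_Ex],
    [strong_bound]). As the coefficients are only locally Lipschitz, this is done
    on the event that the solution stays in a large ball.

    What remains is the difference of the expectations of the iterated observable
    at the two initial values, which is the hypothesis for a matrix bounded by a
    multiple of [A] ([weak_quad]). Imaginary parts are real parts for [- 'i *: A]. *)

(** * Expectation and independence *)

Section expect.
Context {R : realType} {disp : measure_display} {Omega : measurableType disp}.
Variable P : probability Omega R.
Implicit Types X Y f g : Omega -> R.

Definition Ex X : R := \int[P]_w X w.
Definition L1 X := P.-integrable setT (EFin \o X).

Lemma ExE X : fine 'E_P[X] = Ex X.
Proof. by rewrite unlock. Qed.

Lemma L1_meas X : L1 X -> measurable_fun setT X.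
Proof. by move=> /integrableP[/measurable_EFinP]. Qed.

Lemma L1D X Y : L1 X -> L1 Y -> L1 (fun w => X w + Y w).
Proof.
move=> iX iY; have := integrableD measurableT iX iY.
by apply: eq_integrable => // w _ /=; rewrite EFinD.
Qed.

Lemma L1Z c X : L1 X -> L1 (fun w => c * X w).
Proof.
move=> iX; have := integrableZl measurableT c iX.
by apply: eq_integrable => // w _ /=; rewrite EFinM.
Qed.

Lemma L1N X : L1 X -> L1 (fun w => - X w).
Proof.
by move=> /(L1Z (-1)); apply: eq_integrable => // w _ /=; rewrite mulN1r.
Qed.

Lemma L1B X Y : L1 X -> L1 Y -> L1 (fun w => X w - Y w).
Proof. by move=> iX iY; apply: L1D => //; exact: L1N. Qed.

Lemma L1_cst c : L1 (fun=> c).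
Proof. exact: finite_measure_integrable_cst. Qed.

Lemma L1_sum (I : Type) (s : seq I) (Q : pred I) (X : I -> Omega -> R) :
  (forall i, Q i -> L1 (X i)) -> L1 (fun w => \sum_(i <- s | Q i) X i w).
Proof.
move=> iX; elim: s => [|i s IH].
  by have := L1_cst 0; apply: eq_integrable => // w _ /=; rewrite big_nil.
case Qi : (Q i); last first.
  by move: IH; apply: eq_integrable => // w _ /=; rewrite big_cons Qi.
have := L1D (iX _ Qi) IH.
by apply: eq_integrable => // w _ /=; rewrite big_cons Qi.
Qed.

Lemma L1_dom f g : measurable_fun setT f -> L1 g ->
  (forall w, `|f w| <= g w) -> L1 f.
Proof.
move=> mf ig fg; apply: le_integrable ig => //; first exact/measurable_EFinP.
by move=> w _ /=; rewrite lee_fin (le_trans (fg w)) // ler_norm.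
Qed.

Lemma L1_bdd f c : measurable_fun setT f -> (forall w, `|f w| <= c) -> L1 f.
Proof. by move=> mf fc; apply: (L1_dom mf (L1_cst c)). Qed.

Lemma L1_abs X : L1 X -> L1 (fun w => `|X w|).
Proof.
move=> iX; apply: (L1_dom _ (integrable_norm iX)) => //=.
  by apply: measurableT_comp => //; exact: L1_meas.
by move=> w; rewrite normr_id.
Qed.

Lemma ExD X Y : L1 X -> L1 Y -> Ex (fun w => X w + Y w) = Ex X + Ex Y.
Proof. exact: RintegralD. Qed.

Lemma ExZ c X : L1 X -> Ex (fun w => c * X w) = c * Ex X.
Proof. by move=> iX; exact: RintegralZl. Qed.

Lemma ExB X Y : L1 X -> L1 Y -> Ex (fun w => X w - Y w) = Ex X - Ex Y.
Proof. exact: RintegralB. Qed.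

Lemma Ex_cst c : Ex (fun=> c) = c.
Proof. by rewrite /Ex Rintegral_cst //= probability_setT /= mulr1. Qed.

Lemma Ex_sum (I : Type) (s : seq I) (Q : pred I) (X : I -> Omega -> R) :
  (forall i, Q i -> L1 (X i)) ->
  Ex (fun w => \sum_(i <- s | Q i) X i w) = \sum_(i <- s | Q i) Ex (X i).
Proof.
move=> iX; elim: s => [|i s IH].
  by rewrite big_nil -[RHS]Ex_cst; congr Ex; apply/funext => w; rewrite big_nil.
rewrite big_cons; case Qi : (Q i); last first.
  by rewrite -IH; congr Ex; apply/funext => w; rewrite big_cons Qi.
rewrite -IH -ExD; [|exact: iX|exact: L1_sum].
by congr Ex; apply/funext => w; rewrite big_cons Qi.
Qed.

Lemma Ex_le X Y : L1 X -> L1 Y -> (forall w, X w <= Y w) -> Ex X <= Ex Y.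
Proof. by move=> iX iY XY; apply: le_Rintegral. Qed.

Lemma Ex_ge0 X : (forall w, 0 <= X w) -> 0 <= Ex X.
Proof. by move=> X0; exact: Rintegral_ge0. Qed.

Lemma Ex_abs X : L1 X -> `|Ex X| <= Ex (fun w => `|X w|).
Proof. by move=> iX; exact: le_normr_Rintegral. Qed.

Lemma Ex_abs_le X Y : L1 X -> L1 Y -> (forall w, `|X w| <= Y w) ->
  `|Ex X| <= Ex Y.
Proof.
move=> iX iY XY; apply: (le_trans (Ex_abs iX)).
by apply: Ex_le => //; exact: L1_abs.
Qed.

Lemma Ex_ae X Y : measurable_fun setT X -> measurable_fun setT Y ->
  {ae P, forall w, X w = Y w} -> Ex X = Ex Y.
Proof.
move=> mX mY XY; rewrite /Ex /Rintegral; congr fine.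
apply: ae_eq_integral => //; [exact/measurable_EFinP|exact/measurable_EFinP|].
by move: XY; apply: filterS => w /= -> _.
Qed.

Lemma L1_ae X Y : L1 X -> measurable_fun setT Y ->
  {ae P, forall w, X w = Y w} -> L1 Y.
Proof.
move=> /integrableP[mX iX] mY XY; apply/integrableP.
split; first exact/measurable_EFinP.
rewrite (_ : (\int[P]_(x in _) _)%E = (\int[P]_(x in setT) `|(EFin \o X) x|)%E) //.
apply: ae_eq_integral => //; [|exact: measurableT_comp|].
  by apply: measurableT_comp => //; exact/measurable_EFinP.
by move: XY; apply: filterS => w /= -> _.
Qed.

Definition pr (A : set Omega) : R := fine (P A).

Lemma prE A : measurable A -> P A = (pr A)%:E.
Proof. by move=> mA; rewrite /pr fineK // fin_num_measure. Qed.

Lemma pr_ge0 A : 0 <= pr A.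
Proof. by rewrite /pr fine_ge0. Qed.

Lemma pr_le1 A : measurable A -> pr A <= 1.
Proof. by move=> mA; rewrite -lee_fin -prE //; exact: probability_le1. Qed.

Lemma pr_mono A B : measurable A -> measurable B -> A `<=` B -> pr A <= pr B.
Proof.
by move=> mA mB AB; rewrite -lee_fin -!prE //; apply: le_measure; rewrite ?inE.
Qed.

Lemma pr_setU_le A B : measurable A -> measurable B ->
  pr (A `|` B) <= pr A + pr B.
Proof.
move=> mA mB; rewrite -lee_fin EFinD -!prE //; last exact: measurableU.
exact: measureU2.
Qed.

Lemma pr_setC A : measurable A -> pr (~` A) = 1 - pr A.
Proof.
move=> mA; apply/EFin_inj; rewrite EFinB -!prE //; last exact: measurableC.
by rewrite probability_setC.
Qed.

Lemma pr_indic A : measurable A -> Ex \1_A = pr A.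
Proof.
by move=> mA; rewrite /Ex /Rintegral integral_indic // setIT.
Qed.

Lemma L1_indic A : measurable A -> L1 \1_A.
Proof. by move=> mA; exact: integrable_indic. Qed.

Lemma pr_markov X c : 0 < c -> L1 X -> (forall w, 0 <= X w) ->
  pr [set w | c <= X w] <= Ex X / c.
Proof.
move=> c0 iX X0; have mX := L1_meas iX.
have mA : measurable [set w | c <= X w].
  by rewrite -[X in measurable X]setTI; apply: measurable_fun_ler => //; exact: measurable_cst.
rewrite ler_pdivlMr // mulrC -pr_indic // -ExZ; last exact: L1_indic.
apply: Ex_le => //; first by apply: L1Z; exact: L1_indic.
move=> w; rewrite indicE; case: (boolP (w \in _)) => [|_]; last by rewrite mulr0.
by rewrite inE /= mulr1.
Qed.
End expect.

Section independence.
Context {R : realType} {disp : measure_display} {Omega : measurableType disp}.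
Variable P : probability Omega R.
Implicit Types X Y f g : Omega -> R.

(** The joint law of two independent variables is the product of their laws,
    so Fubini's theorem factorises the expectation of the product. *)
Lemma Ex_indep X Y : L1 P X -> L1 P Y ->
  (forall A B : set R, measurable A -> measurable B ->
     P (X @^-1` A `&` Y @^-1` B) = (P (X @^-1` A) * P (Y @^-1` B))%E) ->
  L1 P (fun w => X w * Y w) /\ Ex P (fun w => X w * Y w) = Ex P X * Ex P Y.
Proof.
move=> iX iY XY.
have mX := L1_meas iX; have mY := L1_meas iY.

pose X' : {RV P >-> R} := mfun_Sub (mem_set mX).
pose Y' : {RV P >-> R} := mfun_Sub (mem_set mY).
have mXY : measurable_fun setT (fun w => (X w, Y w)) by exact: measurable_fun_pair.
pose XY' : {RV P >-> (R * R)%type} := mfun_Sub (mem_set mXY).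
pose m1 := distribution P X'; pose m2 := distribution P Y'.
pose f (z : R * R) : \bar R := (z.1 * z.2)%:E.
have mf : measurable_fun setT f.
  apply/measurable_EFinP; apply: measurable_funM; first exact: measurable_fst.
  exact: measurable_snd.
have E0 A : measurable A -> (m1 \x m2)%E A = distribution P XY' A.
  by apply: product_measure_unique => A' B mA mB; exact: XY.
have iX1 : m1.-integrable setT (EFin : R -> \bar R).
  by apply: integrable_pushforward => //; exact: EFin_measurable.
have iY1 : m2.-integrable setT (EFin : R -> \bar R).
  by apply: integrable_pushforward => //; exact: EFin_measurable.
have [_ fX] := integrableP _ _ _ iX1; have [_ fY] := integrableP _ _ _ iY1.
have mabs : measurable_fun setT (fun y : R => `|y|%:E : \bar R).
  by apply/measurable_EFinP; exact: normr_measurable.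
have i12 : (m1 \x m2)%E.-integrable setT f.
  apply/integrable12ltyP => //.
  have -> : (\int[m1]_x \int[m2]_y `|f (x, y)| =
             \int[m1]_x (`|x|%:E * \int[m2]_y `|y%:E|))%E.
    apply: eq_integral => x _; rewrite -ge0_integralZl_EFin //.
    by apply: eq_integral => y _; rewrite /f /= normrM EFinM.
  rewrite ge0_integralZr //; last exact: integral_ge0.
  apply: lte_mul_pinfty => //; first exact: integral_ge0.
  by rewrite ge0_fin_numE //; exact: integral_ge0.
have fC : (\int[P]_w `|(f \o XY') w| < +oo)%E.
  rewrite -(ge0_integral_distribution XY' (f := fun z => `|f z|%E)) //; last first.
    exact: measurableT_comp.
  rewrite (eq_measure_integral (m1 \x m2)%E) => [|A mA _]; last exact/esym/E0.
  by have [] := integrableP _ _ _ i12.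
have iXY : L1 P (fun w => X w * Y w).
  apply/integrableP; split => //.
  by apply/measurable_EFinP; exact: measurable_funM.
split=> //; apply: EFin_inj.
rewrite EFinM /Ex /Rintegral !fineK; [|exact: integrable_fin_num..].
have <- : (\int[distribution P XY']_z f z = \int[P]_x (X x * Y x)%:E)%E.
  by rewrite integral_distribution.
rewrite (eq_measure_integral (m1 \x m2)%E) => [|A mA _]; last exact/esym/E0.
rewrite -integral12_prod_meas1 //.
rewrite -(@integral_distribution _ _ _ _ _ P X' EFin) // -(@integral_distribution _ _ _ _ _ P Y' EFin) //.
rewrite -/m1 -/m2.
have fin2 : (\int[m2]_y y%:E)%E \is a fin_num by apply: integrable_fin_num.
rewrite -(fineK fin2) -integralZr //.
by apply: eq_integral => x _; rewrite fineK // /fubini_F /f /= -integralZl.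
Qed.

(** The sets [A] satisfying the product rule with [B] form a Dynkin class. *)
Lemma dynkin_indep (C : set (set Omega)) (B : set Omega) :
  setI_closed C -> C `<=` measurable -> measurable B ->
  (forall A, C A -> P (A `&` B) = (P A * P B)%E) ->
  forall A, <<s C >> A -> P (A `&` B) = (P A * P B)%E.
Proof.
move=> CI Cm mB CB; rewrite -setI_closed_g_dynkin_g_sigma_algebra //.
suff : <<d C >> `<=` [set A | measurable A /\ P (A `&` B) = (P A * P B)%E].
  by move=> H A /H[].
apply: smallest_sub => [|A CA]; last by split; [exact: Cm|exact: CB].
split.
- by split => //; rewrite setTI probability_setT mul1e.
- move=> A [mA AB]; split; first exact: measurableC.
  have mAB := measurableI _ _ mA mB.
  have mCA := measurableC mA; have mCAB := measurableI _ _ mCA mB.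
  have {}AB : pr P (A `&` B) = pr P A * pr P B.
    by apply: EFin_inj; rewrite EFinM -!prE.
  rewrite !prE // -EFinM; congr EFin.
  rewrite pr_setC // mulrBl mul1r -AB; apply: EFin_inj; rewrite EFinB -!prE //.
  rewrite setIC -setDE measureD //; first by rewrite setIC.
  by rewrite ltey_eq fin_num_measure.
- move=> F tF FD; split; first by apply: bigcup_measurable => k _; case: (FD k).
  have tFB : trivIset setT (fun k => F k `&` B) by exact: trivIset_setIr.
  rewrite setI_bigcupl !measure_semi_bigcup //; last 4 first.
  + by move=> k; case: (FD k).
  + by apply: bigcup_measurable => k _; case: (FD k).
  + by move=> k; apply: measurableI => //; case: (FD k).
  + by apply: bigcup_measurable => k _; apply: measurableI => //; case: (FD k).
  rewrite muleC (prE P mB) -nneseriesZl //.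
  by apply: eq_eseriesr => k _; rewrite muleC -prE //; case: (FD k).
Qed.

Lemma indep_sys_gen (C D : set (set Omega)) :
  setI_closed C -> setI_closed D -> C `<=` measurable -> D `<=` measurable ->
  indep_sys P C D -> indep_sys P <<s C >> <<s D >>.
Proof.
move=> CI DI Cm Dm CD A B sA sB.
have sDm : <<s D >> `<=` measurable.
  by apply: smallest_sub => //; exact: sigma_algebra_measurable.
apply: (dynkin_indep CI) => //; first exact: sDm.
move=> A' CA'; rewrite setIC muleC; apply: (dynkin_indep DI) => //; first exact: Cm.
by move=> B' DB'; rewrite setIC muleC; exact: CD.
Qed.

Lemma indep_sysS (F F' G G' : set (set Omega)) : F' `<=` F -> G' `<=` G ->
  indep_sys P F G -> indep_sys P F' G'.
Proof. by move=> FF GG FG A B /FF FA /GG GB; exact: FG. Qed.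
End independence.

(** * Adapted variables and the noise of one step *)

Section adapted.
Context {R : realType} {disp : measure_display} {Omega : measurableType disp}.
Implicit Types (G : set (set Omega)) (X Y : Omega -> R).

(** Measurability with respect to an arbitrary class of sets, through the
    sigma-algebra generated by it, so that the lemmas on measurable
    functions apply; [admP] gives the preimage form. The record keeps unification from
    unfolding it. *)
Record adm G X : Prop := Adm {
  admE : @measurable_fun _ _ (g_sigma_algebraType G) R setT X }.

Lemma admP G X : sigma_algebra setT G -> adm G X <-> meas_wrt G X.
Proof.
move=> sG; have GE : <<s G >> = G by rewrite sigma_algebra_id.
split=> [[mX] B mB|mX]; last constructor=> _ B mB.
  by have := mX measurableT B mB; rewrite setTI /= {1}/measurable /= GE.
by rewrite setTI {1}/measurable /= GE; exact: mX.
Qed.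

Lemma adm_sub G G' X : G `<=` G' -> adm G X -> adm G' X.
Proof.
move=> GG [mX]; constructor=> _ B mB; have := mX measurableT B mB.
by apply: sub_sigma_algebra2; exact: GG.
Qed.

Lemma adm_meas G X : G `<=` measurable -> adm G X -> measurable_fun setT X.
Proof.
move=> GG [mX] _ B mB; have := mX measurableT B mB.
have := @smallest_sub _ (sigma_algebra setT) G measurable.
by move/(_ (sigma_algebra_measurable _) GG); exact.
Qed.

Lemma adm_cst G c : adm G (fun=> c).
Proof. by constructor; exact: measurable_cst. Qed.

Lemma admD G X Y : adm G X -> adm G Y -> adm G (fun w => X w + Y w).
Proof. by move=> [mX] [mY]; constructor; apply: measurable_funD. Qed.

Lemma admB G X Y : adm G X -> adm G Y -> adm G (fun w => X w - Y w).
Proof. by move=> [mX] [mY]; constructor; apply: measurable_funB. Qed.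

Lemma admM G X Y : adm G X -> adm G Y -> adm G (fun w => X w * Y w).
Proof. by move=> [mX] [mY]; constructor; apply: measurable_funM. Qed.

Lemma admX G X p : adm G X -> adm G (fun w => X w ^+ p).
Proof. by move=> [mX]; constructor; apply: measurable_funX. Qed.

Lemma adm_comp G X (h : R -> R) : measurable_fun setT h -> adm G X ->
  adm G (fun w => h (X w)).
Proof. by move=> mh [mX]; constructor; apply: measurableT_comp. Qed.

Lemma adm_sum G (I : Type) (s : seq I) (Q : pred I) (X : I -> Omega -> R) :
  (forall i, Q i -> adm G (X i)) -> adm G (fun w => \sum_(i <- s | Q i) X i w).
Proof.
move=> mX; elim: s => [|i s IH].
  by under eq_fun do rewrite big_nil; exact: adm_cst.
under eq_fun do rewrite big_cons.
by case Qi : (Q i) => //; apply: admD => //; exact: mX.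
Qed.

Lemma adm_indic G (A : set Omega) : G A -> adm G \1_A.
Proof.
move=> GA; constructor; apply: measurable_indic.
exact: (@sub_sigma_algebra _ setT G).
Qed.

Lemma adm_le_set G X Y : sigma_algebra setT G -> adm G X -> adm G Y ->
  G [set w | X w <= Y w].
Proof.
move=> sG [mX] [mY]; have GE : <<s G >> = G by rewrite sigma_algebra_id.
rewrite -GE -[X in <<s _ >> X]setTI.
exact: (@measurable_fun_ler _ (g_sigma_algebraType G) R setT X Y mX mY measurableT).
Qed.

Lemma adm_inv G X : (forall w, 0 <= X w) -> adm G X -> adm G (fun w => (X w)^-1).
Proof.
move=> X0 mX; under eq_fun do rewrite -powR_inv1 //.
exact: adm_comp (measurable_powR _) mX.
Qed.

Lemma measurable_sqrtr : measurable_fun setT (fun x : R => Num.sqrt x).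
Proof. by apply: continuous_measurable_fun; exact: sqrt_continuous. Qed.

Lemma sigma_gen_sa (I : Type) (X : I -> Omega -> R) :
  sigma_algebra setT (sigma_gen X).
Proof. exact: smallest_sigma_algebra. Qed.

Lemma sigma_gen_meas (I : Type) (X : I -> Omega -> R) :
  (forall i, measurable_fun setT (X i)) -> sigma_gen X `<=` measurable.
Proof.
move=> mX; apply: smallest_sub; first exact: sigma_algebra_measurable.
by move=> A [i _ [B mB <-]]; exact: mX.
Qed.

Lemma sigma_gen_adm (I : Type) (X : I -> Omega -> R) i : adm (sigma_gen X) (X i).
Proof.
apply/admP; first exact: sigma_gen_sa.
move=> B mB; apply: sub_sigma_algebra; exists i => //.
by exists B => //; rewrite setTI.
Qed.

Lemma sigma_gen_min (I : Type) (X : I -> Omega -> R) G :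
  sigma_algebra setT G -> (forall i, adm G (X i)) -> sigma_gen X `<=` G.
Proof.
move=> sG mX; apply: smallest_sub => // A [i _ [B mB <-]].
by rewrite setTI; apply: (admP _ sG).1.
Qed.

Variable P : probability Omega R.

(** Events fixing the values of finitely many variables form a pi-system that
    generates the information of a group of variables. *)
Lemma indep_rvs_groups (I : finType) (X : I -> Omega -> R) (S S' : pred I)
    (J J' : Type) (f : J -> I) (f' : J' -> I) :
  (forall i, measurable_fun setT (X i)) -> indep_rvs P X ->
  (forall i, S i -> S' i -> False) -> (forall j, S (f j)) ->
  (forall j, S' (f' j)) ->
  indep_sys P (sigma_gen (fun j => X (f j))) (sigma_gen (fun j => X (f' j))).
Proof.
move=> mX iX SS' Sf Sf'.
pose C (S0 : pred I) : set (set Omega) := [set A | exists B : I -> set R,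
  [/\ forall i, measurable (B i), forall i, ~~ S0 i -> B i = setT &
      A = \bigcap_(i in [set: I]) X i @^-1` B i]].
have CI S0 : setI_closed (C S0).
  move=> _ _ [B [mB BT ->]] [B' [mB' BT' ->]].
  exists (fun i => B i `&` B' i); split.
  - by move=> i; exact: measurableI.
  - by move=> i Si; rewrite BT // BT' // setTI.
  - by rewrite -bigcapI; apply: eq_bigcapr => i _; rewrite preimage_setI.
have Cm S0 : C S0 `<=` measurable.
  move=> _ [B [mB BT ->]]; apply: fin_bigcap_measurable => //.
  by move=> i _; rewrite -[X in measurable X]setTI; exact: mX.
have CCi : indep_sys P (C S) (C S').
  move=> _ _ [B [mB BT ->]] [B' [mB' BT' ->]].
  rewrite -bigcapI.
  have -> : \bigcap_(i in [set: I]) (X i @^-1` B i `&` X i @^-1` B' i) =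
            \bigcap_(i in [set: I]) X i @^-1` (B i `&` B' i).
    by apply: eq_bigcapr => i _; rewrite preimage_setI.
  rewrite !iX //; last by move=> i; exact: measurableI.
  rewrite -big_split /=; apply: eq_bigr => i _.
  have [Si|nSi] := boolP (S i).
    rewrite (BT' i) ?setIT ?preimage_setT ?probability_setT ?mule1 //.
    by apply/negP => /(SS' _ Si).
  by rewrite (BT i) // setTI preimage_setT probability_setT mul1e.
have gC (S0 : pred I) (J0 : Type) (g : J0 -> I) : (forall j, S0 (g j)) ->
    sigma_gen (fun j => X (g j)) `<=` <<s C S0 >>.
  move=> Sg; apply: sub_sigma_algebra2 => A [j _ [B mB <-]].
  exists (fun i => if i == g j then B else setT); split.
  - by move=> i; case: ifP.
  - by move=> i; case: eqP => // ->; rewrite Sg.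
  - rewrite setTI; apply/seteqP; split => w /=.
      by move=> Bw i _ /=; case: eqP => // ->.
    by move=> /(_ (g j) Logic.I) /=; rewrite eqxx.
apply: indep_sysS (indep_sys_gen (CI S) (CI S') (Cm S) (Cm S') CCi).
- exact: gC.
- exact: gC.
Qed.
End adapted.

Section noise_moments.
Context {R : realType} {disp : measure_display} {Omega : measurableType disp}.
Variable P : probability Omega R.
Variable n : nat.

(** The driving noise of one step, common to the scheme and to the normalised
    Brownian increments: independent of the past [G], with the first three
    moments of a standard normal law. Eighth moments are bounded because the
    square of the strong one-step error is controlled by the eighth power of the
    noise. *)
Record noise (G : set (set Omega)) (x : 'I_n -> Omega -> R) (c : R) : Prop := Noise {
  noise_sa : sigma_algebra setT G;
  noise_sub : G `<=` measurable;
  noise_mf : forall k, measurable_fun setT (x k);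
  noise_indep : indep_sys P G (sigma_gen x);
  noise_rvs : indep_rvs P x;
  noise_L8 : forall k, L1 P (fun w => x k w ^+ 8);
  noise_E8 : forall k, Ex P (fun w => x k w ^+ 8) <= c;
  noise_E1 : forall k, Ex P (x k) = 0;
  noise_E2 : forall k, Ex P (fun w => x k w ^+ 2) = 1;
  noise_E3 : forall k, Ex P (fun w => x k w ^+ 3) = 0 }.

(** A single majorant for all polynomials in the noise. *)
Definition weight (x : 'I_n -> R) : R := 1 + \sum_k `|x k|.

Lemma weight_ge1 x : 1 <= weight x.
Proof. by rewrite lerDl sumr_ge0. Qed.

Lemma weight_ge x k : `|x k| <= weight x.
Proof.
rewrite /weight (bigD1 k) //= addrCA lerDl addr_ge0 // sumr_ge0 //.
Qed.

Lemma weight_mono x p q : (p <= q)%N -> weight x ^+ p <= weight x ^+ q.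
Proof. by move=> pq; rewrite ler_weXn2l // weight_ge1. Qed.

Lemma weight8_le x : weight x ^+ 8 <= n.+1%:R ^+ 8 * (1 + \sum_k x k ^+ 8).
Proof.
have X8 k : x k ^+ 8 = `|x k| ^+ 8.
  by rewrite -normrX ger0_norm // (@exprn_even_ge0 _ 8).
under eq_bigr do rewrite X8.
pose m := \big[Num.max/1]_k `|x k|.
have m1 : 1 <= m.
  exact: bigmax_ge_id.
have xm k : `|x k| <= m by exact: le_bigmax.
have Nm : weight x <= n.+1%:R * m.
  rewrite /weight -natr1 mulrDl mul1r addrC lerD //.
  apply: (le_trans (ler_sum _ (fun k _ => xm k))).
  by rewrite sumr_const card_ord mulr_natl.
have m8 : m ^+ 8 <= 1 + \sum_k `|x k| ^+ 8.
  have : m = 1 \/ exists k, m = `|x k|.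
    rewrite /m; apply: (big_ind (fun u => u = 1 \/ exists k, u = `|x k|)) => [|u v uE vE|k _]; [by left| |by right; exists k].
    by rewrite /Order.max; case: ifP.
  case=> [->|[k ->]]; first by rewrite expr1n lerDl sumr_ge0 // => k _; rewrite exprn_ge0.
  by rewrite (bigD1 k) //= addrCA lerDl addr_ge0 // sumr_ge0.
apply: (@le_trans _ _ ((n.+1%:R * m) ^+ 8)).
  rewrite lerXn2r // nnegrE; first exact: le_trans (weight_ge1 x).
  by rewrite mulr_ge0 // (le_trans _ m1).
by rewrite exprMn ler_wpM2l.
Qed.

Section with_noise.
Variables (G : set (set Omega)) (x : 'I_n -> Omega -> R) (c : R).
Hypothesis Nx : noise G x c.

Let W w := weight (fun k => x k w).

Lemma weight_meas : measurable_fun setT W.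
Proof.
apply: measurable_funD => //; apply: measurable_sum => k.
by apply: measurableT_comp => //; exact: noise_mf Nx k.
Qed.

Lemma weight8_L1 : L1 P (fun w => W w ^+ 8).
Proof.
apply: (L1_dom (g := fun w => n.+1%:R ^+ 8 * (1 + \sum_k x k w ^+ 8))).
- by apply: measurable_funX; exact: weight_meas.
- apply: L1Z; apply: L1D; first exact: L1_cst.
  by apply: L1_sum => k _; exact: noise_L8 Nx k.
- move=> w; rewrite ger0_norm; first exact: weight8_le.
  by rewrite exprn_ge0 // (le_trans _ (weight_ge1 _)).
Qed.

Lemma weight_L1 p : (p <= 8)%N -> L1 P (fun w => W w ^+ p).
Proof.
move=> p8; apply: (L1_dom _ weight8_L1).
  by apply: measurable_funX; exact: weight_meas.
move=> w; rewrite ger0_norm; first exact: weight_mono.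
by rewrite exprn_ge0 // (le_trans _ (weight_ge1 _)).
Qed.

Lemma weight_Ex p : (p <= 8)%N ->
  Ex P (fun w => W w ^+ p) <= n.+1%:R ^+ 8 * (1 + n%:R * c).
Proof.
move=> p8; apply: (@le_trans _ _ (Ex P (fun w => n.+1%:R ^+ 8 * (1 + \sum_k x k w ^+ 8)))).
  apply: Ex_le; first exact: weight_L1.
    apply: L1Z; apply: L1D; first exact: L1_cst.
    by apply: L1_sum => k _; exact: noise_L8 Nx k.
  by move=> w; apply: le_trans (weight8_le _); exact: weight_mono.
have iS : L1 P (fun w => \sum_k x k w ^+ 8).
  by apply: L1_sum => k _; exact: noise_L8 Nx k.
rewrite ExZ; last by apply: L1D => //; exact: L1_cst.
rewrite ler_wpM2l ?exprn_ge0 // ExD //; last exact: L1_cst.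
rewrite Ex_cst Ex_sum; last by move=> k _; exact: noise_L8 Nx k.
rewrite lerD2l (le_trans (ler_sum _ (fun k _ => noise_E8 Nx k))) //.
by rewrite sumr_const card_ord mulr_natl.
Qed.

Lemma mono_L1 (f : Omega -> R) p : (p <= 8)%N -> measurable_fun setT f ->
  (forall w, `|f w| <= W w ^+ p) -> L1 P f.
Proof. by move=> p8 mf fW; apply: (L1_dom mf (weight_L1 p8)). Qed.

Lemma x1_L1 k : L1 P (x k).
Proof.
apply: (@mono_L1 _ 1) => //; first exact: noise_mf Nx k.
by move=> w; rewrite expr1; exact: (weight_ge (fun k => x k w)).
Qed.

Lemma x2_L1 j k : L1 P (fun w => x j w * x k w).
Proof.
apply: (@mono_L1 _ 2) => //.
  by apply: measurable_funM; exact: noise_mf Nx _.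
move=> w; rewrite normrM expr2 ler_pM //; exact: (weight_ge (fun k => x k w)).
Qed.

Lemma x3_L1 i j k : L1 P (fun w => x i w * x j w * x k w).
Proof.
apply: (@mono_L1 _ 3) => //.
  by do 2 (apply: measurable_funM; last exact: noise_mf Nx _); exact: noise_mf Nx _.
move=> w; rewrite !normrM exprSr ler_pM //; last exact: (weight_ge (fun k => x k w)).
  by rewrite expr2 ler_pM //; exact: (weight_ge (fun k => x k w)).
Qed.

Lemma Ex_indep_adm (G1 G2 : set (set Omega)) (a b : Omega -> R) :
  sigma_algebra setT G1 -> sigma_algebra setT G2 -> indep_sys P G1 G2 ->
  adm G1 a -> adm G2 b -> L1 P a -> L1 P b ->
  L1 P (fun w => a w * b w) /\ Ex P (fun w => a w * b w) = Ex P a * Ex P b.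
Proof.
move=> s1 s2 i12 ma mb ia ib; apply: Ex_indep => // A B mA mB.
by apply: i12; [exact: (admP _ s1).1|exact: (admP _ s2).1].
Qed.

Lemma x2_Ex j k : Ex P (fun w => x j w * x k w) = (j == k)%:R.
Proof.
have [<-|jk] := eqVneq j k; first by rewrite -(noise_E2 Nx j).
have /(_ (fun w => x j w) (fun w => x k w)) [] //:= Ex_indep_adm (sigma_gen_sa _) (sigma_gen_sa _)
  (@indep_rvs_groups _ _ _ P _ x (pred1 j) (pred1 k) unit unit (fun=> j) (fun=> k)
   (noise_mf Nx) (noise_rvs Nx) _ (fun=> eqxx j) (fun=> eqxx k)).
- by move=> i /eqP-> /eqP kj; rewrite kj eqxx in jk.
- exact: (sigma_gen_adm (fun=> x j) tt).
- exact: (sigma_gen_adm (fun=> x k) tt).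
- exact: x1_L1.
- exact: x1_L1.
- by move=> _ ->; rewrite (noise_E1 Nx) mul0r.
Qed.

(* one factor whose index differs from the two others splits off *)
Let x3_Ex_split i j k : i != k -> j != k -> Ex P (fun w => x i w * x j w * x k w) = 0.
Proof.
move=> ik jk.
have /(_ (fun w => x i w * x j w) (fun w => x k w)) [] //:= Ex_indep_adm (sigma_gen_sa _) (sigma_gen_sa _)
  (@indep_rvs_groups _ _ _ P _ x (pred2 i j) (pred1 k) bool unit
    (fun b => if b then i else j) (fun=> k)
   (noise_mf Nx) (noise_rvs Nx) _ _ (fun=> eqxx k)).
- by move=> l /orP[] /eqP-> /eqP E; rewrite E eqxx in ik jk.
- by move=> [] /=; rewrite eqxx ?orbT.
- apply: admM; first exact: (sigma_gen_adm (fun b : bool => x (if b then i else j)) true).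
  exact: (sigma_gen_adm (fun b : bool => x (if b then i else j)) false).
- exact: (sigma_gen_adm (fun=> x k) tt).
- exact: x2_L1.
- exact: x1_L1.
- by move=> _ ->; rewrite (noise_E1 Nx) mulr0.
Qed.

Lemma x3_Ex i j k : Ex P (fun w => x i w * x j w * x k w) = 0.
Proof.
have [<-|ij] := eqVneq i j.
  have [<-|ik] := eqVneq i k; last exact: x3_Ex_split.
  by rewrite -(noise_E3 Nx i); congr Ex; apply/funext => w; rewrite !exprS expr0 mulr1 mulrA.
have [<-|ik] := eqVneq i k.
  rewrite -[RHS](@x3_Ex_split i i j) //.
  by congr Ex; apply/funext => w; rewrite mulrAC.
rewrite -[RHS](@x3_Ex_split j k i) 1?eq_sym //.
by congr Ex; apply/funext => w; ring.
Qed.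

Lemma Ex_noise a b : adm G a -> L1 P a -> adm (sigma_gen x) b -> L1 P b ->
  L1 P (fun w => a w * b w) /\ Ex P (fun w => a w * b w) = Ex P a * Ex P b.
Proof.
by move=> ma ia mb ib; apply: (Ex_indep_adm (noise_sa Nx) (sigma_gen_sa _) (noise_indep Nx)).
Qed.

Lemma Ex_noise1 a k : adm G a -> L1 P a ->
  L1 P (fun w => a w * x k w) /\ Ex P (fun w => a w * x k w) = 0.
Proof.
move=> ma ia; have [] := Ex_noise ma ia (sigma_gen_adm x k) (x1_L1 k).
by rewrite (noise_E1 Nx) mulr0.
Qed.

Lemma Ex_noise2 a j k : adm G a -> L1 P a ->
  L1 P (fun w => a w * (x j w * x k w)) /\
  Ex P (fun w => a w * (x j w * x k w)) = Ex P a * (j == k)%:R.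
Proof.
move=> ma ia; have := Ex_noise ma ia (admM (sigma_gen_adm x j) (sigma_gen_adm x k)) (x2_L1 j k).
by rewrite x2_Ex.
Qed.

Lemma Ex_noise3 a i j k : adm G a -> L1 P a ->
  L1 P (fun w => a w * (x i w * x j w * x k w)) /\
  Ex P (fun w => a w * (x i w * x j w * x k w)) = 0.
Proof.
move=> ma ia; have [] := Ex_noise ma ia (admM (admM (sigma_gen_adm x i) (sigma_gen_adm x j))
  (sigma_gen_adm x k)) (x3_L1 i j k).
by rewrite x3_Ex mulr0.
Qed.
End with_noise.
End noise_moments.

(** * Symmetric laws and moments of Gaussian increments *)

Section symmetric_law.
Context {R : realType}.
Variable nu : probability R R.

Lemma Ex_odd (f : R -> R) :
  (forall B, measurable B -> nu ((fun x : R => - x) @^-1` B) = nu B) ->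
  L1 nu f -> (forall x, f (- x) = - f x) -> Ex nu f = 0.
Proof.
move=> sym iF fodd.
have mopp : measurable_fun setT (fun x : R => - x) by exact: oppr_measurable.
pose N : {RV nu >-> R} := mfun_Sub (mem_set mopp).
have E1 : Ex nu f = Ex nu (fun x => f (- x)).
  rewrite /Ex /Rintegral; congr fine.
  rewrite -(@integral_distribution _ _ _ _ _ nu N (EFin \o f)).
  - by apply: eq_measure_integral => B mB _ /=; rewrite -[LHS]sym.
  - exact: measurable_int iF.
  - have := L1N iF; apply: eq_integrable => // x _ /=.
    by rewrite /N /= fodd.
have E2 : Ex nu (fun x => f (- x)) = - Ex nu f.
  rewrite -mulN1r -ExZ //; congr Ex; apply/funext => x.
  by rewrite mulN1r fodd.
by move: E1; rewrite E2; lra.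
Qed.

Lemma Ex_law {disp : measure_display} {Omega : measurableType disp}
  (P : probability Omega R) (X : Omega -> R) (f : R -> R) :
  measurable_fun setT X ->
  (forall B, measurable B -> P (X @^-1` B) = nu B) -> L1 nu f ->
  L1 P (fun w => f (X w)) /\ Ex P (fun w => f (X w)) = Ex nu f.
Proof.
move=> mX XB iF.
pose X' : {RV P >-> R} := mfun_Sub (mem_set mX).
have i1 : L1 P (fun w => f (X w)).
  apply/integrableP; split.
    apply/measurable_EFinP; apply: measurableT_comp => //; exact: L1_meas iF.
  have [mf fi] := integrableP _ _ _ iF.
  rewrite -(ge0_integral_distribution X' (f := fun z => `|(f z)%:E|%E)) //.
    rewrite (eq_measure_integral nu) // => B mB _; exact: XB.
  exact: measurableT_comp.
split=> //; rewrite /Ex /Rintegral; congr fine.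
rewrite -[LHS](@integral_distribution _ _ _ _ _ P X' (EFin \o f)) //.
  by apply: eq_measure_integral => B mB _; exact: XB.
exact: measurable_int iF.
Qed.
End symmetric_law.

Section exp_bounds.
Context {R : realType}.
Implicit Types u v x : R.

Lemma ge0_of_derive (f f' : R -> R) : (forall x, is_derive x 1 f (f' x)) ->
  f 0 = 0 -> (forall x, 0 <= x -> 0 <= f' x) -> forall x, 0 <= x -> 0 <= f x.
Proof.
move=> df f0 f'0 x x0; rewrite -f0.
apply: (@ger0_derive1_ndecry _ f 0) => //.
- move=> y; rewrite in_itv /= andbT => y0.
  by rewrite derive1E; have -> := @derive_val _ _ _ _ _ _ _ (df y); exact/f'0/ltW.
- apply: continuous_subspaceT => y; apply/differentiable_continuous.
  by apply/derivable1_diffP; case: (df y).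
Qed.

Lemma expR_add_ge2 v : 2 <= expR v + expR (- v).
Proof.
have : 0 <= (expR (v / 2) - expR (- (v / 2))) ^+ 2 by exact: sqr_ge0.
rewrite sqrrB -!expRM_natl -expRD subrr expR0.
rewrite (_ : 2%:R * (v / 2) = v); last by field.
rewrite (_ : 2%:R * - (v / 2) = - v); last by field.
lra.
Qed.

(** The difference of the two sides vanishes at 0 and its derivative has a sign. *)
Lemma sinh_bounds v : 0 <= v -> 2 * v <= expR v - expR (- v) <= v * (expR v + expR (- v)).
Proof.
have dN x : is_derive x 1 (fun x => expR (- x)) (- expR (- x)).
  by apply: is_derive_eq; rewrite mulrN1.
have S x : 0 <= x -> 0 <= expR x - expR (- x) - 2 * x.
  apply: (@ge0_of_derive (fun x => expR x - expR (- x) - 2 * x) (fun x => expR x + expR (- x) - 2)).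
  - by move=> y; apply: is_derive_eq; rewrite /GRing.scale /=; lra.
  - by rewrite oppr0 mulr0; lra.
  - by move=> y _; have := expR_add_ge2 y; lra.
have C x : 0 <= x -> 0 <= x * (expR x + expR (- x)) - (expR x - expR (- x)).
  apply: (@ge0_of_derive (fun x => x * (expR x + expR (- x)) - (expR x - expR (- x)))
    (fun x => x * (expR x - expR (- x)))).
  - move=> y; apply: is_derive_eq; rewrite /GRing.scale /=; lra.
  - by rewrite oppr0; lra.
  - by move=> y y0; rewrite mulr_ge0 //; have := S y y0; lra.
by move=> v0; have := S v v0; have := C v v0; lra.
Qed.

(** The sum of the two exponentials minus 2 is the square of twice the hyperbolic sine of [u / 2],
    to which [sinh_bounds] applies twice. *)
Lemma cosh_bounds u :
  0 <= expR u + expR (- u) - 2 - u ^+ 2 <= u ^+ 4 * (expR u + expR (- u)).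
Proof.
wlog u0 : u / 0 <= u.
  move=> H; have [|/ltW u0] := leP 0 u; first exact: H.
  by have := H (- u); rewrite oppr_ge0 opprK sqrrN addrC (@exprNn _ u 4) => /(_ u0); lra.
have /sinh_bounds/andP[] : 0 <= u / 2 by lra.
set a := expR (u / 2); set b := expR (- (u / 2)).
have ua : expR u = a ^+ 2 by rewrite -expRM_natl; congr expR; field.
have ub : expR (- u) = b ^+ 2 by rewrite -expRM_natl; congr expR; field.
have ab : a * b = 1 by rewrite -expRD subrr expR0.
rewrite ua ub => h1 h2.
have a0 : 0 < a by exact: expR_gt0.
have b0 : 0 < b by exact: expR_gt0.
have e1 : a ^+ 2 + b ^+ 2 - 2 = (a - b) ^+ 2 by rewrite sqrrB ab; lra.
have e2 : (a + b) ^+ 2 = (a - b) ^+ 2 + 4 by rewrite sqrrB sqrrD ab; lra.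
have l1 : u ^+ 2 <= (a - b) ^+ 2.
  rewrite lerXn2r // ?nnegrE //; lra.
have l2 : (a - b) ^+ 2 <= (u / 2 * (a + b)) ^+ 2.
  by rewrite lerXn2r // ?nnegrE //; [lra| rewrite mulr_ge0; lra].
have l3 : (u / 2) ^+ 2 * (a - b) ^+ 2 <= (u / 2) ^+ 2 * (u / 2 * (a + b)) ^+ 2.
  by rewrite ler_wpM2l // sqr_ge0.
have E : (u / 2 * (a + b)) ^+ 2 = (u / 2) ^+ 2 * (a - b) ^+ 2 + u ^+ 2.
  by rewrite exprMn e2 mulrDr; congr (_ + _); rewrite expr_div_n; field.
have l4 : (u / 2) ^+ 2 * (u / 2 * (a + b)) ^+ 2 <= u ^+ 4 * (a ^+ 2 + b ^+ 2).
  have -> : (u / 2) ^+ 2 * (u / 2 * (a + b)) ^+ 2 = u ^+ 4 * ((a + b) ^+ 2 / 16) by field.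
  have s2 : (a + b) ^+ 2 <= 2 * (a ^+ 2 + b ^+ 2).
    by have := sqr_ge0 (a - b); rewrite sqrrB sqrrD; lra.
  rewrite ler_wpM2l ?(@exprn_even_ge0 _ 4) //.
  have := sqr_ge0 a; have := sqr_ge0 b; lra.
by rewrite e1; apply/andP; split; lra.
Qed.

Lemma pow_le_exp n x : `|x| ^+ n.+1 <= (n.+1)`!%:R * (expR x + expR (- x)).
Proof.
have f0 : 0 < (n.+1)`!%:R :> R by rewrite ltr0n fact_gt0.
have h : `|x| ^+ n.+1 <= (n.+1)`!%:R * expR `|x|.
  rewrite mulrC -ler_pdivrMr //; apply: le_trans (expR_ge1Dxn n (normr_ge0 x)).
  by rewrite lerDr.
apply: (le_trans h); rewrite ler_wpM2l ?(ltW f0) //.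
have e1 := expR_ge0 x; have e2 := expR_ge0 (- x).
have /orP[x0|x0] := le_total 0 x; first by rewrite ger0_norm //; lra.
by rewrite ler0_norm //; lra.
Qed.
End exp_bounds.

Section gaussian.
Context {R : realType}.
Variable s : R.
Hypothesis s0 : 0 < s.
Local Notation mu := (@lebesgue_measure R).
Local Notation gam0 := (normal_prob 0 s : probability (measurableTypeR R) R).

Lemma idR_measurable : @measurable_fun _ default_measure_display (measurableTypeR R) R setT (fun x => x).
Proof. by move=> _ B mB; rewrite setTI. Qed.

Definition idR : {RV gam0 >-> R} := 
  @mfun_Sub _ default_measure_display (measurableTypeR R) R _ (mem_set idR_measurable).

(** The centred normal law as a measure for the canonical Borel structure of
    the reals. *)
Definition gauss : probability R R := distribution gam0 idR.

Lemma gaussE (B : set R) : gauss B = normal_prob 0 s B.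
Proof. by []. Qed.

Lemma normal_symmetric (B : set R) : measurable B ->
  gauss ((fun x : R => - x) @^-1` B) = gauss B.
Proof.
move=> mB; rewrite !gaussE /normal_prob.
have sN : s != 0 by rewrite gt_eqF.
have pN x : normal_pdf 0 s (- x) = normal_pdf 0 s x.
  by rewrite !normal_pdfE // /normal_fun !subr0 sqrrN.
transitivity (\int[pushforward mu (-%R : _ -> measurableTypeR R)]_(x in B) (normal_pdf 0 s x)%:E)%E.
  rewrite ge0_integral_pushforward //=.
  - by apply: eq_integral => x _; rewrite pN.
  - by apply: measurable_funTS; apply/measurable_EFinP; exact: measurable_normal_pdf.
  - by move=> x _; rewrite lee_fin normal_pdf_ge0.
apply: eq_measure_integral => A mA _; exact: lebesgue_measureN.
Qed.

Lemma ge0_integral_normal (f : R -> R) : measurable_fun setT f ->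
  (forall x, 0 <= f x) ->
  (\int[gauss]_x (f x)%:E = \int[mu]_x (f x * normal_pdf 0 s x)%:E)%E.
Proof.
move=> mf f0.
have dom := normal_prob_dominates 0 s.
rewrite (ge0_integral_distribution idR (f := EFin \o f)) //; last exact/measurable_EFinP.
have mEf : measurable_fun setT (EFin \o f) by exact/measurable_EFinP.
rewrite -(@Radon_Nikodym_SigmaFinite.change_of_variables _ _ _ gam0 mu dom) //.
apply: ae_eq_integral => //.
- apply: emeasurable_funM => //; apply: (measurable_int mu).
  exact: Radon_Nikodym_SigmaFinite.f_integrable.
- by apply/measurable_EFinP; apply: measurable_funM => //; exact: measurable_normal_pdf.
under [X in ae_eq _ _ _ X]eq_fun do rewrite EFinM.
apply: ae_eqe_mul2l => /=.
apply: integral_ae_eq => //=.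
- exact: Radon_Nikodym_SigmaFinite.f_integrable.
- by apply/measurable_EFinP; exact: measurable_normal_pdf.
- by move=> E _ mE; rewrite -Radon_Nikodym_SigmaFinite.f_integral.
Qed.

(** Completing the square turns the integrand into a multiple of the normal
    density centred at [s ^+ 2 * t]. *)
Lemma normal_mgf t : L1 gauss (fun x => expR (t * x)) /\
  Ex gauss (fun x => expR (t * x)) = expR (s ^+ 2 * t ^+ 2 / 2).
Proof.
have sN : s != 0 by rewrite gt_eqF.
have me : measurable_fun setT (fun x : R => expR (t * x)).
  by apply: measurableT_comp => //; exact: mulrl_measurable.
have E : (\int[gauss]_x (expR (t * x))%:E = (expR (s ^+ 2 * t ^+ 2 / 2))%:E)%E.
  rewrite ge0_integral_normal //.
  have -> : (\int[mu]_x (expR (t * x) * normal_pdf 0 s x)%:E =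
     \int[mu]_x ((expR (s ^+ 2 * t ^+ 2 / 2))%:E * (normal_pdf (s ^+ 2 * t) s x)%:E))%E.
    apply: eq_integral => x _; rewrite -EFinM; congr EFin.
    rewrite !normal_pdfE // /normal_fun mulrCA [RHS]mulrCA; congr (_ * _).
    by rewrite -!expRD; congr expR; field.
  rewrite ge0_integralZl_EFin //.
  - by rewrite integral_normal_pdf mule1.
  - by move=> x _; rewrite lee_fin normal_pdf_ge0.
  - by apply/measurable_EFinP; exact: measurable_normal_pdf.
split; last by rewrite /Ex /Rintegral E.
apply/integrableP; split; first exact/measurable_EFinP.
under eq_integral do rewrite /= ger0_norm ?expR_ge0 //.
by rewrite E ltry.
Qed.


(** The right-hand side of [gauss_pow8] without its factor [s ^+ 8], integrated: the
    moment generating function at [s^-1] does not depend on [s]. *)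
Definition gauss8 : R := 8`!%:R * (expR (2^-1) + expR (2^-1)).

Lemma gauss_L1exp t : L1 gauss (fun x => expR (t * x) + expR (- (t * x))).
Proof.
apply: L1D; first by case: (normal_mgf t).
have [+ _] := normal_mgf (- t).
by apply: eq_integrable => // x _; rewrite /= mulNr.
Qed.

Lemma gauss_Exexp t : Ex gauss (fun x => expR (t * x) + expR (- (t * x))) =
  2 * expR (s ^+ 2 * t ^+ 2 / 2).
Proof.
have [i1 e1] := normal_mgf t; have [i2 e2] := normal_mgf (- t).
have E : (fun x => expR (- t * x)) = (fun x => expR (- (t * x))).
  by apply/funext => x; rewrite mulNr.
rewrite ExD //; last by rewrite -E.
by rewrite e1 -E e2 sqrrN; lra.
Qed.

Lemma gauss_pow8 (x : R) : x ^+ 8 <= s ^+ 8 * (8`!%:R * (expR (s^-1 * x) + expR (- (s^-1 * x)))).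
Proof.
have := pow_le_exp 7 (s^-1 * x); rewrite normrM exprMn.
rewrite -[`|x| ^+ 8]normrX (@ger0_norm _ (x ^+ 8)); last exact: (@exprn_even_ge0 _ 8).
rewrite (@ger0_norm _ s^-1) ?invr_ge0 ?(ltW s0) // exprVn mulrC ler_pdivrMr ?exprn_gt0 //.
by rewrite [X in _ <= X]mulrC.
Qed.

Lemma gauss_L8 : L1 gauss (fun x => x ^+ 8).
Proof.
apply: (L1_dom (g := fun x => s ^+ 8 * (8`!%:R * (expR (s^-1 * x) + expR (- (s^-1 * x)))))).
- exact: exprn_measurable.
- by do 2 apply: L1Z; exact: gauss_L1exp.
- by move=> x; rewrite ger0_norm; [exact: gauss_pow8|exact: (@exprn_even_ge0 _ 8)].
Qed.

Lemma gauss_E8 : Ex gauss (fun x => x ^+ 8) <= s ^+ 8 * gauss8.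
Proof.
apply: (@le_trans _ _ (Ex gauss (fun x => s ^+ 8 * (8`!%:R * (expR (s^-1 * x) + expR (- (s^-1 * x))))))).
  apply: Ex_le; first exact: gauss_L8.
    by do 2 apply: L1Z; exact: gauss_L1exp.
  exact: gauss_pow8.
rewrite ExZ; last by apply: L1Z; exact: gauss_L1exp.
rewrite ExZ; last exact: gauss_L1exp.
rewrite gauss_Exexp /gauss8 exprVn divff ?gt_eqF ?exprn_gt0 // mul1r.
by rewrite !ler_wpM2l ?exprn_ge0 ?(ltW s0) //; lra.
Qed.

Lemma gauss_Lp p : (p <= 8)%N -> L1 gauss (fun x => x ^+ p).
Proof.
move=> p8; apply: (@L1_dom _ _ _ _ _ (fun x : R => 1 + x ^+ 8)).
- exact: exprn_measurable.
- by apply: L1D; [exact: L1_cst|exact: gauss_L8].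
- move=> x; rewrite normrX.
  rewrite -[x ^+ 8](@ger0_norm _ (x ^+ 8)); last exact: (@exprn_even_ge0 _ 8).
  rewrite normrX; have [x1|x1] := leP 1 `|x|.
    by apply: (le_trans (ler_weXn2l x1 p8)); rewrite lerDr.
  by rewrite (@le_trans _ _ 1) ?lerDl ?exprn_ge0 // exprn_ile1 // ltW.
Qed.

Lemma gauss_E1 : Ex gauss (fun x => x) = 0.
Proof.
apply: Ex_odd => //; first exact: normal_symmetric.
by have := @gauss_Lp 1 isT.
Qed.

Lemma gauss_E3 : Ex gauss (fun x => x ^+ 3) = 0.
Proof.
apply: Ex_odd => //; [exact: normal_symmetric|exact: gauss_Lp|].
by move=> x; rewrite exprNn; lra.
Qed.

Let K : R := Ex gauss (fun x => 48 * (expR (2 * x) + expR (- (2 * x)))).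

(** Both exponential moments are expanded to fourth order; letting [t] tend to
    0 then identifies the variance without differentiating under the integral. *)
Lemma gauss_E2_approx t : 0 <= t <= 1 ->
  0 <= 2 * expR (s ^+ 2 * t ^+ 2 / 2) - 2 - t ^+ 2 * Ex gauss (fun x => x ^+ 2) <= t ^+ 4 * K.
Proof.
move=> /andP[t0 t1].
have Kb (x : R) : x ^+ 4 * (expR (t * x) + expR (- (t * x))) <=
    48 * (expR (2 * x) + expR (- (2 * x))).
  have x4 : x ^+ 4 <= 24 * (expR x + expR (- x)).
    by have := pow_le_exp 3 x; rewrite -normrX (@ger0_norm _ (x ^+ 4)) // (@exprn_even_ge0 _ 4).
  have te : expR (t * x) + expR (- (t * x)) <= expR x + expR (- x).
    wlog x0 : x {x4} / 0 <= x.
      move=> H; have [|/ltW x0] := lerP 0 x; first exact: H.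
      by have := H (- x); rewrite oppr_ge0 mulrN !opprK => /(_ x0); lra.
    have h1 : expR (t * x) <= expR x by rewrite ler_expR ler_piMl.
    have h2 : expR (- x) * expR (- (t * x)) <= 1.
      by rewrite -expRD -expR0 ler_expR -opprD oppr_le0 addr_ge0 // mulr_ge0.
    have e1 : expR x * expR (- x) = 1 by rewrite -expRD subrr expR0.
    have e2 : expR (t * x) * expR (- (t * x)) = 1 by rewrite -expRD subrr expR0.
    have : 0 <= (expR x - expR (t * x)) * (1 - expR (- x) * expR (- (t * x))).
      by rewrite mulr_ge0 // subr_ge0.
    have -> : (expR x - expR (t * x)) * (1 - expR (- x) * expR (- (t * x))) =
      expR x - expR (t * x) - (expR x * expR (- x)) * expR (- (t * x)) +
      (expR (t * x) * expR (- (t * x))) * expR (- x) by ring.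
    by rewrite e1 e2; lra.
  have c0 : 0 <= expR x + expR (- x) by rewrite addr_ge0 // expR_ge0.
  apply: (@le_trans _ _ (24 * (expR x + expR (- x)) * (expR x + expR (- x)))).
    by rewrite ler_pM ?(@exprn_even_ge0 _ 4) // addr_ge0 // expR_ge0.
  have -> : expR (- (2 * x)) = expR (- x) ^+ 2 by rewrite -expRM_natl mulrN.
  rewrite expRM_natl; have := sqr_ge0 (expR x - expR (- x)).
  by rewrite sqrrB; lra.
have iC := gauss_L1exp t.
have iX := gauss_Lp (isT : 2 <= 8)%N.
have iD : L1 gauss (fun x => expR (t * x) + expR (- (t * x)) - 2 - t ^+ 2 * x ^+ 2).
  by apply: L1B; [apply: L1B => //; exact: L1_cst|exact: L1Z].
have ED : Ex gauss (fun x => expR (t * x) + expR (- (t * x)) - 2 - t ^+ 2 * x ^+ 2) =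
   2 * expR (s ^+ 2 * t ^+ 2 / 2) - 2 - t ^+ 2 * Ex gauss (fun x => x ^+ 2).
  rewrite ExB; [|by apply: L1B => //; exact: L1_cst|exact: L1Z].
  by rewrite ExB //; [rewrite gauss_Exexp Ex_cst ExZ|exact: L1_cst].
rewrite -ED; apply/andP; split.
  apply: Ex_ge0 => x; have /andP[+ _] := cosh_bounds (t * x).
  by rewrite exprMn.
have iK : L1 gauss (fun x => 48 * (expR (2 * x) + expR (- (2 * x)))).
  by apply: L1Z; exact: gauss_L1exp.
rewrite -ExZ //; apply: Ex_le => //; first exact: L1Z.
move=> x; have /andP[_] := cosh_bounds (t * x); rewrite exprMn => /le_trans; apply.
by rewrite exprMn -mulrA ler_wpM2l // exprn_ge0.
Qed.

Lemma gauss_E2 : Ex gauss (fun x => x ^+ 2) = s ^+ 2.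
Proof.
set m := Ex _ _.
have K0 : 0 <= K.
  by apply: Ex_ge0 => x; rewrite mulr_ge0 // addr_ge0 // expR_ge0.
apply/eqP; rewrite -subr_eq0 -normr_le0 leNgt; apply/negP => D0.
set D := `|_| in D0.
pose den := 1 + s ^+ 2 + 2 * (s ^+ 4 + K) / D.
have s2 : 0 < s ^+ 2 by rewrite exprn_gt0.
have s4 : 0 < s ^+ 4 by rewrite exprn_gt0.
have q0 : 0 <= 2 * (s ^+ 4 + K) / D by rewrite divr_ge0 ?(ltW D0) //; lra.
have den0 : 0 < den by rewrite /den; lra.
pose u := den^-1.
have u0 : 0 < u by rewrite invr_gt0.
have ud : u * den = 1 by rewrite mulVf // gt_eqF.
have u1 : u <= 1 by rewrite invf_le1 //; rewrite /den; lra.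
have us : s ^+ 2 * u <= 1.
  by rewrite mulrC -ud ler_wpM2l ?(ltW u0) // /den; lra.
have uK : (s ^+ 4 + K) * u < D.
  have h : u * (2 * (s ^+ 4 + K) / D) <= 1.
    by rewrite -[X in _ <= X]ud ler_wpM2l ?(ltW u0) // /den; lra.
  have := ler_wpM2r (ltW D0) h; rewrite mul1r.
  have -> : u * (2 * (s ^+ 4 + K) / D) * D = 2 * ((s ^+ 4 + K) * u) by field; rewrite gt_eqF.
  lra.
have tu : Num.sqrt u ^+ 2 = u by rewrite sqr_sqrtr // ltW.
have tu4 : Num.sqrt u ^+ 4 = u ^+ 2 by rewrite -[in RHS]tu -exprM.
have t01 : 0 <= Num.sqrt u <= 1.
  by rewrite sqrtr_ge0 -sqrtr1 ler_wsqrtr.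
have /andP[] := gauss_E2_approx t01; rewrite tu tu4 -/m => lo hi.
pose a := s ^+ 2 * u / 2; rewrite -/a in lo hi.
have a0 : 0 < a by rewrite /a divr_gt0 // mulr_gt0.
have a1 : a <= 1 / 2 by rewrite /a; lra.
have ea := expR_ge1Dx a.
have eb : expR a <= 1 + a + 2 * a ^+ 2.
  have en := expR_ge1Dx (- a).
  have ee : expR a * expR (- a) = 1 by rewrite -expRD subrr expR0.
  have h1 : expR a * (1 - a) <= 1 by rewrite -[X in _ <= X]ee ler_wpM2l // expR_ge0.
  have h2 : 1 <= (1 + a + 2 * a ^+ 2) * (1 - a).
    have : 0 <= a ^+ 2 * (1 - 2 * a) by rewrite mulr_ge0 ?sqr_ge0 //; lra.
    lra.
  have h3 : 0 < 1 - a by lra.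
  by rewrite -(ler_pM2r h3) (le_trans h1).
have a2 : 4 * a ^+ 2 = s ^+ 4 * u ^+ 2 by rewrite /a; field.
have lo' : u * m <= s ^+ 2 * u + s ^+ 4 * u ^+ 2 by rewrite -a2; rewrite /a in eb lo *; lra.
have hi' : s ^+ 2 * u - u ^+ 2 * K <= u * m by rewrite /a in ea hi *; lra.
have : D <= (s ^+ 4 + K) * u.
  rewrite /D ler_norml; apply/andP; split; rewrite -(ler_pM2l u0).
    have : 0 <= s ^+ 4 * u ^+ 2 by rewrite mulr_ge0 ?(ltW s4) // exprn_ge0 // ltW.
    lra.
  have : 0 <= K * u ^+ 2 by rewrite mulr_ge0 // exprn_ge0 // ltW.
  lra.
lra.
Qed.
End gaussian.

(** * Euclidean vectors and matrices *)

Section euclid.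
Context {R : realType} {m : nat}.
Implicit Types (x y z u v w : 'cV[R]_m) (A B : 'M[R]_m) (a c : R).

Definition dot x y : R := \sum_i x i 0 * y i 0.
Definition nrm x : R := Num.sqrt (dot x x).

Lemma dotC x y : dot x y = dot y x.
Proof. by apply: eq_bigr => i _; rewrite mulrC. Qed.

Lemma dotDl x y z : dot (x + y) z = dot x z + dot y z.
Proof. by rewrite -big_split /=; apply: eq_bigr => i _; rewrite mxE mulrDl. Qed.

Lemma dotDr x y z : dot x (y + z) = dot x y + dot x z.
Proof. by rewrite dotC dotDl !(dotC _ x). Qed.

Lemma dotZl a x y : dot (a *: x) y = a * dot x y.
Proof. by rewrite mulr_sumr; apply: eq_bigr => i _; rewrite mxE mulrA. Qed.

Lemma dotZr a x y : dot x (a *: y) = a * dot x y.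
Proof. by rewrite dotC dotZl dotC. Qed.

Lemma dotNl x y : dot (- x) y = - dot x y.
Proof. by rewrite -scaleN1r dotZl mulN1r. Qed.

Lemma dotNr x y : dot x (- y) = - dot x y.
Proof. by rewrite dotC dotNl dotC. Qed.

Lemma dotBl x y z : dot (x - y) z = dot x z - dot y z.
Proof. by rewrite dotDl dotNl. Qed.

Lemma dotBr x y z : dot x (y - z) = dot x y - dot x z.
Proof. by rewrite dotDr dotNr. Qed.

Lemma dot0l x : dot 0 x = 0.
Proof. by rewrite -(scale0r 0) dotZl mul0r. Qed.

Lemma dot0r x : dot x 0 = 0.
Proof. by rewrite dotC dot0l. Qed.

Lemma dot_suml (I : Type) (s : seq I) (Q : pred I) (X : I -> 'cV[R]_m) y :
  dot (\sum_(i <- s | Q i) X i) y = \sum_(i <- s | Q i) dot (X i) y.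
Proof.
by elim/big_rec2 : _ => [|i u v _ <-]; rewrite ?dot0l ?dotDl.
Qed.

Lemma dot_sumr (I : Type) (s : seq I) (Q : pred I) (X : I -> 'cV[R]_m) y :
  dot y (\sum_(i <- s | Q i) X i) = \sum_(i <- s | Q i) dot y (X i).
Proof. by rewrite dotC dot_suml; apply: eq_bigr => i _; rewrite dotC. Qed.

Lemma dot_ge0 x : 0 <= dot x x.
Proof. by apply: sumr_ge0 => i _; rewrite -expr2 sqr_ge0. Qed.

Lemma dot_tr A x y : dot x (A *m y) = dot (A^T *m x) y.
Proof.
rewrite /dot; under eq_bigr do rewrite mxE mulr_sumr.
rewrite exchange_big /=; apply: eq_bigr => j _.
by rewrite mxE mulr_suml; apply: eq_bigr => i _; rewrite mxE mulrCA mulrA.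
Qed.

Lemma nrm_ge0 x : 0 <= nrm x.
Proof. exact: sqrtr_ge0. Qed.

Lemma nrm_sqr x : nrm x ^+ 2 = dot x x.
Proof. by rewrite sqr_sqrtr // dot_ge0. Qed.

Lemma nrm0 : nrm 0 = 0.
Proof. by rewrite /nrm dot0l sqrtr0. Qed.

Lemma nrm_eq0 x : (nrm x == 0) = (x == 0).
Proof.
apply/eqP/eqP => [|->]; last exact: nrm0.
move=> n0; have : dot x x = 0 by rewrite -nrm_sqr n0 expr0n.
move/psumr_eq0P => H; apply/matrixP => i j; rewrite ord1 mxE.
by apply/eqP; rewrite -sqrf_eq0 expr2 H // => k _; rewrite -expr2 sqr_ge0.
Qed.

Lemma nrmZ a x : nrm (a *: x) = `|a| * nrm x.
Proof.
by rewrite /nrm dotZl dotZr mulrA -expr2 sqrtrM ?sqr_ge0 // sqrtr_sqr.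
Qed.

Lemma nrmN x : nrm (- x) = nrm x.
Proof. by rewrite -scaleN1r nrmZ normrN1 mul1r. Qed.

Lemma cauchy_schwarz x y : `|dot x y| <= nrm x * nrm y.
Proof.
have [/eqP|y0] := eqVneq (nrm y) 0.
  by rewrite nrm_eq0 => /eqP ->; rewrite dot0r normr0 nrm0 mulr0.
have ny : 0 < nrm y by rewrite lt_def y0 nrm_ge0.
have := dot_ge0 (nrm y ^+ 2 *: x - dot x y *: y).
rewrite !(dotBl, dotBr, dotZl, dotZr) (dotC y x) -!nrm_sqr => h.
have {}h : dot x y ^+ 2 <= (nrm x * nrm y) ^+ 2.
  have n2 : 0 < nrm y ^+ 2 by rewrite exprn_gt0.
  by rewrite -subr_ge0 -(pmulr_rge0 _ n2); move: h; congr (_ <= _); ring.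
rewrite -(@ler_pXn2r _ 2) // ?nnegrE ?mulr_ge0 ?nrm_ge0 //.
by rewrite -normrX ger0_norm // sqr_ge0.
Qed.

Lemma dot_le x y : dot x y <= nrm x * nrm y.
Proof. exact: le_trans (ler_norm _) (cauchy_schwarz x y). Qed.

Lemma nrmD x y : nrm (x + y) <= nrm x + nrm y.
Proof.
rewrite -(@ler_pXn2r _ 2) // ?nnegrE ?addr_ge0 ?nrm_ge0 //.
rewrite nrm_sqr sqrrD !nrm_sqr !(dotDl, dotDr) (dotC y x).
by have := dot_le x y; lra.
Qed.

Lemma nrmB x y : nrm (x - y) <= nrm x + nrm y.
Proof. by rewrite -[nrm y]nrmN; exact: nrmD. Qed.

Lemma nrm_sum (I : Type) (s : seq I) (Q : pred I) (X : I -> 'cV[R]_m) :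
  nrm (\sum_(i <- s | Q i) X i) <= \sum_(i <- s | Q i) nrm (X i).
Proof.
elim/big_rec2 : _ => [|i u v _ h]; first by rewrite nrm0.
by apply: (le_trans (nrmD _ _)); rewrite lerD2l.
Qed.

Lemma coord_le x i : `|x i 0| <= nrm x.
Proof.
rewrite -(@ler_pXn2r _ 2) // ?nnegrE ?nrm_ge0 // nrm_sqr -normrX ger0_norm ?sqr_ge0 //.
by rewrite /dot (bigD1 i) //= -expr2 lerDl sumr_ge0 // => j _; rewrite -expr2 sqr_ge0.
Qed.

Lemma sumr_sqr_le (I : Type) (s : seq I) (f : I -> R) : (forall i, 0 <= f i) ->
  \sum_(i <- s) f i ^+ 2 <= (\sum_(i <- s) f i) ^+ 2.
Proof.
move=> f0; elim: s => [|i s IH]; first by rewrite !big_nil expr0n.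
rewrite !big_cons sqrrD; have : 0 <= f i * \sum_(j <- s) f j.
  by rewrite mulr_ge0 // sumr_ge0.
by move: IH; set S := \sum_(j <- s) f j; set S2 := \sum_(j <- s) _; lra.
Qed.

Lemma nrm_le_l1 x : nrm x <= \sum_i `|x i 0|.
Proof.
rewrite -(@ler_pXn2r _ 2) // ?nnegrE ?nrm_ge0 ?sumr_ge0 // nrm_sqr.
apply: le_trans (sumr_sqr_le _ (fun i => normr_ge0 _)).
by apply: ler_sum => i _; rewrite -normrX ger0_norm ?sqr_ge0.
Qed.

(** The entrywise l1 norm, which is submultiplicative and dominates the
    operator norm. *)
Definition mn B : R := \sum_i \sum_j `|B i j|.

Lemma mn_ge0 B : 0 <= mn B.
Proof. by apply: sumr_ge0 => i _; apply: sumr_ge0. Qed.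

Lemma mnD A B : mn (A + B) <= mn A + mn B.
Proof.
rewrite -big_split /=; apply: ler_sum => i _; rewrite -big_split /=.
by apply: ler_sum => j _; rewrite mxE ler_normD.
Qed.

Lemma mnZ a B : mn (a *: B) = `|a| * mn B.
Proof.
rewrite mulr_sumr; apply: eq_bigr => i _; rewrite mulr_sumr.
by apply: eq_bigr => j _; rewrite mxE normrM.
Qed.

Lemma mn0 : mn 0 = 0.
Proof. by rewrite -(scale0r 0) mnZ normr0 mul0r. Qed.

Lemma mn_sum (I : Type) (s : seq I) (Q : pred I) (X : I -> 'M[R]_m) :
  mn (\sum_(i <- s | Q i) X i) <= \sum_(i <- s | Q i) mn (X i).
Proof.
elim/big_rec2 : _ => [|i u v _ h]; first by rewrite mn0.
by apply: (le_trans (mnD _ _)); rewrite lerD2l.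
Qed.

Lemma mn_tr B : mn B^T = mn B.
Proof.
rewrite /mn exchange_big /=; apply: eq_bigr => i _.
by apply: eq_bigr => j _; rewrite mxE.
Qed.

Lemma mnM A B : mn (A *m B) <= mn A * mn B.
Proof.
rewrite mulr_suml; apply: ler_sum => i _; rewrite mulr_suml.
have -> : \sum_(k < m) `|A i k| * mn B = \sum_k \sum_l \sum_j `|A i k| * `|B l j|.
  by apply: eq_bigr => k _; rewrite mulr_sumr; apply: eq_bigr => l _; rewrite mulr_sumr.
apply: (@le_trans _ _ (\sum_(j < m) \sum_(k < m) `|A i k| * `|B k j|)).
  apply: ler_sum => j _; rewrite mxE; apply: (le_trans (ler_norm_sum _ _ _)).
  by apply: ler_sum => k _; rewrite normrM.
rewrite exchange_big /=; apply: ler_sum => k _.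
rewrite [leRHS](bigD1 k) //= lerDl sumr_ge0 // => l _.
by apply: sumr_ge0 => j _; rewrite mulr_ge0.
Qed.

Lemma nrmM B x : nrm (B *m x) <= mn B * nrm x.
Proof.
apply: (le_trans (nrm_le_l1 _)); rewrite mulr_suml; apply: ler_sum => i _.
rewrite mxE mulr_suml; apply: (le_trans (ler_norm_sum _ _ _)).
by apply: ler_sum => j _; rewrite normrM ler_wpM2l // coord_le.
Qed.

Lemma dotM_le B x y : `|dot x (B *m y)| <= mn B * (nrm x * nrm y).
Proof.
apply: (le_trans (cauchy_schwarz _ _)).
by rewrite mulrCA ler_wpM2l ?nrm_ge0 // nrmM.
Qed.
End euclid.

(** * Coefficients of the equation and their generator *)

Section coefficients.
Context {R : realType} {m n : nat}.
Variables (G : 'M[R]_m) (L : 'I_n -> 'M[R]_m).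
Implicit Types (x y z u v w : 'cV[R]_m) (A B : 'M[R]_m).

(** The coefficients of the nonlinear equation in real coordinates: [dif] are the
    diffusion coefficients, [drD] is the nonlinear part of the drift [dri], and
    [lindblad] is the adjoint of the Lindblad generator, acting on observables. *)
Definition ell k z : R := dot z (L k *m z).
Definition dif k z : 'cV[R]_m := L k *m z - ell k z *: z.
Definition drD z : 'cV[R]_m :=
  \sum_k (ell k z *: (L k *m z) - (2^-1 * ell k z ^+ 2) *: z).
Definition dri z : 'cV[R]_m := G *m z + drD z.
Definition lindblad B : 'M[R]_m := G^T *m B + B *m G + \sum_k (L k)^T *m B *m L k.
(** The polarisation of the quadratic form of [B]. *)
Definition bet B x y : R := dot x (B *m y) + dot y (B *m x).

Definition dife (xi : 'I_n -> R) z : 'cV[R]_m := \sum_k xi k *: dif k z.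

Lemma dot_lindblad B z : dot z (lindblad B *m z) =
  bet B z (G *m z) + \sum_k dot (L k *m z) (B *m (L k *m z)).
Proof.
rewrite /lindblad /bet !mulmxDl !dotDr mulmx_suml dot_sumr.
congr (_ + _); last first.
  by apply: eq_bigr => k _; rewrite -!mulmxA dot_tr trmxK.
by rewrite -!mulmxA dot_tr trmxK addrC.
Qed.

(** Ito's formula for quadratic observables: the generator of the nonlinear
    equation sends z^T B z to a quadratic form again, since the terms of degree
    four and six in the drift cancel against those of the quadratic variation. *)
Lemma generator_quadratic B z :
  bet B z (dri z) + \sum_k dot (dif k z) (B *m dif k z) = dot z (lindblad B *m z).
Proof.
rewrite dot_lindblad /bet /dri /drD mulmxDr !dotDl !dotDr -!addrA; congr (_ + _).
rewrite mulmx_sumr dot_sumr dot_suml addrCA; congr (_ + _).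
rewrite -!big_split /=; apply: eq_bigr => k _; rewrite /dif.
rewrite !mulmxBr !(dotBl, dotBr) -!scalemxAr !(dotZl, dotZr).
by set l := ell k z; field.
Qed.

(** On the unit sphere the noise is tangential. *)
Lemma dot_dif k z : dot z (dif k z) = ell k z * (1 - dot z z).
Proof. by rewrite /dif dotBr dotZr -/(ell k z); ring. Qed.

Lemma dif0 k : dif k 0 = 0.
Proof. by rewrite /dif mulmx0 scaler0 subr0. Qed.

Lemma dri0 : dri 0 = 0.
Proof.
by rewrite /dri /drD mulmx0 add0r big1 // => k _; rewrite mulmx0 !scaler0 subr0.
Qed.

Lemma drD0 : drD 0 = 0.
Proof. by rewrite /drD big1 // => k _; rewrite mulmx0 !scaler0 subr0. Qed.

Lemma dife0 xi : dife xi 0 = 0.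
Proof. by rewrite /dife big1 // => k _; rewrite dif0 scaler0. Qed.

(** The coefficients are polynomial, hence Lipschitz on bounded sets. *)
Lemma ell_lip r : exists2 c, 0 <= c & forall k x y, nrm x <= r -> nrm y <= r ->
  `|ell k x - ell k y| <= c * nrm (x - y).
Proof.
have [r0|r0] := ltP r 0.
  by exists 0 => // k x y /le_lt_trans/(_ r0); rewrite ltNge nrm_ge0.
exists (2 * r * \sum_k mn (L k)) => [|k x y xr yr].
  by rewrite !mulr_ge0 // sumr_ge0 // => k _; exact: mn_ge0.
have -> : ell k x - ell k y = dot x (L k *m (x - y)) + dot (x - y) (L k *m y).
  by rewrite /ell mulmxBr dotBr dotBl; ring.
have Lk : mn (L k) <= \sum_k mn (L k).
  by rewrite (bigD1 k) //= lerDl sumr_ge0 // => j _; exact: mn_ge0.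
have d0 := nrm_ge0 (x - y); have L0 := mn_ge0 (L k).
apply: (le_trans (ler_normD _ _)).
have h1 : `|dot x (L k *m (x - y))| <= (\sum_k mn (L k)) * (r * nrm (x - y)).
  apply: (le_trans (dotM_le _ _ _)); apply: ler_pM => //.
    by rewrite mulr_ge0 ?nrm_ge0.
  by rewrite ler_wpM2r.
have h2 : `|dot (x - y) (L k *m y)| <= (\sum_k mn (L k)) * (r * nrm (x - y)).
  apply: (le_trans (dotM_le _ _ _)); apply: ler_pM => //.
    by rewrite mulr_ge0 ?nrm_ge0.
  by rewrite mulrC ler_wpM2r.
by apply: (le_trans (lerD h1 h2)); rewrite le_eqVlt; apply/orP; left; apply/eqP; ring.
Qed.

Lemma ell_bound r : exists2 c, 0 <= c & forall k x, nrm x <= r -> `|ell k x| <= c.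
Proof.
have [c c0 lip] := ell_lip r.
exists (c * `|r|) => [|k x xr]; first by rewrite mulr_ge0.
have := lip k x 0 xr; rewrite nrm0 subr0 (_ : ell k 0 = 0) ?subr0; last by rewrite /ell dot0l.
have r0 : 0 <= r by exact: le_trans (nrm_ge0 x) xr.
by move/(_ r0) => /le_trans; apply; rewrite ler_wpM2l // ger0_norm.
Qed.

Lemma coef_lip r : exists2 c, 0 <= c & forall x y, nrm x <= r -> nrm y <= r ->
  (forall k, nrm (dif k x - dif k y) <= c * nrm (x - y)) /\
  nrm (dri x - dri y) <= c * nrm (x - y).
Proof.
have [r0|r0] := ltP r 0.
  by exists 0 => // x y /le_lt_trans/(_ r0); rewrite ltNge nrm_ge0.
have [c1 c10 lip] := ell_lip r; have [c2 c20 bd] := ell_bound r.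
pose l := \sum_k mn (L k).
have l0 : 0 <= l by rewrite sumr_ge0 // => k _; exact: mn_ge0.
have Lk k : mn (L k) <= l.
  by rewrite /l (bigD1 k) //= lerDl sumr_ge0 // => j _; exact: mn_ge0.
pose cE := l + c1 * r + c2.
pose cD := c1 * (l * r) + c2 * l + 2^-1 * (2 * c2 * c1 * r + c2 ^+ 2).
have cE0 : 0 <= cE by rewrite !addr_ge0 // mulr_ge0.
have cD0 : 0 <= cD.
  by rewrite !(addr_ge0, mulr_ge0) ?exprn_ge0 // invr_ge0.
exists (cE + (mn G + n%:R * cD)) => [|x y xr yr].
  by rewrite addr_ge0 // addr_ge0 ?mn_ge0 // mulr_ge0.
have d0 := nrm_ge0 (x - y).
have Lz k z : nrm (L k *m z) <= l * nrm z.
  by apply: (le_trans (nrmM _ _)); rewrite ler_wpM2r ?nrm_ge0.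
have LD k : nrm (L k *m x - L k *m y) <= l * nrm (x - y) by rewrite -mulmxBr.
have prodB (a b p q : R) (X Y : 'cV[R]_m) : `|a - b| <= p * nrm (x - y) ->
   `|b| <= q -> forall s t, nrm X <= s -> nrm (X - Y) <= t * nrm (x - y) ->
   0 <= p -> 0 <= q ->
   nrm (a *: X - b *: Y) <= (p * s + q * t) * nrm (x - y).
  move=> ab bq s t Xs XY p0 q0.
  have -> : a *: X - b *: Y = (a - b) *: X + b *: (X - Y).
    by rewrite scalerBl scalerBr addrA subrK.
  apply: (le_trans (nrmD _ _)); rewrite !nrmZ mulrDl lerD //.
    rewrite mulrAC; apply: ler_pM => //; exact: nrm_ge0.
  by rewrite -mulrA; apply: ler_pM => //; exact: nrm_ge0.
have xy1 : nrm (x - y) <= 1 * nrm (x - y) by rewrite mul1r.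
have dE k : nrm (dif k x - dif k y) <= cE * nrm (x - y).
  have -> : dif k x - dif k y = (L k *m x - L k *m y) - (ell k x *: x - ell k y *: y).
    by rewrite /dif opprD addrACA -opprD.
  apply: (le_trans (nrmB _ _)).
  have := prodB _ _ _ _ _ _ (lip k x y xr yr) (bd k y yr) _ _ xr xy1 c10 c20.
  by move/(lerD (LD k)) => /le_trans; apply; rewrite /cE; lra.
have dD : nrm (drD x - drD y) <= n%:R * cD * nrm (x - y).
  rewrite /drD -sumrB; apply: (le_trans (nrm_sum _ _ _)).
  have -> : n%:R * cD * nrm (x - y) = \sum_(k < n) cD * nrm (x - y).
    by rewrite sumr_const card_ord -mulrA mulr_natl.
  apply: ler_sum => k _.
  set X := _ - _ *: x; set Y := _ - _ *: y.
  have -> : X - Y = (ell k x *: (L k *m x) - ell k y *: (L k *m y)) -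
     2^-1 *: (ell k x ^+ 2 *: x - ell k y ^+ 2 *: y).
    by rewrite scalerBr !scalerA /X /Y opprD addrACA -opprD.
  apply: (le_trans (nrmB _ _)); rewrite nrmZ ger0_norm ?invr_ge0 //.
  have h1 : nrm (L k *m x) <= l * r.
    by apply: (le_trans (Lz _ _)); rewrite ler_wpM2l.
  have H1 := prodB _ _ _ _ _ _ (lip k x y xr yr) (bd k y yr) _ _ h1 (LD k) c10 c20.
  have sqB : `|ell k x ^+ 2 - ell k y ^+ 2| <= 2 * c2 * c1 * nrm (x - y).
    rewrite subr_sqr normrM mulrC -mulrA; apply: ler_pM => //; last exact: lip.
    by apply: (le_trans (ler_normD _ _)); have := bd k x xr; have := bd k y yr; lra.
  have sqb : `|ell k y ^+ 2| <= c2 ^+ 2.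
    by rewrite normrX lerXn2r // ?nnegrE //; exact: bd.
  have H2 := prodB _ _ _ _ _ _ sqB sqb _ _ xr xy1 _ (sqr_ge0 c2).
  have p0 : 0 <= 2 * c2 * c1 by rewrite !mulr_ge0.
  have {}H2 := H2 p0.
  have H3 : 2^-1 * nrm (ell k x ^+ 2 *: x - ell k y ^+ 2 *: y) <=
    2^-1 * ((2 * c2 * c1 * r + c2 ^+ 2 * 1) * nrm (x - y)).
    by rewrite ler_wpM2l // invr_ge0.
  by apply: (le_trans (lerD H1 H3)); rewrite /cD; lra.
split=> [k|].
  apply: (le_trans (dE k)); rewrite ler_wpM2r // lerDl addr_ge0 ?mn_ge0 //.
  by rewrite mulr_ge0.
have -> : dri x - dri y = G *m (x - y) + (drD x - drD y).
  by rewrite /dri mulmxBr opprD addrACA.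
apply: (le_trans (nrmD _ _)); apply: (le_trans (lerD (nrmM _ _) dD)).
by rewrite -mulrDl ler_wpM2r // lerDr.
Qed.

Lemma coef_bound r : exists2 c, 0 <= c & forall x, nrm x <= r ->
  (forall k, nrm (dif k x) <= c) /\ nrm (dri x) <= c.
Proof.
have [c c0 lip] := coef_lip r.
exists (c * `|r|) => [|x xr]; first by rewrite mulr_ge0.
have r0 : 0 <= r by exact: le_trans (nrm_ge0 x) xr.
have n0 : nrm (0 : 'cV[R]_m) <= r by rewrite nrm0.
have [h1 h2] := lip x 0 xr n0.
have h : c * nrm x <= c * `|r| by rewrite ler_wpM2l // ger0_norm.
split=> [k|].
  by have := h1 k; rewrite dif0 !subr0 => /le_trans; apply.
by move: h2; rewrite dri0 !subr0 => /le_trans; apply.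
Qed.

Lemma drD_bound r : exists2 c, 0 <= c & forall x, nrm x <= r -> nrm (drD x) <= c.
Proof.
have [c c0 bd] := coef_bound r.
exists (c + mn G * `|r|) => [|x xr]; first by rewrite addr_ge0 // mulr_ge0 // mn_ge0.
have [_ h] := bd x xr.
have -> : drD x = dri x - G *m x by rewrite /dri addrC addKr.
apply: (le_trans (nrmB _ _)); rewrite lerD //; apply: (le_trans (nrmM _ _)).
rewrite ler_wpM2l ?mn_ge0 //; apply: (le_trans xr); exact: ler_norm.
Qed.

Lemma dife_bound c xi z : (forall k, nrm (dif k z) <= c) -> 0 <= c ->
  nrm (dife xi z) <= c * weight xi.
Proof.
move=> Ec c0; apply: (le_trans (nrm_sum _ _ _)).
apply: (@le_trans _ _ (\sum_k c * `|xi k|)).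
  by apply: ler_sum => k _; rewrite nrmZ mulrC ler_wpM2r.
by rewrite -mulr_sumr ler_wpM2l // /weight lerDr.
Qed.
End coefficients.

(** * Expansion of the projected step *)

Section projection.
Context {R : realType} {m : nat}.
Implicit Types (w z : 'cV[R]_m) (B : 'M[R]_m).

Definition sphproj w : 'cV[R]_m := (nrm w)^-1 *: w.

Lemma sphproj0 : sphproj 0 = 0.
Proof. by rewrite /sphproj scaler0. Qed.

Lemma sphproj_unit w : dot (sphproj w) (sphproj w) = 1 \/ sphproj w = 0.
Proof.
have [/eqP|w0] := eqVneq (nrm w) 0.
  by rewrite nrm_eq0 => /eqP ->; right; exact: sphproj0.
by left; rewrite -nrm_sqr nrmZ ger0_norm ?invr_ge0 ?nrm_ge0 // mulVf // expr1n.
Qed.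

(** Expanding the squared norm in the denominator to first order around 1
    leaves an error that is quadratic in |w|^2 - 1, whatever the size of w. *)
Lemma sphproj_quad B w : `|dot (sphproj w) (B *m sphproj w) - dot w (B *m w) * (2 - dot w w)|
  <= mn B * (dot w w - 1) ^+ 2.
Proof.
have [/eqP|w0] := eqVneq (nrm w) 0.
  rewrite nrm_eq0 => /eqP ->; rewrite sphproj0 !dot0l mul0r subrr normr0.
  by rewrite mulr_ge0 ?mn_ge0 // sqr_ge0.
have n2 : 0 < dot w w by rewrite -nrm_sqr exprn_gt0 // lt_def w0 nrm_ge0.
rewrite /sphproj -scalemxAr dotZl dotZr -nrm_sqr.
have -> : (nrm w)^-1 * ((nrm w)^-1 * dot w (B *m w)) - dot w (B *m w) * (2 - nrm w ^+ 2) =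
   dot w (B *m w) / nrm w ^+ 2 * (nrm w ^+ 2 - 1) ^+ 2 by field.
rewrite normrM (ger0_norm (sqr_ge0 _)) ler_wpM2r ?sqr_ge0 //.
rewrite normrM normfV (ger0_norm (sqr_ge0 _)) nrm_sqr ler_pdivrMr //.
by rewrite -nrm_sqr expr2; exact: dotM_le.
Qed.

(** The analogue of [sphproj_quad] for the inverse of the norm itself: the first
    order expansion of [x^-1] in [x ^+ 2] around 1, times [nrm w]. *)
Lemma sphproj_vec w : nrm (sphproj w - (1 - 2^-1 * (dot w w - 1)) *: w) <= (dot w w - 1) ^+ 2.
Proof.
have [/eqP|w0] := eqVneq (nrm w) 0.
  by rewrite nrm_eq0 => /eqP ->; rewrite sphproj0 scaler0 subrr nrm0 sqr_ge0.
have n0 : 0 < nrm w by rewrite lt_def w0 nrm_ge0.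
rewrite /sphproj -scalerBl nrmZ -[X in _ * X](ger0_norm (nrm_ge0 w)) -normrM -nrm_sqr.
set t := nrm w in n0 w0 *.
have -> : (t^-1 - (1 - 2^-1 * (t ^+ 2 - 1))) * t = (t - 1) ^+ 2 * ((t + 2) / 2) by field.
have -> : (t ^+ 2 - 1) ^+ 2 = (t - 1) ^+ 2 * (t + 1) ^+ 2 by ring.
rewrite normrM (ger0_norm (sqr_ge0 _)) ler_wpM2l ?sqr_ge0 //.
rewrite ger0_norm; last by lra.
have := mulr_gt0 n0 n0; rewrite -expr2 => t2; rewrite sqrrD; lra.
Qed.
End projection.

Section expansion.
Context {R : realType} {m : nat}.
Implicit Types (z e b g r : 'cV[R]_m) (B : 'M[R]_m).

Let nD (x y X Y : R) : `|x| <= X -> `|y| <= Y -> `|x + y| <= X + Y.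
Proof. by move=> h1 h2; apply: (le_trans (ler_normD _ _)); exact: lerD. Qed.

Let nB (x y X Y : R) : `|x| <= X -> `|y| <= Y -> `|x - y| <= X + Y.
Proof. by rewrite -(normrN y); exact: nD. Qed.

Let nM (x y X Y : R) : `|x| <= X -> `|y| <= Y -> `|x * y| <= X * Y.
Proof. by move=> h1 h2; rewrite normrM ler_pM. Qed.

Let vD (x y : 'cV[R]_m) X Y : nrm x <= X -> nrm y <= Y -> nrm (x + y) <= X + Y.
Proof. by move=> h1 h2; apply: (le_trans (nrmD _ _)); exact: lerD. Qed.

Let vZ a (x : 'cV[R]_m) A X : `|a| <= A -> nrm x <= X -> nrm (a *: x) <= A * X.
Proof. by move=> h1 h2; rewrite nrmZ ler_pM // nrm_ge0. Qed.

Definition quad B z : R := dot z (B *m z).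

Section five_terms.
Variables (z e b g r : 'cV[R]_m) (s S K : R).
Hypotheses (s0 : 0 <= s) (sS : s <= S).
Hypotheses (zK : nrm z <= K) (eK : nrm e <= K) (bK : nrm b <= K)
  (gK : nrm g <= K) (rK : nrm r <= K).

Let w := z + s *: e + s ^+ 2 *: b + s ^+ 3 *: g + s ^+ 4 *: r.

(** The coefficients of [s ^+ 2] and [s ^+ 3] in the quadratic form of
    [z + s e + s^2 b + s^3 g + s^4 r]; [c4] bounds the remaining one. *)
Definition q2 B z e b := bet B z b + quad B e.
Definition q3 B z e b g := bet B z g + bet B e b.
Definition c4 (S : R) : R := 5 + S * (4 + S * (3 + S * (2 + S))).

Let sn : `|s| <= S. Proof. by rewrite ger0_norm. Qed.
Let S0 : 0 <= S. Proof. exact: le_trans sS. Qed.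
Let K0 : 0 <= K. Proof. exact: le_trans (nrm_ge0 z) zK. Qed.

Lemma quad_expansion B : exists2 q4, `|q4| <= c4 S * (mn B * K ^+ 2) &
  quad B w = quad B z + s * bet B z e + s ^+ 2 * q2 B z e b +
             s ^+ 3 * q3 B z e b g + s ^+ 4 * q4.
Proof.
pose d x y := dot x (B *m y).
set k := mn B * K ^+ 2.
have dk x y : nrm x <= K -> nrm y <= K -> `|d x y| <= k.
  move=> xK yK; apply: (le_trans (dotM_le _ _ _)).
  by rewrite ler_wpM2l ?mn_ge0 // expr2 ler_pM // nrm_ge0.
exists ((d z r + d r z + d e g + d g e + d b b) + s * ((d e r + d r e + d b g + d g b) +
  s * ((d b r + d r b + d g g) + s * ((d g r + d r g) + s * d r r)))); last first.
  rewrite /quad /w /q2 /q3 /bet /quad !mulmxDr -!scalemxAr.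
  rewrite !(dotDl, dotDr, dotZl, dotZr) /d; ring.
have -> : c4 S * k = (k + k + k + k + k) + S * ((k + k + k + k) +
  S * ((k + k + k) + S * ((k + k) + S * k))) by rewrite /c4; ring.
by do ![apply: nD | apply: nM => // | exact: dk].
Qed.

Lemma q1_le B : `|bet B z e| <= 2 * (mn B * K ^+ 2).
Proof.
rewrite mulr_natl mulr2n; apply: nD; apply: (le_trans (dotM_le _ _ _));
  by rewrite ler_wpM2l ?mn_ge0 // expr2 ler_pM // nrm_ge0.
Qed.

Lemma q2_le B : `|q2 B z e b| <= 3 * (mn B * K ^+ 2).
Proof.
have -> : 3 * (mn B * K ^+ 2) = mn B * K ^+ 2 + mn B * K ^+ 2 + mn B * K ^+ 2 by ring.
apply: nD; first apply: nD; apply: (le_trans (dotM_le _ _ _));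
  by rewrite ler_wpM2l ?mn_ge0 // expr2 ler_pM // nrm_ge0.
Qed.

Lemma q3_le B : `|q3 B z e b g| <= 4 * (mn B * K ^+ 2).
Proof.
have -> : 4 * (mn B * K ^+ 2) = (mn B * K ^+ 2 + mn B * K ^+ 2) + (mn B * K ^+ 2 + mn B * K ^+ 2) by ring.
do 2 apply: nD; apply: (le_trans (dotM_le _ _ _));
  by rewrite ler_wpM2l ?mn_ge0 // expr2 ler_pM // nrm_ge0.
Qed.

Lemma quad0_le B : `|quad B z| <= mn B * K ^+ 2.
Proof.
by apply: (le_trans (dotM_le _ _ _)); rewrite ler_wpM2l ?mn_ge0 // expr2 ler_pM // nrm_ge0.
Qed.

Lemma quad1 (x : 'cV[R]_m) : quad 1%:M x = dot x x.
Proof. by rewrite /quad mul1mx. Qed.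

Lemma bet1 (x y : 'cV[R]_m) : bet 1%:M x y = 2 * dot x y.
Proof. by rewrite /bet !mul1mx (dotC y x); ring. Qed.

Hypotheses (K1 : 1 <= K) (z1 : dot z z = 1) (ze : dot z e = 0).

Let mu := mn (1%:M : 'M[R]_m).
Let mu0 : 0 <= mu. Proof. exact: mn_ge0. Qed.
Let n2 := q2 1%:M z e b.
Let n3 := q3 1%:M z e b g.

(** The linear term is absent because [e] is orthogonal to [z]; hence the squared
    norm differs from 1 only at order [s ^+ 2], and the square of this
    difference, which is the error of [sphproj_quad], is of order [s ^+ 4]. *)
Lemma sqnorm_expansion : exists2 n4, `|n4| <= c4 S * (mu * K ^+ 2) &
  dot w w - 1 = s ^+ 2 * (n2 + s * (n3 + s * n4)).
Proof.
have [n4 n4K h] := quad_expansion 1%:M; exists n4 => //.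
move: h; rewrite quad1 => ->; rewrite quad1 z1 bet1 ze -/n2 -/n3; ring.
Qed.

Definition vS := 3 + S * (4 + S * c4 S).
Definition weak_const := vS ^+ 2 * mu ^+ 2 + c4 S + c4 S * mu +
  2 * (4 + S * c4 S) * mu + vS * vS * mu.

(** The product of [quad_expansion] with 2 minus the squared norm, which
    [sphproj_quad] puts in place of the division by the latter. *)
Lemma weak_expansion5 B :
  `|quad B (sphproj w) - (quad B z + s * bet B z e + s ^+ 2 * (q2 B z e b - quad B z * n2)
     + s ^+ 3 * (q3 B z e b g - quad B z * n3 - bet B z e * n2))|
  <= weak_const * mn B * s ^+ 4 * K ^+ 4.
Proof.
have [q4 q4K qE] := quad_expansion B.
have [n4 n4K nE] := sqnorm_expansion.
have B0 := mn_ge0 B.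
set k := mn B * K ^+ 2 in q4K; set k1 := mu * K ^+ 2 in n4K.
have k0 : 0 <= k by rewrite mulr_ge0 // sqr_ge0.
have k10 : 0 <= k1 by rewrite mulr_ge0 // sqr_ge0.
pose nu' := n3 + s * n4; pose nu := n2 + s * nu'.
pose p := q2 B z e b + s * (q3 B z e b g + s * q4).
have nu'K : `|nu'| <= (4 + S * c4 S) * k1.
  have -> : (4 + S * c4 S) * k1 = 4 * k1 + S * (c4 S * k1) by ring.
  by apply: nD; [exact: q3_le|exact: nM].
have nuK : `|nu| <= vS * k1.
  have -> : vS * k1 = 3 * k1 + S * ((4 + S * c4 S) * k1) by rewrite /vS; ring.
  by apply: nD; [exact: q2_le|exact: nM].
have pK : `|p| <= vS * k.
  have -> : vS * k = 3 * k + S * (4 * k + S * (c4 S * k)) by rewrite /vS; ring.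
  by apply: nD; [exact: q2_le|apply: nM => //; apply: nD; [exact: q3_le|exact: nM]].
have E : quad B (sphproj w) - (quad B z + s * bet B z e + s ^+ 2 * (q2 B z e b - quad B z * n2)
     + s ^+ 3 * (q3 B z e b g - quad B z * n3 - bet B z e * n2)) =
  (quad B (sphproj w) - quad B w * (2 - dot w w)) +
  s ^+ 4 * (q4 - quad B z * n4 - bet B z e * nu' - p * nu).
  have -> : 2 - dot w w = 1 - s ^+ 2 * nu by rewrite /nu /nu' -nE; ring.
  rewrite qE /p /nu /nu'; ring.
rewrite E.
have H1 := sphproj_quad B w; rewrite nE -/nu' -/nu in H1.
have H2 : mn B * (s ^+ 2 * nu) ^+ 2 <= s ^+ 4 * (mn B * (vS * k1) ^+ 2).
  have -> : mn B * (s ^+ 2 * nu) ^+ 2 = s ^+ 4 * (mn B * nu ^+ 2) by ring.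
  rewrite ler_wpM2l ?exprn_ge0 // ler_wpM2l // -[nu ^+ 2]ger0_norm ?sqr_ge0 //.
  by rewrite normrX lerXn2r // nnegrE (le_trans _ nuK).
have H3 : `|q4 - quad B z * n4 - bet B z e * nu' - p * nu| <=
   c4 S * k + k * (c4 S * k1) + 2 * k * ((4 + S * c4 S) * k1) + vS * k * (vS * k1).
  apply: nB; last exact: nM.
  apply: nB; last by apply: nM => //; exact: q1_le.
  by apply: nB => //; apply: nM => //; exact: quad0_le.
have H4 : `|s ^+ 4 * (q4 - quad B z * n4 - bet B z e * nu' - p * nu)| <=
   s ^+ 4 * (c4 S * k + k * (c4 S * k1) + 2 * k * ((4 + S * c4 S) * k1) + vS * k * (vS * k1)).
  by apply: nM => //; rewrite ger0_norm // exprn_ge0.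
apply: (le_trans (nD (le_trans H1 H2) H4)).
have K2 : K ^+ 2 <= K ^+ 4 by rewrite ler_weXn2l.
have c40 : 0 <= c4 S by rewrite /c4 !(addr_ge0, mulr_ge0).
have s40 : 0 <= s ^+ 4 by rewrite exprn_ge0.
have h : s ^+ 4 * (c4 S * k) <= s ^+ 4 * (c4 S * (mn B * K ^+ 4)).
  by rewrite ler_wpM2l // ler_wpM2l // ler_wpM2l.
rewrite -subr_ge0; move: h; rewrite -subr_ge0 => /le_trans; apply.
rewrite le_eqVlt; apply/orP; left; apply/eqP.
rewrite /weak_const /k /k1; ring.
Qed.

Definition strong_const := (1 + S) + 3 / 2 * mu * (1 + S + S ^+ 2 * (1 + S)) +
  2^-1 * (4 + S * c4 S) * mu * (1 + S * (1 + S + S ^+ 2 * (1 + S))) + S * vS ^+ 2 * mu ^+ 2.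

Lemma strong_expansion5 :
  nrm (sphproj w - (z + s *: e + s ^+ 2 *: b - (s ^+ 2 * (2^-1 * n2)) *: z))
  <= strong_const * s ^+ 3 * K ^+ 4.
Proof.
have [n4 n4K nE] := sqnorm_expansion.
set k1 := mu * K ^+ 2 in n4K.
have k10 : 0 <= k1 by rewrite mulr_ge0 // sqr_ge0.
pose nu' := n3 + s * n4; pose nu := n2 + s * nu'.
have nu'K : `|nu'| <= (4 + S * c4 S) * k1.
  have -> : (4 + S * c4 S) * k1 = 4 * k1 + S * (c4 S * k1) by ring.
  by apply: nD; [exact: q3_le|exact: nM].
have n2K : `|n2| <= 3 * k1 by exact: q2_le.
have nuK : `|nu| <= vS * k1.
  have -> : vS * k1 = 3 * k1 + S * ((4 + S * c4 S) * k1) by rewrite /vS; ring.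
  by apply: nD => //; exact: nM.
pose p3 := g + s *: r; pose p1 := e + s *: (b + s *: p3).
have p3K : nrm p3 <= (1 + S) * K by rewrite mulrDl mul1r; apply: vD => //; exact: vZ.
have p1K : nrm p1 <= (1 + S + S ^+ 2 * (1 + S)) * K.
  have -> : (1 + S + S ^+ 2 * (1 + S)) * K = K + S * (K + S * ((1 + S) * K)) by ring.
  by apply: vD => //; apply: vZ => //; apply: vD => //; exact: vZ.
have wE : w = z + s *: p1.
  by apply/matrixP => i j; rewrite /w /p1 /p3 !mxE; ring.
have wK : nrm w <= (1 + S * (1 + S + S ^+ 2 * (1 + S))) * K.
  by rewrite wE mulrDl mul1r; apply: vD => //; rewrite -mulrA; exact: vZ.
have E : sphproj w - (z + s *: e + s ^+ 2 *: b - (s ^+ 2 * (2^-1 * n2)) *: z) =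
  (sphproj w - (1 - 2^-1 * (dot w w - 1)) *: w) +
  s ^+ 3 *: (p3 - (2^-1 * n2) *: p1 - (2^-1 * nu') *: w).
  rewrite nE -/nu' -/nu; apply/matrixP => i j.
  rewrite wE /p1 /p3 !mxE /nu; ring.
rewrite E; apply: (le_trans (nrmD _ _)).
have H1 := sphproj_vec w; rewrite [X in _ <= X ^+ 2]nE -/nu' -/nu in H1.
have s30 : 0 <= s ^+ 3 by rewrite exprn_ge0.
have H2 : (s ^+ 2 * nu) ^+ 2 <= s ^+ 3 * (S * (vS * k1) ^+ 2).
  have -> : (s ^+ 2 * nu) ^+ 2 = s ^+ 3 * (s * nu ^+ 2) by ring.
  rewrite ler_wpM2l // ler_pM ?sqr_ge0 // -[nu ^+ 2]ger0_norm ?sqr_ge0 //.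
  by rewrite normrX lerXn2r // nnegrE (le_trans _ nuK).
have h2 : `|2^-1 : R| <= 2^-1 by rewrite ger0_norm // invr_ge0.
have H3 : nrm (s ^+ 3 *: (p3 - (2^-1 * n2) *: p1 - (2^-1 * nu') *: w)) <=
   s ^+ 3 * ((1 + S) * K + (2^-1 * (3 * k1)) * ((1 + S + S ^+ 2 * (1 + S)) * K) +
    (2^-1 * ((4 + S * c4 S) * k1)) * ((1 + S * (1 + S + S ^+ 2 * (1 + S))) * K)).
  apply: vZ; first by rewrite ger0_norm.
  apply: vD; last by rewrite nrmN; apply: vZ => //; exact: nM.
  by apply: vD => //; rewrite nrmN; apply: vZ => //; exact: nM.
apply: (le_trans (lerD (le_trans H1 H2) H3)).
have K14 : K <= K ^+ 4 by rewrite -[leLHS]expr1 ler_weXn2l.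
have K34 : K ^+ 3 <= K ^+ 4 by rewrite ler_weXn2l.
have c40 : 0 <= c4 S by rewrite /c4 !(addr_ge0, mulr_ge0).
have -> : strong_const * s ^+ 3 * K ^+ 4 = s ^+ 3 * (S * vS ^+ 2 * mu ^+ 2 * K ^+ 4) +
  s ^+ 3 * ((1 + S) * K ^+ 4 + 3 / 2 * mu * (1 + S + S ^+ 2 * (1 + S)) * K ^+ 4 +
  2^-1 * (4 + S * c4 S) * mu * (1 + S * (1 + S + S ^+ 2 * (1 + S))) * K ^+ 4).
  by rewrite /strong_const; ring.
apply: lerD.
  by rewrite ler_wpM2l // le_eqVlt; apply/orP; left; apply/eqP; rewrite /k1; ring.
rewrite ler_wpM2l //; apply: lerD; [apply: lerD|].
- by rewrite ler_wpM2l // addr_ge0.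
- have -> : 2^-1 * (3 * k1) * ((1 + S + S ^+ 2 * (1 + S)) * K) =
    3 / 2 * mu * (1 + S + S ^+ 2 * (1 + S)) * K ^+ 3 by rewrite /k1; field.
  by rewrite ler_wpM2l // !(mulr_ge0, addr_ge0) // ?exprn_ge0 // invr_ge0.
- have -> : 2^-1 * ((4 + S * c4 S) * k1) * ((1 + S * (1 + S + S ^+ 2 * (1 + S))) * K) =
    2^-1 * (4 + S * c4 S) * mu * (1 + S * (1 + S + S ^+ 2 * (1 + S))) * K ^+ 3 by rewrite /k1; ring.
  by rewrite ler_wpM2l // !(mulr_ge0, addr_ge0) // ?exprn_ge0 // invr_ge0.
Qed.
End five_terms.
End expansion.

(** * One step of the scheme *)

Section one_step.
Context {R : realType} {m n : nat}.
Variables (G : 'M[R]_m) (L : 'I_n -> 'M[R]_m) (ex : R -> 'M[R]_m) (T Cex : R).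
Hypothesis T0 : 0 < T.
Hypothesis Cex0 : 0 <= Cex.
(** All that is used of [ex h] is that it agrees with [1 + h G] to second order,
    and of the generator that it annihilates the squared norm, which expresses
    the conservation of probability. *)
Hypothesis exP : forall h v, 0 <= h <= T ->
  nrm (ex h *m v - v - h *: (G *m v)) <= Cex * h ^+ 2 * nrm v.
Hypothesis dissip : forall z, dot z (lindblad G L 1%:M *m z) = 0.
Implicit Types (z : 'cV[R]_m) (B : 'M[R]_m) (xi : 'I_n -> R).

Definition step (h : R) xi z : 'cV[R]_m :=
  sphproj (ex h *m (z + h *: drD L z + Num.sqrt h *: dife L xi z)).

(** The projection sends 0 to 0, so a step may leave the sphere; 0 is then an
    absorbing state at which all estimates hold trivially. *)
Definition unit0 z := dot z z = 1 \/ z = 0.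

Lemma unit0_nrm z : unit0 z -> nrm z <= 1.
Proof. by case=> [h|->]; rewrite ?nrm0 // /nrm h sqrtr1. Qed.

Lemma step_unit0 h xi z : unit0 (step h xi z).
Proof. exact: sphproj_unit. Qed.

Lemma step0 h xi : step h xi 0 = 0.
Proof. by rewrite /step drD0 dife0 !scaler0 !addr0 mulmx0 sphproj0. Qed.

(** Since [ex h = 1 + h G + O(h^2)], the linear part of the drift appears at order
    [h], and [G] applied to the noise at order [h^(3/2)]. *)
Lemma step_decomp : exists2 c, 1 <= c & forall h xi z, 0 <= h <= T -> nrm z <= 1 ->
  let K := c * weight xi in let e := dife L xi z in let s := Num.sqrt h in
  [/\ nrm e <= K, nrm (dri G L z) <= K, nrm (G *m e) <= K & exists2 r, nrm r <= K &
   ex h *m (z + h *: drD L z + Num.sqrt h *: e) =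
   z + s *: e + s ^+ 2 *: dri G L z + s ^+ 3 *: (G *m e) + s ^+ 4 *: r].
Proof.
have [c1 c10 bd1] := coef_bound G L 1; have [c2 c20 bd2] := drD_bound G L 1.
pose g := mn G; have g0 : 0 <= g by exact: mn_ge0.
pose S := Num.sqrt T; have S0 : 0 <= S by exact: sqrtr_ge0.
exists (1 + (c1 + g * c1 + g * c2 + Cex * (1 + T * c2 + S * c1))).
  by rewrite lerDl !(addr_ge0, mulr_ge0) // ltW.
move=> h xi z /andP[h0 hT] z1 K e s.
have N1 := weight_ge1 xi; have N0 : 0 <= weight xi by exact: le_trans N1.
have [bE bb] := bd1 z z1; have bD := bd2 z z1.
have eN : nrm e <= c1 * weight xi by exact: dife_bound.
have ltK c : 0 <= c -> c <= 1 + (c1 + g * c1 + g * c2 + Cex * (1 + T * c2 + S * c1)) ->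
   c * weight xi <= K by move=> *; rewrite ler_wpM2r.
have p1 : 0 <= g * c1 by rewrite mulr_ge0.
have p2 : 0 <= g * c2 by rewrite mulr_ge0.
have p4 : 0 <= 1 + T * c2 + S * c1 by rewrite !(addr_ge0, mulr_ge0) // ltW.
have p3 : 0 <= Cex * (1 + T * c2 + S * c1) by rewrite mulr_ge0.
have sT : s <= S by rewrite ler_wsqrtr.
have s2 : s ^+ 2 = h by rewrite sqr_sqrtr.
split.
- by apply: (le_trans eN); apply: ltK => //; lra.
- apply: (le_trans bb); apply: (@le_trans _ _ (c1 * weight xi)); first by rewrite ler_peMr.
  by apply: ltK => //; lra.
- apply: (le_trans (nrmM _ _)); apply: (@le_trans _ _ (g * c1 * weight xi)).
    by rewrite -mulrA ler_wpM2l.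
  by apply: ltK => //; lra.
set v := z + h *: drD L z + Num.sqrt h *: e.
pose rho := ex h *m v - v - h *: (G *m v).
have rhoK : nrm rho <= Cex * h ^+ 2 * nrm v by apply: exP; rewrite h0.
have vK : nrm v <= (1 + T * c2 + S * c1) * weight xi.
  rewrite !mulrDl mul1r; apply: (le_trans (nrmD _ _)); apply: lerD.
    apply: (le_trans (nrmD _ _)); apply: lerD; first exact: le_trans z1 N1.
    rewrite nrmZ ger0_norm //; apply: (@le_trans _ _ (T * c2)).
      by apply: ler_pM => //; exact: nrm_ge0.
    by rewrite ler_peMr // mulr_ge0 // ltW.
  rewrite nrmZ ger0_norm ?sqrtr_ge0 // -mulrA.
  by apply: ler_pM; rewrite ?sqrtr_ge0 ?nrm_ge0.
exists (G *m drD L z + (s ^+ 4)^-1 *: rho).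
  apply: (@le_trans _ _ ((g * c2 + Cex * (1 + T * c2 + S * c1)) * weight xi)).
    rewrite mulrDl; apply: (le_trans (nrmD _ _)); apply: lerD.
      apply: (le_trans (nrmM _ _)); apply: (@le_trans _ _ (g * c2)).
        by apply: ler_pM => //; exact: nrm_ge0.
      by rewrite ler_peMr.
    rewrite nrmZ ger0_norm ?invr_ge0 ?exprn_ge0 ?sqrtr_ge0 //.
    have s4 : s ^+ 4 = h ^+ 2 by rewrite -s2 -exprM.
    rewrite s4; have [->|hn] := eqVneq h 0.
      by rewrite expr0n invr0 mul0r mulr_ge0.
    rewrite mulrC ler_pdivrMr ?exprn_even_gt0 // (le_trans rhoK) //.
    rewrite [X in _ <= X](_ : _ = Cex * h ^+ 2 * ((1 + T * c2 + S * c1) * weight xi)); last by ring.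
    by rewrite ler_wpM2l // mulr_ge0 // sqr_ge0.
  by apply: ltK; [rewrite addr_ge0|lra].
have rE : s ^+ 4 *: ((s ^+ 4)^-1 *: rho) = rho.
  have [s40|s40] := eqVneq (s ^+ 4) 0; last by rewrite scalerA divff // scale1r.
  have h20 : h ^+ 2 = 0 by rewrite -s2 -exprM.
  move: rhoK; rewrite h20 mulr0 mul0r => rho0.
  have /eqP : nrm rho = 0 by apply/eqP; rewrite eq_le rho0 nrm_ge0.
  by rewrite nrm_eq0 => /eqP ->; rewrite !scaler0.
rewrite [X in _ = _ + X]scalerDr rE /rho -s2.
have -> : G *m v = G *m z + s ^+ 2 *: (G *m drD L z) + s *: (G *m e).
  by rewrite /v s2 !mulmxDr !scalemxAr.
have -> : dri G L z = G *m z + drD L z by [].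
set a1 := G *m z; set a2 := G *m drD L z; set a3 := G *m e; set a4 := ex _ *m v.
rewrite /v -/s -s2; set a5 := drD L z.
clearbody a1 a2 a3 a4 a5 e.
by apply/matrixP => i j; rewrite !mxE; ring.
Qed.

(** The quadratic observable after one step, up to the fourth power of the
    square root of the step size; the third-order coefficient is kept because
    only its expectation vanishes. *)
Definition weak_main B (s : R) xi z : R :=
  let e := dife L xi z in let b := dri G L z in
  quad B z + s * bet B z e + s ^+ 2 * (q2 B z e b - quad B z * q2 1%:M z e b)
  + s ^+ 3 * (q3 B z e b (G *m e) - quad B z * q3 1%:M z e b (G *m e)
              - bet B z e * q2 1%:M z e b).

Definition strong_main (s : R) xi z : 'cV[R]_m :=
  z + s *: dife L xi z + s ^+ 2 *: dri G L z
  - (s ^+ 2 * (2^-1 * q2 1%:M z (dife L xi z) (dri G L z))) *: z.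

Lemma dot_dife xi z : unit0 z -> dot z (dife L xi z) = 0.
Proof.
move=> z1; rewrite /dife dot_sumr big1 // => k _; rewrite dotZr dot_dif.
by case: z1 => [->|->]; rewrite ?subrr ?mulr0 // /ell !dot0l mul0r mulr0.
Qed.

Lemma weak_step : exists2 c, 0 <= c & forall B h xi z, 0 <= h <= T -> unit0 z ->
  `|quad B (step h xi z) - weak_main B (Num.sqrt h) xi z|
   <= c * mn B * h ^+ 2 * weight xi ^+ 4.
Proof.
have [c c1 dec] := step_decomp.
pose S := Num.sqrt T; have S0 : 0 <= S by exact: sqrtr_ge0.
have c40 : 0 <= c4 S by rewrite /c4 !(addr_ge0, mulr_ge0).
have vS0 : 0 <= vS S by rewrite /vS !(addr_ge0, mulr_ge0).
have wc0 : 0 <= @weak_const R m S.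
  by rewrite /weak_const !(addr_ge0, mulr_ge0) // ?mn_ge0 ?sqr_ge0.
exists (@weak_const R m S * c ^+ 4) => [|B h xi z hT z1].
  by rewrite mulr_ge0 // exprn_ge0 // (le_trans _ c1).
have h0 : 0 <= h by case/andP: hT.
have N1 := weight_ge1 xi.
have s4 : Num.sqrt h ^+ 4 = h ^+ 2 by rewrite -{2}(sqr_sqrtr h0) -exprM.
case: (z1) => [zz|->]; last first.
  rewrite step0 /weak_main dife0 dri0 /q2 /q3 /quad /bet !mulmx0 !dot0l.
  rewrite !(addr0, mulr0, mul0r, subr0) normr0.
  have c0 : 0 <= c by exact: le_trans c1.
  have N0 : 0 <= weight xi by exact: le_trans N1.
  by rewrite !mulr_ge0 ?mn_ge0 ?sqr_ge0 ?exprn_ge0.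
have := dec h xi z hT (unit0_nrm z1); cbv zeta; move=> [eK bK gK [r rK E]].
set s := Num.sqrt h in E s4 *.
have K1 : 1 <= c * weight xi by rewrite -[1]mulr1 ler_pM.
have zK : nrm z <= c * weight xi by exact: le_trans (unit0_nrm z1) K1.
have sS : s <= S by rewrite ler_wsqrtr //; case/andP: hT.
have := @weak_expansion5 R m z (dife L xi z) (dri G L z) (G *m dife L xi z) r s S
  (c * weight xi) (sqrtr_ge0 _) sS zK eK bK gK rK K1 zz (dot_dife xi z1) B.
rewrite -E -/(step h xi z) -/(weak_main B s xi z) => /le_trans; apply.
rewrite s4 le_eqVlt; apply/orP; left; apply/eqP; rewrite exprMn; ring.
Qed.

Lemma strong_step : exists2 c, 0 <= c & forall h xi z, 0 <= h <= T -> unit0 z ->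
  nrm (step h xi z - strong_main (Num.sqrt h) xi z)
   <= c * Num.sqrt h ^+ 3 * weight xi ^+ 4.
Proof.
have [c c1 dec] := step_decomp.
pose S := Num.sqrt T; have S0 : 0 <= S by exact: sqrtr_ge0.
have c40 : 0 <= c4 S by rewrite /c4 !(addr_ge0, mulr_ge0).
have vS0 : 0 <= vS S by rewrite /vS !(addr_ge0, mulr_ge0).
have wc0 : 0 <= @strong_const R m S.
  by rewrite /strong_const !(addr_ge0, mulr_ge0, invr_ge0) // ?mn_ge0 ?sqr_ge0 ?invr_ge0.
exists (@strong_const R m S * c ^+ 4) => [|h xi z hT z1].
  by rewrite mulr_ge0 // exprn_ge0 // (le_trans _ c1).
have N1 := weight_ge1 xi.
case: (z1) => [zz|->]; last first.
  rewrite step0 /strong_main dife0 dri0 !scaler0 !addr0 !subr0 nrm0.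
  have c0 : 0 <= c by exact: le_trans c1.
  have N0 : 0 <= weight xi by exact: le_trans N1.
  by rewrite !mulr_ge0 ?exprn_ge0 ?sqrtr_ge0.
have := dec h xi z hT (unit0_nrm z1); cbv zeta; move=> [eK bK gK [r rK E]].
set s := Num.sqrt h in E *.
have K1 : 1 <= c * weight xi by rewrite -[1]mulr1 ler_pM.
have zK : nrm z <= c * weight xi by exact: le_trans (unit0_nrm z1) K1.
have sS : s <= S by rewrite ler_wsqrtr //; case/andP: hT.
have := @strong_expansion5 R m z (dife L xi z) (dri G L z) (G *m dife L xi z) r s S
  (c * weight xi) (sqrtr_ge0 _) sS zK eK bK gK rK K1 zz (dot_dife xi z1).
rewrite -E -/(step h xi z) -/(strong_main s xi z) => /le_trans; apply.
rewrite le_eqVlt; apply/orP; left; apply/eqP; rewrite exprMn; ring.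
Qed.

Lemma weak_mainE B s xi z :
  let E k := dif L k z in let b := dri G L z in
  weak_main B s xi z = quad B z
  + \sum_k xi k * (s * bet B z (E k)
      + s ^+ 3 * (bet B z (G *m E k) + bet B (E k) b
         - quad B z * (bet 1%:M z (G *m E k) + bet 1%:M (E k) b)
         - bet B z (E k) * bet 1%:M z b))
  + (s ^+ 2 * (bet B z b - quad B z * bet 1%:M z b)
  + \sum_j \sum_k xi j * xi k * (s ^+ 2 * (dot (E j) (B *m E k)
      - quad B z * dot (E j) (E k))))
  - \sum_i \sum_j \sum_k xi i * xi j * xi k *
      (s ^+ 3 * (bet B z (E i) * dot (E j) (E k))).
Proof.
move=> E b.
have betS B' x : bet B' x (dife L xi z) = \sum_k xi k * bet B' x (E k).
  rewrite /bet /dife dot_suml mulmx_sumr dot_sumr -big_split /=.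
  by apply: eq_bigr => k _; rewrite -scalemxAr dotZr dotZl mulrDr.
have betG B' x : bet B' x (G *m dife L xi z) = \sum_k xi k * bet B' x (G *m E k).
  rewrite /bet /dife !mulmx_sumr dot_suml dot_sumr -big_split /=.
  by apply: eq_bigr => k _; rewrite -!scalemxAr dotZr dotZl mulrDr.
have betC B' x : bet B' (dife L xi z) x = \sum_k xi k * bet B' (E k) x.
  rewrite /bet /dife dot_suml mulmx_sumr dot_sumr -big_split /=.
  by apply: eq_bigr => k _; rewrite -scalemxAr dotZr dotZl mulrDr.
have quadS B' : quad B' (dife L xi z) = \sum_j \sum_k xi j * xi k * dot (E j) (B' *m E k).
  rewrite /quad /dife dot_suml; apply: eq_bigr => j _.
  rewrite dotZl mulmx_sumr dot_sumr mulr_sumr; apply: eq_bigr => k _.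
  by rewrite -scalemxAr dotZr mulrA.
rewrite /weak_main /q2 /q3 -/b.
have -> : \sum_i \sum_j \sum_k xi i * xi j * xi k * (s ^+ 3 * (bet B z (E i) * dot (E j) (E k)))
   = s ^+ 3 * (bet B z (dife L xi z) * quad 1%:M (dife L xi z)).
  rewrite betS quadS mulr_suml mulr_sumr; apply: eq_bigr => i _.
  rewrite mulr_sumr mulr_sumr; apply: eq_bigr => j _.
  rewrite mulr_sumr mulr_sumr; apply: eq_bigr => k _.
  by rewrite mul1mx; ring.
have -> : \sum_j \sum_k xi j * xi k * (s ^+ 2 * (dot (E j) (B *m E k) - quad B z * dot (E j) (E k)))
  = s ^+ 2 * (quad B (dife L xi z) - quad B z * quad 1%:M (dife L xi z)).
  rewrite !quadS mulr_sumr -sumrB mulr_sumr; apply: eq_bigr => j _.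
  rewrite mulr_sumr -sumrB mulr_sumr; apply: eq_bigr => k _.
  by rewrite mul1mx; ring.
have -> : \sum_k xi k * (s * bet B z (E k)
      + s ^+ 3 * (bet B z (G *m E k) + bet B (E k) b
         - quad B z * (bet 1%:M z (G *m E k) + bet 1%:M (E k) b)
         - bet B z (E k) * bet 1%:M z b)) =
  s * bet B z (dife L xi z) + s ^+ 3 * (bet B z (G *m dife L xi z) + bet B (dife L xi z) b
    - quad B z * (bet 1%:M z (G *m dife L xi z) + bet 1%:M (dife L xi z) b)
    - bet B z (dife L xi z) * bet 1%:M z b).
  rewrite !betS !betG !betC mulr_suml -!big_split /= !mulr_sumr -!sumrB mulr_sumr -big_split /=.
  by apply: eq_bigr => k _; ring.
by ring.
Qed.
End one_step.

(** * Vector-valued random variables and the weak error of the chain *)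

(** Measurability, adaptedness and boundedness are inherited by polynomial
    expressions for the same formal reason; the class [C] is instantiated with
    each of them. *)
Section function_classes.
Context {R : realType} {Omega : Type} {m n : nat}.
Variable C : (Omega -> R) -> Prop.
Hypothesis Ccst : forall c, C (fun=> c).
Hypothesis CD : forall f g, C f -> C g -> C (fun w => f w + g w).
Hypothesis CM : forall f g, C f -> C g -> C (fun w => f w * g w).

Definition vcl (X : Omega -> 'cV[R]_m) := forall i, C (fun w => X w i 0).

Lemma clN f : C f -> C (fun w => - f w).
Proof.
move=> Cf; have -> : (fun w => - f w) = (fun w => -1 * f w) by apply/funext => w; rewrite mulN1r.
exact: CM.
Qed.

Lemma clB f g : C f -> C g -> C (fun w => f w - g w).
Proof. by move=> Cf Cg; apply: CD => //; exact: clN. Qed.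

Lemma clX f p : C f -> C (fun w => f w ^+ p).
Proof.
move=> Cf; elim: p => [|p IH]; first by under eq_fun do rewrite expr0.
by under eq_fun do rewrite exprS; exact: CM.
Qed.

Lemma cl_sum (I : Type) (s : seq I) (Q : pred I) (f : I -> Omega -> R) :
  (forall i, C (f i)) -> C (fun w => \sum_(i <- s | Q i) f i w).
Proof.
move=> Cf; elim: s => [|i s IH]; first by under eq_fun do rewrite big_nil.
by under eq_fun do rewrite big_cons; case: (Q i) => //; exact: CD.
Qed.

Lemma vclD X Y : vcl X -> vcl Y -> vcl (fun w => X w + Y w).
Proof. by move=> CX CY i; under eq_fun do rewrite mxE; exact: CD. Qed.

Lemma vclB X Y : vcl X -> vcl Y -> vcl (fun w => X w - Y w).
Proof. by move=> CX CY i; under eq_fun do rewrite !mxE; exact: clB. Qed.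

Lemma vclZ f X : C f -> vcl X -> vcl (fun w => f w *: X w).
Proof. by move=> Cf CX i; under eq_fun do rewrite mxE; exact: CM. Qed.

Lemma vclM (A : 'M[R]_m) X : vcl X -> vcl (fun w => A *m X w).
Proof.
move=> CX i; under eq_fun do rewrite mxE.
by apply: cl_sum => j; apply: CM.
Qed.

Lemma vcl_sum (I : Type) (s : seq I) (Q : pred I) (X : I -> Omega -> 'cV[R]_m) :
  (forall i, vcl (X i)) -> vcl (fun w => \sum_(i <- s | Q i) X i w).
Proof.
by move=> CX j; under eq_fun do rewrite summxE; apply: cl_sum => i; exact: CX.
Qed.

Lemma cl_dot X Y : vcl X -> vcl Y -> C (fun w => dot (X w) (Y w)).
Proof. by move=> CX CY; rewrite /dot; apply: cl_sum => i; exact: CM. Qed.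

Lemma cl_quad B X : vcl X -> C (fun w => quad B (X w)).
Proof. by move=> CX; apply: cl_dot => //; exact: vclM. Qed.

Lemma cl_bet B X Y : vcl X -> vcl Y -> C (fun w => bet B (X w) (Y w)).
Proof. by move=> CX CY; apply: CD; apply: cl_dot => //; exact: vclM. Qed.

Variables (G : 'M[R]_m) (L : 'I_n -> 'M[R]_m).

Lemma cl_ell k X : vcl X -> C (fun w => ell L k (X w)).
Proof. exact: cl_quad. Qed.

Lemma vcl_dif k X : vcl X -> vcl (fun w => dif L k (X w)).
Proof.
by move=> CX; apply: vclB; [exact: vclM|apply: vclZ => //; exact: cl_ell].
Qed.

Lemma vcl_drD X : vcl X -> vcl (fun w => drD L (X w)).
Proof.
move=> CX; apply: vcl_sum => k; apply: vclB; apply: vclZ => //.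
- exact: cl_ell.
- exact: vclM.
- by apply: CM => //; apply: clX; exact: cl_ell.
Qed.

Lemma vcl_dri X : vcl X -> vcl (fun w => dri G L (X w)).
Proof. by move=> CX; apply: vclD; [exact: vclM|exact: vcl_drD]. Qed.

Lemma vcl_dife (x : 'I_n -> Omega -> R) X : (forall k, C (x k)) -> vcl X ->
  vcl (fun w => dife L (fun k => x k w) (X w)).
Proof. by move=> Cx CX; apply: vcl_sum => k; apply: vclZ => //; exact: vcl_dif. Qed.
End function_classes.

Section bounded_adapted.
Context {R : realType} {disp : measure_display} {Omega : measurableType disp}.
Context {m n : nat}.
Implicit Types (F : set (set Omega)) (X Y : Omega -> 'cV[R]_m).

Definition vadm F X := vcl (adm F) X.

Definition bdd_adm F (f : Omega -> R) := adm F f /\ exists c, forall w, `|f w| <= c.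

Lemma bdd_adm_cst F c : bdd_adm F (fun=> c).
Proof. by split; [exact: adm_cst|exists `|c|]. Qed.

Lemma bdd_admD F f g : bdd_adm F f -> bdd_adm F g -> bdd_adm F (fun w => f w + g w).
Proof.
move=> [mf [c fc]] [mg [d gd]]; split; first exact: admD.
by exists (c + d) => w; apply: (le_trans (ler_normD _ _)); exact: lerD.
Qed.

Lemma bdd_admM F f g : bdd_adm F f -> bdd_adm F g -> bdd_adm F (fun w => f w * g w).
Proof.
move=> [mf [c fc]] [mg [d gd]]; split; first exact: admM.
by exists (c * d) => w; rewrite normrM ler_pM.
Qed.

Lemma adm_full (f : Omega -> R) : measurable_fun setT f -> adm measurable f.
Proof.
move=> mf; apply/(admP _ (sigma_algebra_measurable _)) => A mA.
by have := mf measurableT A mA; rewrite setTI.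
Qed.

Lemma unit_bdd_adm F X : vadm F X -> (forall w, nrm (X w) <= 1) -> vcl (bdd_adm F) X.
Proof.
move=> aX X1 i; split; first exact: aX.
by exists 1 => w; apply: le_trans (X1 w); exact: coord_le.
Qed.

Lemma vadm_sub F F' X : F `<=` F' -> vadm F X -> vadm F' X.
Proof. by move=> FF aX i; apply: adm_sub FF (aX i). Qed.

Lemma adm_nrm F X : vadm F X -> adm F (fun w => nrm (X w)).
Proof.
move=> aX; apply: adm_comp; first exact: measurable_sqrtr.
exact: (cl_dot (@adm_cst _ _ _ F) (@admD _ _ _ F) (@admM _ _ _ F)).
Qed.

Lemma vadm_sphproj F X : vadm F X -> vadm F (fun w => sphproj (X w)).
Proof.
move=> aX; apply: vclZ => //; first exact: admM.
by apply: adm_inv => [w|]; [exact: nrm_ge0|exact: adm_nrm].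
Qed.

Lemma vadm_step F (L : 'I_n -> 'M[R]_m) ex h (x : 'I_n -> Omega -> R) X :
  (forall k, adm F (x k)) -> vadm F X ->
  vadm F (fun w => step L ex h (fun k => x k w) (X w)).
Proof.
move=> ax aX; apply: vadm_sphproj; have c := @adm_cst R _ _ F; have D := @admD R _ _ F.
have M := @admM R _ _ F.
apply: vclM => //; apply: vclD => //; first apply: vclD => //.
- by apply: (vclZ M (c h)); exact: vcl_drD.
- by apply: (vclZ M (c (Num.sqrt h))); exact: vcl_dife.
Qed.

Variable P : probability Omega R.

Lemma bdd_adm_L1 F f : F `<=` measurable -> bdd_adm F f -> L1 P f.
Proof.
by move=> Fm [mf [c fc]]; apply: (@L1_bdd _ _ _ P f c) => //; exact: adm_meas Fm mf.
Qed.

Lemma quad_le (B : 'M[R]_m) z : nrm z <= 1 -> `|quad B z| <= mn B.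
Proof.
move=> z1; apply: (le_trans (dotM_le _ _ _)); rewrite ler_piMr ?mn_ge0 //.
by rewrite mulr_ile1 // nrm_ge0.
Qed.

Lemma quad_meas (B : 'M[R]_m) X : vadm measurable X -> measurable_fun setT (fun w => quad B (X w)).
Proof.
move=> aX; have Im : (measurable : set (set Omega)) `<=` measurable by [].
exact: (adm_meas Im (cl_quad (@adm_cst _ _ _ _) (@admD _ _ _ _) (@admM _ _ _ _) B aX)).
Qed.

Lemma quad_L1 X (B : 'M[R]_m) : vadm measurable X -> (forall w, nrm (X w) <= 1) ->
  L1 P (fun w => quad B (X w)).
Proof.
by move=> aX X1; apply: (@L1_bdd _ _ _ P _ (mn B)) => [|w]; [exact: quad_meas|exact: quad_le].
Qed.
End bounded_adapted.

Section weak_chain.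
Context {R : realType} {disp : measure_display} {Omega : measurableType disp}.
Variable P : probability Omega R.
Context {m n : nat}.
Variables (G : 'M[R]_m) (L : 'I_n -> 'M[R]_m) (ex : R -> 'M[R]_m) (T Cex : R).
Hypothesis T0 : 0 < T.
Hypothesis Cex0 : 0 <= Cex.
Hypothesis exP : forall h v, 0 <= h <= T ->
  nrm (ex h *m v - v - h *: (G *m v)) <= Cex * h ^+ 2 * nrm v.
Hypothesis dissip : forall z, dot z (lindblad G L 1%:M *m z) = 0.

(** Odd powers of the noise have zero mean, and in the quadratic term [x_j * x_k]
    averages to the identity matrix. What remains at order [s ^+ 2] is the
    generator applied to the quadratic form of [B], corrected by the generator
    applied to the squared norm, which vanishes. *)
Lemma Ex_weak_main F x c Y B s : noise P F x c -> vadm F Y ->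
  (forall w, unit0 (Y w)) ->
  L1 P (fun w => weak_main G L B s (fun k => x k w) (Y w)) /\
  Ex P (fun w => weak_main G L B s (fun k => x k w) (Y w)) =
  Ex P (fun w => quad (B + s ^+ 2 *: lindblad G L B) (Y w)).
Proof.
move=> Nx aY Y1.
have Fm := noise_sub Nx.
have vb : vcl (bdd_adm F) Y by apply: unit_bdd_adm => // w; exact: unit0_nrm.
have c0 := @bdd_adm_cst R _ _ F; have D0 := @bdd_admD R _ _ F; have M0 := @bdd_admM R _ _ F.
have vE k : vcl (bdd_adm F) (fun w => dif L k (Y w)) by exact: vcl_dif.
have vGE k : vcl (bdd_adm F) (fun w => G *m dif L k (Y w)) by exact: vclM.
have vb' : vcl (bdd_adm F) (fun w => dri G L (Y w)) by exact: vcl_dri.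
have Qb B' : bdd_adm F (fun w => quad B' (Y w)) by exact: cl_quad.
have betb B' (X X' : Omega -> 'cV[R]_m) : vcl (bdd_adm F) X -> vcl (bdd_adm F) X' -> bdd_adm F (fun w => bet B' (X w) (X' w)).
  by move=> *; exact: cl_bet.
pose a1 k w := s * bet B (Y w) (dif L k (Y w))
      + s ^+ 3 * (bet B (Y w) (G *m dif L k (Y w)) + bet B (dif L k (Y w)) (dri G L (Y w))
         - quad B (Y w) * (bet 1%:M (Y w) (G *m dif L k (Y w)) + bet 1%:M (dif L k (Y w)) (dri G L (Y w)))
         - bet B (Y w) (dif L k (Y w)) * bet 1%:M (Y w) (dri G L (Y w))).
pose a0 w := s ^+ 2 * (bet B (Y w) (dri G L (Y w)) - quad B (Y w) * bet 1%:M (Y w) (dri G L (Y w))).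
pose a2 j k w := s ^+ 2 * (dot (dif L j (Y w)) (B *m dif L k (Y w))
      - quad B (Y w) * dot (dif L j (Y w)) (dif L k (Y w))).
pose a3 i j k w := s ^+ 3 * (bet B (Y w) (dif L i (Y w)) * dot (dif L j (Y w)) (dif L k (Y w))).
have b1 k : bdd_adm F (a1 k).
  apply: (D0); apply: (M0) => //; first exact: betb.
  apply: clB => //; last by apply: (M0); exact: betb.
  apply: clB => //; first by apply: (D0); exact: betb.
  by apply: (M0) => //; apply: (D0); exact: betb.
have b0 : bdd_adm F a0.
  by apply: (M0) => //; apply: clB => //; [exact: betb|apply: (M0) => //; exact: betb].
have b2 j k : bdd_adm F (a2 j k).
  apply: (M0) => //; apply: clB => //; first by apply: cl_dot => //; exact: vclM.
  by apply: (M0) => //; exact: cl_dot.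
have b3 i j k : bdd_adm F (a3 i j k).
  by apply: (M0) => //; apply: (M0); [exact: betb|exact: cl_dot].
have E w : weak_main G L B s (fun k => x k w) (Y w) = quad B (Y w)
  + \sum_k a1 k w * x k w + (a0 w + \sum_j \sum_k a2 j k w * (x j w * x k w))
  - \sum_i \sum_j \sum_k a3 i j k w * (x i w * x j w * x k w).
  rewrite weak_mainE; congr (_ + _ + (_ + _) - _).
  - by apply: eq_bigr => k _; rewrite mulrC.
  - by apply: eq_bigr => j _; apply: eq_bigr => k _; rewrite mulrC.
  - by apply: eq_bigr => i _; apply: eq_bigr => j _; apply: eq_bigr => k _; rewrite mulrC.
have iQ : L1 P (fun w => quad B (Y w)) by exact: bdd_adm_L1 Fm (Qb B).
have n1 k := Ex_noise1 Nx k (proj1 (b1 k)) (bdd_adm_L1 P Fm (b1 k)).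
have n2 j k := Ex_noise2 Nx j k (proj1 (b2 j k)) (bdd_adm_L1 P Fm (b2 j k)).
have n3 i j k := Ex_noise3 Nx i j k (proj1 (b3 i j k)) (bdd_adm_L1 P Fm (b3 i j k)).
have i1 : L1 P (fun w => \sum_k a1 k w * x k w).
  by apply: L1_sum => k _; case: (n1 k).
have i0 : L1 P a0 by exact: bdd_adm_L1 Fm b0.
have i2 : L1 P (fun w => \sum_j \sum_k a2 j k w * (x j w * x k w)).
  by apply: L1_sum => j _; apply: L1_sum => k _; case: (n2 j k).
have i3 : L1 P (fun w => \sum_i \sum_j \sum_k a3 i j k w * (x i w * x j w * x k w)).
  by apply: L1_sum => i _; apply: L1_sum => j _; apply: L1_sum => k _; case: (n3 i j k).
move/funext: E => ->.
split; first by apply: L1B => //; apply: L1D; apply: L1D.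
rewrite ExB //; last by apply: L1D; apply: L1D.
rewrite ExD //; [|exact: L1D|exact: L1D].
rewrite !ExD //.
have -> : Ex P (fun w => \sum_k a1 k w * x k w) = 0.
  by rewrite Ex_sum => [|k _]; [rewrite big1 // => k _|]; case: (n1 k).
have -> : Ex P (fun w => \sum_i \sum_j \sum_k a3 i j k w * (x i w * x j w * x k w)) = 0.
  rewrite Ex_sum => [|i _]; last by apply: L1_sum => j _; apply: L1_sum => k _; case: (n3 i j k).
  rewrite big1 // => i _; rewrite Ex_sum => [|j _]; last by apply: L1_sum => k _; case: (n3 i j k).
  rewrite big1 // => j _; rewrite Ex_sum => [|k _]; last by case: (n3 i j k).
  by rewrite big1 // => k _; case: (n3 i j k).
have -> : Ex P (fun w => \sum_j \sum_k a2 j k w * (x j w * x k w)) = Ex P (fun w => \sum_k a2 k k w).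
  rewrite Ex_sum => [|j _]; last by apply: L1_sum => k _; case: (n2 j k).
  rewrite Ex_sum => [|k _]; last exact: bdd_adm_L1 Fm (b2 k k).
  apply: eq_bigr => j _; rewrite Ex_sum => [|k _]; last by case: (n2 j k).
  rewrite (bigD1 j) //= big1 => [|k kj]; last first.
    by have [_ ->] := n2 j k; rewrite eq_sym (negbTE kj) mulr0.
  by have [_ ->] := n2 j j; rewrite eqxx mulr1 addr0.
have i22 : L1 P (fun w => \sum_k a2 k k w).
  by apply: L1_sum => k _; exact: bdd_adm_L1 Fm (b2 k k).
rewrite addr0 subr0 -ExD // -ExD //; last exact: L1D.
congr Ex; apply/funext => w; rewrite /quad mulmxDl dotDr -scalemxAl dotZr -/(quad B (Y w)).
have g1 := generator_quadratic G L B (Y w).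
have g2 := generator_quadratic G L 1%:M (Y w).
rewrite dissip in g2.
have -> : \sum_k a2 k k w = s ^+ 2 * (\sum_k dot (dif L k (Y w)) (B *m dif L k (Y w))
   - quad B (Y w) * \sum_k dot (dif L k (Y w)) (1%:M *m dif L k (Y w))).
  rewrite mulr_sumr -sumrB mulr_sumr; apply: eq_bigr => k _.
  by rewrite /a2 mul1mx.
rewrite -g1 /a0.
move: g2; set S1 := \sum_k dot _ (1%:M *m _) => g2.
have -> : S1 = - bet 1%:M (Y w) (dri G L (Y w)) by move: g2; lra.
by ring.
Qed.

Lemma weak_step_Ex : exists2 C, 0 <= C & forall c F x Y B h, noise P F x c -> 0 <= c ->
  vadm F Y -> (forall w, unit0 (Y w)) -> 0 <= h <= T ->
  `|Ex P (fun w => quad B (step L ex h (fun k => x k w) (Y w)))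
    - Ex P (fun w => quad (B + h *: lindblad G L B) (Y w))| <= C * (1 + c) * mn B * h ^+ 2.
Proof.
have [C C0 ws] := weak_step L T0 Cex0 exP.
exists (C * (n.+1%:R ^+ 8 * n.+1%:R)) => [|c F x Y B h Nx c0 aY Y1 hT].
  by rewrite !mulr_ge0 // exprn_ge0.
have h0 : 0 <= h by case/andP: hT.
have [iM] := Ex_weak_main B (Num.sqrt h) Nx aY Y1.
rewrite sqr_sqrtr // => <-.
have Fm := noise_sub Nx.
have mY i : measurable_fun setT (fun w => Y w i 0) by exact: adm_meas Fm (aY i).
have iS : L1 P (fun w => quad B (step L ex h (fun k => x k w) (Y w))).
  apply: (@L1_bdd _ _ _ P _ (mn B)).
    pose F' : set (set Omega) := measurable.
    have Fs : F' `<=` measurable by [].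
    apply: (adm_meas Fs); apply: cl_quad; [exact: adm_cst|exact: admD|exact: admM|].
    by apply: vadm_step => [k|i]; apply: adm_full => //; exact: noise_mf Nx k.
  move=> w; apply: (le_trans (dotM_le _ _ _)); rewrite -[leRHS]mulr1 ler_wpM2l ?mn_ge0 //.
  have s1 := unit0_nrm (step_unit0 L ex h (fun k => x k w) (Y w)).
  by rewrite -[leRHS]mulr1 ler_pM // nrm_ge0.
rewrite -ExB //.
have iW := weight_L1 Nx (isT : 4 <= 8)%N.
have iR : L1 P (fun w => C * mn B * h ^+ 2 * weight (fun k => x k w) ^+ 4) by exact: L1Z.
apply: (@le_trans _ _ (Ex P (fun w => C * mn B * h ^+ 2 * weight (fun k => x k w) ^+ 4))).
  apply: Ex_abs_le => //; first exact: L1B.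
  by move=> w; exact: ws.
rewrite ExZ //.
have Ch : 0 <= C * mn B * h ^+ 2 by rewrite !mulr_ge0 ?mn_ge0 ?sqr_ge0.
apply: (le_trans (ler_wpM2l Ch (weight_Ex Nx (isT : 4 <= 8)%N))).
have n1 : 1 + n%:R * c <= n.+1%:R * (1 + c).
  by rewrite -natr1; have := ler0n R n; lra.
have -> : C * (n.+1%:R ^+ 8 * n.+1%:R) * (1 + c) * mn B * h ^+ 2 =
  C * mn B * h ^+ 2 * (n.+1%:R ^+ 8 * (n.+1%:R * (1 + c))) by ring.
by rewrite ler_wpM2l // ler_wpM2l // exprn_ge0.
Qed.

Fixpoint chain (h : R) (x : nat -> 'I_n -> R) (z : 'cV[R]_m) (i : nat) : 'cV[R]_m :=
  if i is i'.+1 then step L ex h (x i') (chain h x z i') else z.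

Lemma chain_unit0 h x z i : unit0 z -> unit0 (chain h x z i).
Proof. by case: i => // i _; exact: step_unit0. Qed.

Lemma vadm_chain (F : nat -> set (set Omega)) (x : nat -> 'I_n -> Omega -> R) (Y0 : Omega -> 'cV[R]_m) h N :
  (forall i, (i < N)%N -> F i `<=` F i.+1) -> (forall i k, (i < N)%N -> adm (F i.+1) (x i k)) ->
  vadm (F 0%N) Y0 ->
  forall i, (i <= N)%N -> vadm (F i) (fun w => chain h (fun j k => x j k w) (Y0 w) i).
Proof.
move=> FF ax aY0; elim=> [//|i IH iN]; apply: vadm_step; first by move=> k; exact: ax.
by apply: vadm_sub (FF i iN) (IH (ltnW iN)).
Qed.

(** One Euler step of the linear equation solved by the observable. *)
Definition evol (h : R) (B : 'M[R]_m) : 'M[R]_m := B + h *: lindblad G L B.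

(** A bound for the operator norm of [lindblad]. *)
Definition growth : R := 2 * mn G + \sum_k mn (L k) ^+ 2.

Lemma growth_ge0 : 0 <= growth.
Proof. by rewrite addr_ge0 ?mulr_ge0 ?mn_ge0 // sumr_ge0 // => k _; rewrite sqr_ge0. Qed.

Lemma lindblad_le B : mn (lindblad G L B) <= growth * mn B.
Proof.
rewrite /lindblad /growth mulrDl; apply: (le_trans (mnD _ _)); apply: lerD.
  apply: (le_trans (mnD _ _)); have := mnM G^T B; have := mnM B G; rewrite mn_tr; lra.
apply: (le_trans (mn_sum _ _ _)); rewrite mulr_suml; apply: ler_sum => k _.
apply: (le_trans (mnM _ _)); rewrite expr2 mulrAC; apply: ler_pM; rewrite ?mn_ge0 //.
by apply: (le_trans (mnM _ _)); rewrite mn_tr.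
Qed.

Lemma evol_le h B : 0 <= h -> mn (evol h B) <= (1 + growth * h) * mn B.
Proof.
move=> h0; apply: (le_trans (mnD _ _)); rewrite mnZ ger0_norm // mulrDl mul1r lerD2l.
by rewrite mulrC mulrAC ler_wpM2r // lindblad_le.
Qed.

Lemma iter_evol_le h B i : 0 <= h -> mn (iter i (evol h) B) <= (1 + growth * h) ^+ i * mn B.
Proof.
move=> h0; elim: i => [|i IH]; first by rewrite expr0 mul1r.
rewrite iterS; apply: (le_trans (evol_le _ h0)).
by rewrite exprS -mulrA ler_wpM2l // addr_ge0 // mulr_ge0 // growth_ge0.
Qed.

(** Weak error of the chain: each step reproduces the linear evolution of the
    observable up to O(h^2), and the evolution is stable. *)
Lemma weak_chain_Ex : exists2 C, 0 <= C & forall c (N : nat) (F : nat -> set (set Omega))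
    (x : nat -> 'I_n -> Omega -> R) (Y0 : Omega -> 'cV[R]_m) (h : R),
  0 <= c -> 0 <= h <= T ->
  (forall i, (i < N)%N -> noise P (F i) (x i) c) ->
  (forall i, (i < N)%N -> F i `<=` F i.+1) ->
  (forall i k, (i < N)%N -> adm (F i.+1) (x i k)) ->
  vadm (F 0%N) Y0 -> (forall w, unit0 (Y0 w)) ->
  let Y i w := chain h (fun j k => x j k w) (Y0 w) i in
  forall i B, (i <= N)%N ->
  `|Ex P (fun w => quad B (Y i w)) - Ex P (fun w => quad (iter i (evol h) B) (Y0 w))|
   <= C * (1 + c) * i%:R * h ^+ 2 * (1 + growth * h) ^+ i * mn B.
Proof.
have [C C0 ws] := weak_step_Ex.
exists C => // c N F x Y0 h c0 hT Nx FF ax aY0 Y01 Y.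
have h0 : 0 <= h by case/andP: hT.
have aY i (iN : (i <= N)%N) : vadm (F i) (Y i) := vadm_chain h FF ax aY0 iN.
move=> i; elim: i => [|i IH] B iN.
  by rewrite subrr normr0 !mulr0 !mul0r.
rewrite -[iter i.+1 _ _]/(evol h (iter i (evol h) B)) -iterS iterSr.
have Y1 w : unit0 (Y i w) by apply: chain_unit0.
have S1 := ws c (F i) (x i) (Y i) B h (Nx i iN) c0 (aY i (ltnW iN)) Y1 hT.
have S2 := IH (evol h B) (ltnW iN).
rewrite -(subrKA (Ex P (fun w => quad (evol h B) (Y i w)))).
apply: (le_trans (ler_normD _ _)); apply: (le_trans (lerD S1 S2)).
have l0 := growth_ge0; have p0 : 0 <= growth * h by rewrite mulr_ge0.
set q := 1 + growth * h; have q1 : 1 <= q by rewrite lerDl.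
have B0 := mn_ge0 B.
have D0 : 0 <= C * (1 + c) * h ^+ 2 by rewrite !mulr_ge0 ?addr_ge0 ?sqr_ge0.
have E1 : C * (1 + c) * mn B * h ^+ 2 <= C * (1 + c) * h ^+ 2 * (q ^+ i.+1 * mn B).
  rewrite mulrAC ler_wpM2l // ler_peMl // exprn_ege1 //.
have E2 : C * (1 + c) * i%:R * h ^+ 2 * q ^+ i * mn (evol h B) <=
   C * (1 + c) * h ^+ 2 * (i%:R * (q ^+ i.+1 * mn B)).
  have -> : C * (1 + c) * i%:R * h ^+ 2 * q ^+ i * mn (evol h B) =
     C * (1 + c) * h ^+ 2 * (i%:R * (q ^+ i * mn (evol h B))) by ring.
  rewrite ler_wpM2l // ler_wpM2l // exprSr -mulrA ler_wpM2l ?evol_le //.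
  by rewrite exprn_ge0 // (le_trans _ q1).
apply: (le_trans (lerD E1 E2)); rewrite -natr1 le_eqVlt; apply/orP; left; apply/eqP; ring.
Qed.
End weak_chain.

(** * Strong error of one step against a frozen-coefficient increment *)

Ltac nneg := repeat first [ done | exact: sqr_ge0 | exact: nrm_ge0 | exact: dot_ge0 | exact: mn_ge0
  | exact: ler0n | apply: ltW; assumption | apply: mulr_ge0 | apply: addr_ge0 | apply: exprn_ge0
  | rewrite invr_ge0 ].

Section strong_error.
Context {R : realType} {disp : measure_display} {Omega : measurableType disp}.
Variable P : probability Omega R.
Context {m n : nat}.
Variables (G : 'M[R]_m) (L : 'I_n -> 'M[R]_m) (ex : R -> 'M[R]_m) (T Cex : R).
Hypothesis T0 : 0 < T.
Hypothesis Cex0 : 0 <= Cex.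
Hypothesis exP : forall h v, 0 <= h <= T ->
  nrm (ex h *m v - v - h *: (G *m v)) <= Cex * h ^+ 2 * nrm v.
Hypothesis dissip : forall z, dot z (lindblad G L 1%:M *m z) = 0.

Lemma dot_sqD (a b : 'cV[R]_m) : dot (a + b) (a + b) = dot a a + 2 * dot a b + dot b b.
Proof. by rewrite dotDl !dotDr (dotC b a); ring. Qed.

Lemma sqD_split (h : R) (a b : 'cV[R]_m) : 0 < h ->
  dot (a + b) (a + b) <= (1 + h) * dot a a + (1 + h^-1) * dot b b.
Proof.
move=> h0; have := dot_ge0 (h *: a - b).
rewrite !(dotBl, dotBr, dotZl, dotZr) (dotC b a) => H.
rewrite !(dotDl, dotDr) (dotC b a).
have : 0 <= h^-1 * (h * (h * dot a a - dot a b) - (h * dot a b - dot b b)).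
  by rewrite mulr_ge0 // invr_ge0 ltW.
have -> : h^-1 * (h * (h * dot a a - dot a b) - (h * dot a b - dot b b)) =
  h * dot a a - 2 * dot a b + h^-1 * dot b b by field; rewrite gt_eqF.
lra.
Qed.

Lemma sqD_le (a b : 'cV[R]_m) : dot (a + b) (a + b) <= 2 * dot a a + 2 * dot b b.
Proof. by have := @sqD_split 1 a b ltr01; rewrite invr1; lra. Qed.

Lemma sqB_le (a b : 'cV[R]_m) : dot (a - b) (a - b) <= 2 * dot a a + 2 * dot b b.
Proof. by have := sqD_le a (- b); rewrite dotNl dotNr opprK. Qed.

Lemma nrm_le1D (a : 'cV[R]_m) : nrm a <= 1 + dot a a.
Proof.
by rewrite -nrm_sqr; have := sqr_ge0 (nrm a - 1); rewrite sqrrB; have := nrm_ge0 a; lra.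
Qed.

Lemma sq_le (a : 'cV[R]_m) c : 0 <= c -> nrm a <= c -> dot a a <= c ^+ 2.
Proof. by move=> c0 ac; rewrite -nrm_sqr lerXn2r // ?nnegrE // nrm_ge0. Qed.

Lemma dot_abs_le (a b : 'cV[R]_m) p q : nrm a <= p -> nrm b <= q -> `|dot a b| <= p * q.
Proof.
by move=> ap bq; apply: (le_trans (cauchy_schwarz _ _)); rewrite ler_pM // nrm_ge0.
Qed.

Lemma Ex_diag (q : 'I_n -> 'I_n -> Omega -> R) (x : 'I_n -> Omega -> R) : (forall j k, L1 P (q j k)) ->
   (forall j k, L1 P (fun w => q j k w * (x j w * x k w)) /\
     Ex P (fun w => q j k w * (x j w * x k w)) = Ex P (q j k) * (j == k)%:R) ->
   Ex P (fun w => \sum_j \sum_k q j k w * (x j w * x k w)) = Ex P (fun w => \sum_k q k k w).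
Proof.
move=> iq nq; rewrite [LHS]Ex_sum; last first.
  by move=> j _; apply: L1_sum => k _; case: (nq j k).
rewrite [RHS]Ex_sum => [|k _] //.
apply: eq_bigr => j _; rewrite Ex_sum => [|k _]; last by case: (nq j k).
rewrite (bigD1 j) //= big1 => [|k kj]; last first.
  by have [_ ->] := nq j k; rewrite eq_sym (negbTE kj) mulr0.
by have [_ ->] := nq j j; rewrite eqxx mulr1 addr0.
Qed.

Variables (rho c : R).
Hypothesis c0 : 0 <= c.

(** With the coefficients taken at the solution [Z], the step is the increment of a
    simple stochastic integral; the event [A] keeps them bounded. *)
Definition frozen_step (A : set Omega) h (x : 'I_n -> Omega -> R) (U Z : Omega -> 'cV[R]_m) w :=
  U w + \1_A w *: (h *: dri G L (Z w) + Num.sqrt h *: dife L (fun k => x k w) (Z w)).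

Let indE (A : set Omega) w : (A w /\ \1_A w = 1 :> R) \/ (~ A w /\ \1_A w = 0 :> R).
Proof.
rewrite indicE; case: (boolP (w \in A)) => h; [left|right].
  by split=> //; move: h; rewrite inE.
by split=> //; move: h; rewrite notin_setE.
Qed.

Lemma frozen_step_L2 F x U Z A h : noise P F x c -> vadm F U -> vadm F Z ->
  L1 P (fun w => dot (U w) (U w)) -> F A -> (forall w, A w -> nrm (Z w) <= rho) ->
  0 <= h ->
  L1 P (fun w => dot (frozen_step A h x U Z w) (frozen_step A h x U Z w)).
Proof.
move=> Nx aU aZ iU FA ZA h0.
have Fm := noise_sub Nx.
have [cb cb0 bd] := coef_bound G L rho.
have aF (f : Omega -> R) : adm F f -> adm measurable f by exact: adm_sub.
have mx k : adm measurable (x k) by apply: adm_full; exact: noise_mf Nx k.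
have Cc := @adm_cst R _ _ (measurable : set (set Omega)).
have CD := @admD R _ _ (measurable : set (set Omega)).
have CM := @admM R _ _ (measurable : set (set Omega)).
have mU : vadm measurable U by move=> i; exact: aF (aU i).
have mZ : vadm measurable Z by move=> i; exact: aF (aZ i).
have mA : adm measurable (\1_A : Omega -> R) by exact/aF/adm_indic.
have mS : vadm measurable (frozen_step A h x U Z).
  apply: vclD => //; apply: vclZ => //; apply: vclD => //.
    by apply: (vclZ CM (Cc h)); exact: vcl_dri.
  by apply: (vclZ CM (Cc (Num.sqrt h))); exact: vcl_dife.
have Id : (measurable : set (set Omega)) `<=` measurable by [].
have iW := weight_L1 Nx (isT : 2 <= 8)%N.
apply: (@L1_dom _ _ _ P _ (fun w => 2 * dot (U w) (U w) +
   (4 * (h ^+ 2 * cb ^+ 2) + 4 * (h * cb ^+ 2) * weight (fun k => x k w) ^+ 2))).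
- by apply: (adm_meas Id); exact: cl_dot.
- apply: L1D; first exact: L1Z.
  by apply: L1D; [exact: L1_cst|exact: L1Z].
move=> w; rewrite ger0_norm ?dot_ge0 //; apply: (le_trans (sqD_le _ _)).
rewrite lerD2l dotZl dotZr; have W0 := weight_ge1 (fun k => x k w).
case: (indE A w) => [[Aw ->]|[_ ->]]; last first.
  by rewrite !mul0r mulr0 addr_ge0 ?mulr_ge0 ?exprn_ge0 // (le_trans _ W0).
have [bE bb] := bd _ (ZA w Aw).
rewrite !mul1r; set a := h *: _; set b := Num.sqrt h *: _.
have := sqD_le a b; rewrite /a /b !(dotZl, dotZr).
have h1 : dot (dri G L (Z w)) (dri G L (Z w)) <= cb ^+ 2 by exact: sq_le.
have h2 := sq_le (mulr_ge0 cb0 (le_trans ler01 W0)) (dife_bound (fun k => x k w) bE cb0).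
have hh : Num.sqrt h * (Num.sqrt h * dot (dife L (x^~ w) (Z w)) (dife L (x^~ w) (Z w))) <=
   h * (cb ^+ 2 * weight (x^~ w) ^+ 2).
  by rewrite mulrA -expr2 sqr_sqrtr // ler_wpM2l // -exprMn.
have hh1 : h * (h * dot (dri G L (Z w)) (dri G L (Z w))) <= h ^+ 2 * cb ^+ 2.
  by rewrite mulrA -expr2 ler_wpM2l // sqr_ge0.
lra.
Qed.

(** Squares are compared with Young's inequality in the form [sqD_split], which
    costs a factor [1 + h] only on the part [D + A3] that contains the martingale
    increments. The cross term of order [h] between [D] and the normalisation of
    the step has zero mean because the generator annihilates the squared norm. *)
Lemma strong_step_Ex : exists2 C, 0 <= C & forall F x Y U Z A h,
  noise P F x c -> vadm F Y -> (forall w, unit0 (Y w)) -> vadm F U ->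
  L1 P (fun w => dot (U w) (U w)) -> vadm F Z -> F A ->
  (forall w, A w -> nrm (Z w) <= rho) -> 0 < h <= T ->
  let Y' w := step L ex h (fun k => x k w) (Y w) in
  let U' := frozen_step A h x U Z in
  Ex P (fun w => \1_A w * dot (U' w - Y' w) (U' w - Y' w)) <=
   (1 + C * h) * Ex P (fun w => \1_A w * dot (U w - Y w) (U w - Y w)) +
   C * h * Ex P (fun w => \1_A w * dot (Z w - Y w) (Z w - Y w)) + C * h ^+ 2.
Proof.
pose r1 := Num.max rho 1.
have [cl cl0 lip] := coef_lip G L r1; have [cb cb0 bd] := coef_bound G L 1.
have [cs cs0 st] := strong_step L T0 Cex0 exP.
pose E8 := n.+1%:R ^+ 8 * (1 + n%:R * c).
have E80 : 0 <= E8 by rewrite mulr_ge0 ?exprn_ge0 // addr_ge0 // mulr_ge0.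
pose cn := 2 * cb + cb ^+ 2.
have cn0 : 0 <= cn by rewrite addr_ge0 ?mulr_ge0 ?sqr_ge0.
have T1 : 0 <= 1 + T by rewrite addr_ge0 // ltW.
pose C1 := (1 + T) * 2 * n%:R * cl ^+ 2 + 2 * (1 + T) * cl ^+ 2.
pose C2 := (1 + T) * (2^-1 * cn ^+ 2) * E8 + 2 * (1 + T) * cs ^+ 2 * E8.
have C10 : 0 <= C1.
  by rewrite /C1; nneg.
have C20 : 0 <= C2.
  by rewrite /C2; nneg.
exists (1 + C1 + C2) => [|F x Y U Z A h Nx aY Y1 aU iU aZ FA ZA /andP[h0 hT]].
  by nneg.
cbv zeta; set Y' := fun w => step L ex h _ _; set U' := frozen_step A h x U Z.
have h0' := ltW h0; pose s := Num.sqrt h; have s2 : s ^+ 2 = h by rewrite sqr_sqrtr.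
have s0 : 0 <= s by exact: sqrtr_ge0.
have Fm := noise_sub Nx.
have Cc := @adm_cst R _ _ F; have CD := @admD R _ _ F; have CM := @admM R _ _ F.
have adot (X1 X2 : Omega -> 'cV[R]_m) : vadm F X1 -> vadm F X2 -> adm F (fun w => dot (X1 w) (X2 w)).
  by move=> a1 a2; exact: (cl_dot Cc CD CM a1 a2).
pose kap : Omega -> R := \1_A.
have akap : adm F kap by exact: adm_indic.
have kap0 w : 0 <= kap w by rewrite /kap; case: (indE A w) => [[_ ->]|[_ ->]].
pose D w := U w - Y w.
pose dE k w := dif L k (Z w) - dif L k (Y w).
pose db w := dri G L (Z w) - dri G L (Y w).
have aD : vadm F D by exact: vclB.
have adE k : vadm F (dE k) by apply: vclB => //; exact: vcl_dif.
have aE k : vadm F (fun w => dif L k (Y w)) by exact: vcl_dif.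
have ab : vadm F (fun w => dri G L (Y w)) by exact: vcl_dri.
have Yn w : nrm (Y w) <= 1 by exact: unit0_nrm.
have Yr w : nrm (Y w) <= r1 by apply: le_trans (Yn w) _; rewrite le_max lexx orbT.
have Zr w : A w -> nrm (Z w) <= r1 by move=> /ZA /le_trans; apply; rewrite le_max lexx.
pose K := cl * (r1 + 1).
have r10 : 0 <= r1 by rewrite le_max ler01 orbT.
have K0 : 0 <= K by rewrite mulr_ge0 // addr_ge0.
have ZY w : A w -> nrm (Z w - Y w) <= r1 + 1.
  by move=> Aw; apply: (le_trans (nrmB _ _)); rewrite lerD // Zr.
have dEK k w : A w -> nrm (dE k w) <= K.
  move=> Aw; have [h1 _] := lip _ _ (Zr w Aw) (Yr w).
  by apply: (le_trans (h1 k)); rewrite ler_wpM2l // ZY.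
have iD : L1 P (fun w => dot (D w) (D w)).
  apply: (@L1_dom _ _ _ P _ (fun w => 2 * dot (U w) (U w) + 2)).
  - by apply: (adm_meas Fm); exact: cl_dot.
  - by apply: L1D; [exact: L1Z|exact: L1_cst].
  - move=> w; rewrite ger0_norm ?dot_ge0 //; apply: (le_trans (sqB_le _ _)).
    by have := sq_le ler01 (Yn w); rewrite expr1n; lra.
have ldom (f : Omega -> R) b : adm F f -> (forall w, A w -> `|f w| <= b * nrm (D w)) -> 0 <= b ->
    L1 P (fun w => kap w * f w).
  move=> af fb b0.
  apply: (@L1_dom _ _ _ P _ (fun w => b * (1 + dot (D w) (D w)))).
  - by apply: (adm_meas Fm); exact: CM.
  - by apply: L1Z; apply: L1D => //; exact: L1_cst.
  move=> w; rewrite normrM /kap; case: (indE A w) => [[Aw ->]|[_ ->]]; last first.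
    by rewrite normr0 mul0r mulr_ge0 // addr_ge0 // dot_ge0.
  rewrite normr1 mul1r; apply: (le_trans (fb w Aw)); rewrite ler_wpM2l //.
  exact: nrm_le1D.
have lbdd (f : Omega -> R) b : adm F f -> (forall w, A w -> `|f w| <= b) -> 0 <= b ->
    L1 P (fun w => kap w * f w).
  move=> af fb b0; apply: (@L1_bdd _ _ _ P _ b).
  - by apply: (adm_meas Fm); exact: CM.
  move=> w; rewrite normrM /kap; case: (indE A w) => [[Aw ->]|[_ ->]]; last first.
    by rewrite normr0 mul0r.
  by rewrite normr1 mul1r fb.
(* coefficients, known at the beginning of the step, of the powers of the noise *)
pose a1 k w := kap w * dot (D w) (dE k w).
pose d0 w := kap w * (bet 1%:M (Y w) (dri G L (Y w)) * dot (D w) (Y w)).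
pose d2 j k w := kap w * (dot (dif L j (Y w)) (dif L k (Y w)) * dot (D w) (Y w)).
pose b2 j k w := kap w * dot (dE j w) (dE k w).
have DYn w : `|dot (D w) (Y w)| <= nrm (D w).
  by rewrite -[leRHS]mulr1; exact: dot_abs_le.
have betn w : `|bet 1%:M (Y w) (dri G L (Y w))| <= 2 * cb.
  have [_ hb] := bd _ (Yn w).
  rewrite bet1 normrM ger0_norm // ler_wpM2l //.
  by rewrite -[leRHS]mul1r; exact: dot_abs_le.
have EE j k w : `|dot (dif L j (Y w)) (dif L k (Y w))| <= cb ^+ 2.
  have [hb _] := bd _ (Yn w); rewrite expr2; exact: dot_abs_le.
have ia1 k : L1 P (a1 k).
  apply: (ldom (fun w => dot (D w) (dE k w)) K) => //.
    exact: (adot _ _ aD (adE k)).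
  by move=> w Aw; rewrite mulrC; apply: dot_abs_le => //; exact: dEK.
have id0 : L1 P d0.
  apply: (ldom (fun w => bet 1%:M (Y w) (dri G L (Y w)) * dot (D w) (Y w)) (2 * cb)) => //; last by rewrite mulr_ge0.
    by apply: (CM); [exact: cl_bet|exact: cl_dot].
  by move=> w _; rewrite normrM; apply: ler_pM.
have id2 j k : L1 P (d2 j k).
  apply: (ldom (fun w => dot (dif L j (Y w)) (dif L k (Y w)) * dot (D w) (Y w)) (cb ^+ 2)) => //; last by rewrite sqr_ge0.
    by apply: (CM); [exact: (adot _ _ (aE j) (aE k))|exact: adot].
  by move=> w _; rewrite normrM; apply: ler_pM.
have ib2 j k : L1 P (b2 j k).
  apply: (lbdd (fun w => dot (dE j w) (dE k w)) (K ^+ 2)) => //; last by rewrite sqr_ge0.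
    exact: (adot _ _ (adE j) (adE k)).
  by move=> w Aw; rewrite expr2; apply: dot_abs_le; exact: dEK.
have aa1 k : adm F (a1 k) by apply: (CM) => //; exact: (adot _ _ aD (adE k)).
have ad2 j k : adm F (d2 j k) by apply: (CM) => //; apply: (CM); [exact: (adot _ _ (aE j) (aE k))|exact: adot].
have ab2 j k : adm F (b2 j k) by apply: (CM) => //; exact: (adot _ _ (adE j) (adE k)).
have ikD : L1 P (fun w => kap w * dot (D w) (D w)).
  apply: (L1_dom _ iD); first by apply: (adm_meas Fm); apply: (CM) => //; exact: adot.
  move=> w; rewrite normrM [`|dot _ _|]ger0_norm ?dot_ge0 // /kap.
  by case: (indE A w) => [[_ ->]|[_ ->]]; rewrite ?normr1 ?normr0 ?mul1r // mul0r dot_ge0.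
have ikZ : L1 P (fun w => kap w * dot (Z w - Y w) (Z w - Y w)).
  apply: (lbdd (fun w => dot (Z w - Y w) (Z w - Y w)) ((r1 + 1) ^+ 2)); rewrite ?sqr_ge0 //.
    by apply: cl_dot => //; exact: vclB.
  by move=> w Aw; rewrite ger0_norm ?dot_ge0 // sq_le ?ZY // addr_ge0.
have n1 k := Ex_noise1 Nx k (aa1 k) (ia1 k).
have nd j k := Ex_noise2 Nx j k (ad2 j k) (id2 j k).
have nb j k := Ex_noise2 Nx j k (ab2 j k) (ib2 j k).
have iW p (p8 : (p <= 8)%N) := weight_L1 Nx p8.
pose W w := weight (fun k => x k w).
pose S1 w := \sum_k a1 k w * x k w.
pose S2 w := \sum_j \sum_k d2 j k w * (x j w * x k w).
pose S3 w := \sum_j \sum_k b2 j k w * (x j w * x k w).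
have iS1 : L1 P S1 by apply: L1_sum => k _; case: (n1 k).
have iS2 : L1 P S2 by apply: L1_sum => j _; apply: L1_sum => k _; case: (nd j k).
have iS3 : L1 P S3 by apply: L1_sum => j _; apply: L1_sum => k _; case: (nb j k).
have eS1 : Ex P S1 = 0.
  by rewrite Ex_sum => [|k _]; [rewrite big1 // => k _|]; case: (n1 k).
have eS2 : Ex P d0 + Ex P S2 = 0.
  rewrite (Ex_diag id2 nd) // -ExD //; last by apply: L1_sum => k _.
  rewrite -[RHS](Ex_cst P); congr Ex; apply/funext => w.
  have := generator_quadratic G L 1%:M (Y w); rewrite dissip => g.
  rewrite /d0 /d2 -mulr_sumr -mulr_suml -mulrDr -mulrDl.
  under [X in _ * ((_ + X) * _)]eq_bigr => k _ do rewrite -[dif L k (Y w) in X in dot _ X]mul1mx.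
  by rewrite g mul0r mulr0.
have eS3 : Ex P S3 <= n%:R * cl ^+ 2 * Ex P (fun w => kap w * dot (Z w - Y w) (Z w - Y w)).
  rewrite (Ex_diag ib2 nb) // -ExZ //; apply: Ex_le; [by apply: L1_sum|exact: L1Z|].
  move=> w; rewrite /b2 -mulr_sumr /kap.
  case: (indE A w) => [[Aw ->]|[_ ->]]; last by rewrite !mul0r mulr0.
  have [h1 _] := lip _ _ (Zr w Aw) (Yr w).
  rewrite !mul1r; apply: (@le_trans _ _ (\sum_(k < n) (cl * nrm (Z w - Y w)) ^+ 2)).
    by apply: ler_sum => k _; apply: sq_le; [by rewrite mulr_ge0 ?nrm_ge0|exact: h1].
  by rewrite sumr_const card_ord exprMn nrm_sqr -[leLHS]mulr_natl mulrA.
(* the sums S1, S2, S3 are kept exact since it is their means that are small *)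
pose Maj w := (1 + h) * (kap w * dot (D w) (D w) + 2 * s * S1 w + h * (d0 w + S2 w)
   + 2 * h * S3 w + h ^+ 2 * (2^-1 * cn ^+ 2) * W w ^+ 4)
   + 2 * (1 + T) * h * cl ^+ 2 * (kap w * dot (Z w - Y w) (Z w - Y w))
   + 2 * (1 + T) * cs ^+ 2 * h ^+ 2 * W w ^+ 8.
have W1 w : 1 <= W w by exact: weight_ge1.
have W0 w : 0 <= W w by exact: le_trans (W1 w).
have pt w : kap w * dot (U' w - Y' w) (U' w - Y' w) <= Maj w.
  rewrite /Maj /S1 /S2 /S3 /a1 /d0 /d2 /b2 /U' /frozen_step /kap.
  case: (indE A w) => [[Aw ->]|[_ ->]]; last first.
    rewrite !mul0r !big1 => [|j _|j _|j _]; last 3 first.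
    - by apply: big1 => k _; rewrite !mul0r.
    - by apply: big1 => k _; rewrite !mul0r.
    - by rewrite !mul0r.
    by rewrite !(mulr0, addr0, add0r); nneg.
  rewrite !mul1r scale1r.
  under [X in 2 * s * X]eq_bigr do rewrite mul1r.
  under [X in h * (_ + X)]eq_bigr => j _ do under eq_bigr do rewrite mul1r.
  under [X in 2 * h * X]eq_bigr => j _ do under eq_bigr do rewrite mul1r.
  have [hE hb] := lip _ _ (Zr w Aw) (Yr w); have [bE bb] := bd _ (Yn w).
  set e := dife L (fun k => x k w) (Y w).
  pose nu := q2 1%:M (Y w) e (dri G L (Y w)).
  pose r2 := Y' w - strong_main G L s (fun k => x k w) (Y w).
  have r2n : nrm r2 <= cs * s ^+ 3 * W w ^+ 4 by apply: st => //; rewrite h0'.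
  pose X := \sum_k x k w *: dE k w.
  pose A3 := s *: X + (2^-1 * h * nu) *: Y w.
  have dX : dife L (fun k => x k w) (Z w) = e + X.
    by rewrite /e /X /dife -big_split /=; apply: eq_bigr => k _; rewrite -scalerDr addrC subrK.
  have -> : U w + (h *: dri G L (Z w) + s *: dife L (fun k => x k w) (Z w)) - Y' w =
     (D w + A3) + (h *: db w - r2).
    rewrite /r2 /strong_main -/e -/nu s2 dX /A3 /D /db.
    set v1 := dri G L (Z w); set v2 := dri G L (Y w); set v3 := Y' w; set v4 := Y w; set v5 := U w.
    clearbody e X nu v1 v2 v3 v4 v5.
    by apply/matrixP => i j; rewrite !mxE; ring.
  apply: (le_trans (sqD_split _ _ h0)).
  have en : nrm e <= cb * W w by exact: dife_bound.
  have nun : nu ^+ 2 <= cn ^+ 2 * W w ^+ 4.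
    have nn : `|nu| <= cn * W w ^+ 2.
      rewrite /nu /q2 quad1; apply: (le_trans (ler_normD _ _)); rewrite /cn mulrDl lerD //.
        apply: (le_trans (betn w)); rewrite ler_peMr ?mulr_ge0 // exprn_ege1 //.
      by rewrite ger0_norm ?dot_ge0 // -exprMn sq_le // mulr_ge0.
    have := lerXn2r 2 (normr_ge0 nu) (le_trans (normr_ge0 nu) nn) nn.
    by rewrite -normrX ger0_norm ?sqr_ge0 // exprMn -exprM.
  have hA3 : dot A3 A3 <= 2 * h * dot X X + h ^+ 2 * (2^-1 * cn ^+ 2) * W w ^+ 4.
    apply: (le_trans (sqD_le _ _)); rewrite !(dotZl, dotZr).
    have -> : 2 * (s * (s * dot X X)) = 2 * h * dot X X by rewrite -s2; ring.
    rewrite lerD2l.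
    have Y2 : dot (Y w) (Y w) <= 1 by have := sq_le ler01 (Yn w); rewrite expr1n.
    have -> : 2 * (2^-1 * h * nu * (2^-1 * h * nu * dot (Y w) (Y w))) =
      h ^+ 2 * 2^-1 * (nu ^+ 2 * dot (Y w) (Y w)) by field.
    have -> : h ^+ 2 * (2^-1 * cn ^+ 2) * W w ^+ 4 = h ^+ 2 * 2^-1 * (cn ^+ 2 * W w ^+ 4) by ring.
    rewrite ler_wpM2l ?mulr_ge0 ?sqr_ge0 ?invr_ge0 //.
    by apply: le_trans nun; rewrite ler_piMr ?sqr_ge0.
  have XX : dot X X = \sum_j \sum_k dot (dE j w) (dE k w) * (x j w * x k w).
    rewrite /X dot_suml; apply: eq_bigr => j _; rewrite dotZl dot_sumr mulr_sumr.
    by apply: eq_bigr => k _; rewrite dotZr; ring.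
  have DX : dot (D w) X = \sum_k dot (D w) (dE k w) * x k w.
    by rewrite /X dot_sumr; apply: eq_bigr => k _; rewrite dotZr mulrC.
  have nuE : nu * dot (D w) (Y w) = bet 1%:M (Y w) (dri G L (Y w)) * dot (D w) (Y w) +
    \sum_j \sum_k dot (dif L j (Y w)) (dif L k (Y w)) * dot (D w) (Y w) * (x j w * x k w).
    rewrite /nu /q2 mulrDl quad1; congr (_ + _).
    rewrite /e /dife dot_suml mulr_suml; apply: eq_bigr => j _.
    rewrite dotZl dot_sumr [LHS]mulrAC mulr_sumr; apply: eq_bigr => k _.
    by rewrite dotZr; ring.
  have hD : dot (D w + A3) (D w + A3) <= dot (D w) (D w)
     + 2 * s * \sum_k dot (D w) (dE k w) * x k w
     + h * (bet 1%:M (Y w) (dri G L (Y w)) * dot (D w) (Y w) +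
        \sum_j \sum_k dot (dif L j (Y w)) (dif L k (Y w)) * dot (D w) (Y w) * (x j w * x k w))
     + 2 * h * \sum_j \sum_k dot (dE j w) (dE k w) * (x j w * x k w)
     + h ^+ 2 * (2^-1 * cn ^+ 2) * W w ^+ 4.
    rewrite -XX -DX -nuE.
    have -> : dot (D w + A3) (D w + A3) = dot (D w) (D w) + 2 * s * dot (D w) X
      + h * (nu * dot (D w) (Y w)) + dot A3 A3.
      have E2 : dot (D w) A3 = s * dot (D w) X + 2^-1 * h * nu * dot (D w) (Y w).
        by rewrite dotDr !dotZr.
      by rewrite dot_sqD E2; field.
    by rewrite -[leRHS]addrA lerD2l.
  have hR : dot (h *: db w - r2) (h *: db w - r2) <=
     2 * (h ^+ 2 * (cl ^+ 2 * dot (Z w - Y w) (Z w - Y w))) + 2 * (cs ^+ 2 * h ^+ 3 * W w ^+ 8).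
    apply: (le_trans (sqB_le _ _)); apply: lerD; rewrite ler_wpM2l //.
      rewrite dotZl dotZr mulrA -expr2 ler_wpM2l ?sqr_ge0 //.
      by rewrite -[dot (Z w - Y w) _]nrm_sqr -exprMn sq_le // mulr_ge0 // nrm_ge0.
    have -> : cs ^+ 2 * h ^+ 3 * W w ^+ 8 = (cs * s ^+ 3 * W w ^+ 4) ^+ 2 by rewrite -s2; ring.
    by rewrite sq_le // !mulr_ge0 // ?exprn_ge0.
  have hh : (1 + h^-1) * h ^+ 2 = (1 + h) * h by field; rewrite gt_eqF.
  have hi : 0 <= 1 + h^-1 by rewrite addr_ge0 // invr_ge0.
  have h1 : 0 <= 1 + h by rewrite addr_ge0.
  have Q0 : 0 <= cl ^+ 2 * dot (Z w - Y w) (Z w - Y w) by rewrite mulr_ge0 ?sqr_ge0 ?dot_ge0.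
  have Q1 : 0 <= cs ^+ 2 * W w ^+ 8 by rewrite mulr_ge0 ?sqr_ge0 ?exprn_ge0.
  have HR := ler_wpM2l hi hR.
  have {}HR : (1 + h^-1) * dot (h *: db w - r2) (h *: db w - r2) <=
     2 * (1 + T) * h * cl ^+ 2 * dot (Z w - Y w) (Z w - Y w) + 2 * (1 + T) * cs ^+ 2 * h ^+ 2 * W w ^+ 8.
    apply: (le_trans HR).
    have -> : (1 + h^-1) * (2 * (h ^+ 2 * (cl ^+ 2 * dot (Z w - Y w) (Z w - Y w))) + 2 * (cs ^+ 2 * h ^+ 3 * W w ^+ 8))
     = (1 + h^-1) * h ^+ 2 * (2 * (cl ^+ 2 * dot (Z w - Y w) (Z w - Y w)) + 2 * h * (cs ^+ 2 * W w ^+ 8)) by ring.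
    rewrite hh.
    have -> : 2 * (1 + T) * h * cl ^+ 2 * dot (Z w - Y w) (Z w - Y w) + 2 * (1 + T) * cs ^+ 2 * h ^+ 2 * W w ^+ 8
     = (1 + T) * h * (2 * (cl ^+ 2 * dot (Z w - Y w) (Z w - Y w)) + 2 * h * (cs ^+ 2 * W w ^+ 8)) by ring.
    apply: ler_wpM2r; last by rewrite ler_wpM2r // lerD2l.
    by apply: addr_ge0; apply: mulr_ge0 => //; apply: mulr_ge0.
  by rewrite -[leRHS]addrA; apply: lerD => //; exact: ler_wpM2l.
have iMaj : L1 P Maj.
  have i4 := iW 4%N isT; have i8 := iW 8%N isT.
  apply: L1D; last exact: L1Z.
  apply: L1D; last exact: L1Z.
  apply: L1Z; apply: L1D; last exact: L1Z.
  apply: L1D; last exact: L1Z.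
  apply: L1D; last by apply: L1Z; exact: L1D.
  by apply: L1D => //; exact: L1Z.
have aF (f : Omega -> R) : adm F f -> adm measurable f by exact: adm_sub.
have iLHS : L1 P (fun w => kap w * dot (U' w - Y' w) (U' w - Y' w)).
  have Id : (measurable : set (set Omega)) `<=` measurable by [].
  have mx k : adm measurable (x k) by apply: adm_full; exact: noise_mf Nx k.
  have Cc' := @adm_cst R _ _ (measurable : set (set Omega)).
  have CD' := @admD R _ _ (measurable : set (set Omega)).
  have CM' := @admM R _ _ (measurable : set (set Omega)).
  have mU : vadm measurable U by move=> i; exact: aF (aU i).
  have mY : vadm measurable Y by move=> i; exact: aF (aY i).
  have mZ : vadm measurable Z by move=> i; exact: aF (aZ i).
  have mk : adm measurable kap by exact: aF.
  apply: (L1_dom _ iMaj) => [|w]; last first.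
    by rewrite ger0_norm // mulr_ge0 ?dot_ge0.
  apply: (adm_meas Id); apply: (CM') => //; apply: cl_dot => //;
    (apply: vclB => //; last exact: vadm_step);
    (apply: vclD => //; apply: vclZ => //; apply: vclD => //;
      [by apply: (vclZ CM' (Cc' h)); exact: vcl_dri
      |by apply: (vclZ CM' (Cc' (Num.sqrt h))); exact: vcl_dife]).
apply: (le_trans (Ex_le iLHS iMaj pt)).
have i4 := iW 4%N isT; have i8 := iW 8%N isT.
have e4 : Ex P (fun w => W w ^+ 4) <= E8 := weight_Ex Nx (isT : 4 <= 8)%N.
have e8 : Ex P (fun w => W w ^+ 8) <= E8 := weight_Ex Nx (isT : 8 <= 8)%N.
have eMaj : Ex P Maj = (1 + h) * (Ex P (fun w => kap w * dot (D w) (D w)) + 2 * s * Ex P S1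
   + h * (Ex P d0 + Ex P S2) + 2 * h * Ex P S3 + h ^+ 2 * (2^-1 * cn ^+ 2) * Ex P (fun w => W w ^+ 4))
   + 2 * (1 + T) * h * cl ^+ 2 * Ex P (fun w => kap w * dot (Z w - Y w) (Z w - Y w))
   + 2 * (1 + T) * cs ^+ 2 * h ^+ 2 * Ex P (fun w => W w ^+ 8).
  have j1 : L1 P (fun w => kap w * dot (D w) (D w) + 2 * s * S1 w) by apply: L1D => //; exact: L1Z.
  have j2 : L1 P (fun w => h * (d0 w + S2 w)) by apply: L1Z; exact: L1D.
  have j3 : L1 P (fun w => 2 * h * S3 w) by exact: L1Z.
  have j4 : L1 P (fun w => h ^+ 2 * (2^-1 * cn ^+ 2) * W w ^+ 4) by exact: L1Z.
  have j12 := L1D j1 j2; have j123 := L1D j12 j3; have j1234 := L1D j123 j4.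
  have j5 : L1 P (fun w => 2 * (1 + T) * h * cl ^+ 2 * (kap w * dot (Z w - Y w) (Z w - Y w))) by exact: L1Z.
  have j6 : L1 P (fun w => 2 * (1 + T) * cs ^+ 2 * h ^+ 2 * W w ^+ 8) by exact: L1Z.
  have l1 : L1 P (fun w => 2 * s * S1 w) by exact: L1Z.
  have l2 : L1 P (fun w => d0 w + S2 w) by exact: L1D.
  have l5 : L1 P (fun w => (1 + h) * (kap w * dot (D w) (D w) + 2 * s * S1 w + h * (d0 w + S2 w)
   + 2 * h * S3 w + h ^+ 2 * (2^-1 * cn ^+ 2) * W w ^+ 4)) by exact: L1Z.
  rewrite /Maj (ExD (L1D l5 j5) j6) (ExD l5 j5) (ExZ _ j1234) (ExD j123 j4) (ExD j12 j3) (ExD j1 j2).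
  by rewrite (ExD ikD l1) (ExZ _ iS1) (ExZ _ l2) (ExD id0 iS2) (ExZ _ iS3) (ExZ _ i4) (ExZ _ ikZ) (ExZ _ i8).
rewrite eMaj eS1 eS2 !mulr0 !addr0.
set a := Ex P (fun w => kap w * dot (D w) (D w)).
set ez := Ex P (fun w => kap w * dot (Z w - Y w) (Z w - Y w)) in eS3 *.
have a0 : 0 <= a.
  by apply: Ex_ge0 => w; rewrite mulr_ge0 ?dot_ge0.
have ez0 : 0 <= ez.
  by apply: Ex_ge0 => w; rewrite mulr_ge0 ?dot_ge0.
have t3 : (1 + h) * (2 * h * Ex P S3) <= (1 + T) * 2 * n%:R * cl ^+ 2 * h * ez.
  have -> : (1 + T) * 2 * n%:R * cl ^+ 2 * h * ez = (1 + T) * (2 * h * (n%:R * cl ^+ 2 * ez)) by ring.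
  have q0 : 0 <= n%:R * cl ^+ 2 * ez by rewrite !mulr_ge0 // sqr_ge0.
  apply: (@le_trans _ _ ((1 + h) * (2 * h * (n%:R * cl ^+ 2 * ez)))).
    by rewrite ler_wpM2l ?addr_ge0 // ler_wpM2l // mulr_ge0.
  by rewrite ler_wpM2r ?lerD2l // !mulr_ge0.
have t4 : (1 + h) * (h ^+ 2 * (2^-1 * cn ^+ 2) * Ex P (fun w => W w ^+ 4)) <=
   (1 + T) * (2^-1 * cn ^+ 2) * E8 * h ^+ 2.
  have -> : (1 + T) * (2^-1 * cn ^+ 2) * E8 * h ^+ 2 = (1 + T) * (h ^+ 2 * (2^-1 * cn ^+ 2) * E8) by ring.
  have q0 : 0 <= h ^+ 2 * (2^-1 * cn ^+ 2) by rewrite !mulr_ge0 ?sqr_ge0 // invr_ge0.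
  apply: (@le_trans _ _ ((1 + h) * (h ^+ 2 * (2^-1 * cn ^+ 2) * E8))).
    by rewrite ler_wpM2l ?addr_ge0 // ler_wpM2l.
  by rewrite ler_wpM2r ?lerD2l // mulr_ge0.
have t8 : 2 * (1 + T) * cs ^+ 2 * h ^+ 2 * Ex P (fun w => W w ^+ 8) <= 2 * (1 + T) * cs ^+ 2 * E8 * h ^+ 2.
  rewrite [leRHS]mulrAC ler_wpM2l // !mulr_ge0 // sqr_ge0.
have u1 : 0 <= (C1 + C2) * h * a by rewrite !mulr_ge0 // addr_ge0.
have u2 : 0 <= (1 + C2) * h * ez by rewrite !mulr_ge0 // addr_ge0.
have u3 : 0 <= (1 + C1) * h ^+ 2 by rewrite mulr_ge0 ?sqr_ge0 // addr_ge0.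
have e1 : (1 + h) * (h ^+ 2 * (2^-1 * cn ^+ 2) * Ex P (fun w => W w ^+ 4)) + 
  2 * (1 + T) * cs ^+ 2 * h ^+ 2 * Ex P (fun w => W w ^+ 8) <= C2 * h ^+ 2.
  by rewrite [C2 * _]mulrDl lerD.
have e2 : (1 + h) * (2 * h * Ex P S3) + 2 * (1 + T) * h * cl ^+ 2 * ez <= C1 * h * ez.
  have -> : 2 * (1 + T) * h * cl ^+ 2 * ez = 2 * (1 + T) * cl ^+ 2 * h * ez by ring.
  have -> : C1 * h * ez = (1 + T) * 2 * n%:R * cl ^+ 2 * h * ez + 2 * (1 + T) * cl ^+ 2 * h * ez by rewrite /C1; ring.
  by rewrite lerD2r.
clearbody C1 C2; move: u1 u2 u3 e1 e2; lra.
Qed.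
End strong_error.

(** * Elementary stochastic integrals *)

Section brownian_noise.
Context {R : realType} {disp : measure_display} {Omega : measurableType disp}.
Variable P : probability Omega R.
Variables (F : R -> set (set Omega)) (n : nat) (W : 'I_n -> R -> Omega -> R).
Hypothesis usualF : usual_filtration P F.
Hypothesis BM : brownian P F W.

Lemma filt_sa t : 0 <= t -> sigma_algebra setT (F t).
Proof. by case: usualF => H _ _ _ _ /H[]. Qed.

Lemma filt_meas t : 0 <= t -> F t `<=` measurable.
Proof. by case: usualF => H _ _ _ _ /H[]. Qed.

Lemma filt_mono s t : 0 <= s -> s <= t -> F s `<=` F t.
Proof. by case: usualF => _ H _ _ _; exact: H. Qed.

Lemma bm_adm k t : 0 <= t -> adm (F t) (W k t).
Proof. by move=> t0; apply/(admP _ (filt_sa t0)); case: BM => _ _ H _; exact: H. Qed.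

Lemma bm_incr_adm k s t : 0 <= s -> s <= t -> adm (F t) (fun w => W k t w - W k s w).
Proof.
move=> s0 st; have t0 := le_trans s0 st; apply: admB; first exact: bm_adm.
by apply: adm_sub (bm_adm k s0); exact: filt_mono.
Qed.

(** Brownian increments normalised to unit variance, so that a step of the chain
    with noise [incr s t] and size [t - s] uses the increment itself. *)
Definition incr s t k w := (Num.sqrt (t - s))^-1 * (W k t w - W k s w).

Lemma bm_noise s t : 0 <= s -> s < t -> noise P (F s) (incr s t) gauss8.
Proof.
move=> s0 st; have t0 := le_trans s0 (ltW st).
have d0 : 0 < Num.sqrt (t - s) by rewrite sqrtr_gt0 subr_gt0.
set r := Num.sqrt (t - s) in d0 *.
case: BM => _ _ _ /(_ s t s0 st) /=; set dW := (fun k w => _); move=> [ind rvs law].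
have mdW k : measurable_fun setT (dW k).
  by apply: (adm_meas (filt_meas t0)); exact: (bm_incr_adm k s0 (ltW st)).
have mom f : L1 (gauss r) f -> forall k, L1 P (fun w => f (dW k w)) /\ Ex P (fun w => f (dW k w)) = Ex (gauss r) f.
  by move=> lf k; apply: Ex_law => // B mB; rewrite law.
have rV p : (r^-1) ^+ p * r ^+ p = 1 by rewrite -exprMn mulVf ?gt_eqF // expr1n.
have sc p k : (p <= 8)%N -> L1 P (fun w => incr s t k w ^+ p) /\
   Ex P (fun w => incr s t k w ^+ p) = (r^-1) ^+ p * Ex (gauss r) (fun x => x ^+ p).
  move=> p8; have [l e] := mom _ (gauss_Lp d0 p8) k.
  have -> : (fun w => incr s t k w ^+ p) = (fun w => (r^-1) ^+ p * dW k w ^+ p).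
    by apply/funext => w; rewrite /incr exprMn.
  by split; [exact: L1Z|rewrite ExZ // e].
split.
- exact: filt_sa.
- exact: filt_meas.
- move=> k; apply: measurable_funM; [exact: measurable_cst|exact: mdW].
- apply: indep_sysS ind => //; apply: sigma_gen_min; first exact: sigma_gen_sa.
  by move=> k; apply: admM; [exact: adm_cst|exact: (sigma_gen_adm dW k)].
- move=> B mB; pose B' k := [set x | B k (r^-1 * x)].
  have mB' k : measurable (B' k).
    have mf : measurable_fun setT (fun x : R => r^-1 * x).
      by apply: measurable_funM; [exact: measurable_cst|exact: measurable_id].
    by have := mf measurableT _ (mB k); rewrite setTI.
  exact: (rvs B' mB').
- by move=> k; case: (sc 8 k).
- move=> k; have [_ ->] := sc 8 k isT.
  apply: (@le_trans _ _ ((r^-1) ^+ 8 * (r ^+ 8 * gauss8))).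
    by rewrite ler_wpM2l ?exprn_ge0 ?invr_ge0 ?(ltW d0) //; exact: gauss_E8.
  by rewrite mulrA rV mul1r.
- move=> k; have [_] := sc 1 k isT; rewrite [in RHS]expr1.
  have -> : (fun x : R => x ^+ 1) = (fun x => x) by apply/funext => x; rewrite expr1.
  by rewrite gauss_E1 // mulr0.
- by move=> k; have [_ ->] := sc 2 k isT; rewrite gauss_E2 // rV.
- by move=> k; have [_ ->] := sc 3 k isT; rewrite gauss_E3 // mulr0.
Qed.

Section grid_sums.
Variables (tau : nat -> R) (k : 'I_n) (D : nat -> Omega -> R).
Hypothesis tau0 : 0 <= tau 0%N.
Hypothesis tauS : forall i, tau i <= tau i.+1.
Hypothesis DF : forall i, bdd_adm (F (tau i)) (D i).

Lemma tau_nd i j : (i <= j)%N -> tau i <= tau j.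
Proof. by elim: j i => [|j IH] [|i] //; rewrite ?leqn0 // leq_eqVlt => /predU1P[->//|]; rewrite ltnS => /IH/le_trans; apply. Qed.

Lemma tau_ge0 i : 0 <= tau i.
Proof. exact: le_trans (tau_nd (leq0n i)). Qed.

Definition grid_sum (D : nat -> Omega -> R) N w :=
  \sum_(i < N) D i w * (W k (tau i.+1) w - W k (tau i) w).

Definition grid_bracket (D : nat -> Omega -> R) N w := \sum_(i < N) D i w ^+ 2 * (tau i.+1 - tau i).

(** Elementary Ito isometry: the increments are orthogonal to the past. *)
Lemma grid_sum_L2 N : [/\ adm (F (tau N)) (grid_sum D N), L1 P (fun w => grid_sum D N w ^+ 2),
  L1 P (grid_bracket D N) & Ex P (fun w => grid_sum D N w ^+ 2) = Ex P (grid_bracket D N)].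
Proof.
have Fm i := filt_meas (tau_ge0 i).
have bD2 i : L1 P (fun w => D i w ^+ 2 * (tau i.+1 - tau i)).
  apply: (bdd_adm_L1 _ (Fm i)); apply: bdd_admM (bdd_adm_cst _ _).
  by under eq_fun do rewrite expr2; exact: bdd_admM.
elim: N => [|N [aS lS lb eS]].
  have e1 : grid_sum D 0 = fun=> 0 by apply/funext => w; rewrite /grid_sum big_ord0.
  have e2 : grid_bracket D 0 = fun=> 0 by apply/funext => w; rewrite /grid_bracket big_ord0.
  rewrite e1 e2; split; [exact: adm_cst|exact: L1_cst|exact: L1_cst|].
  by congr Ex; apply/funext => w; rewrite expr0n.
have eb : grid_bracket D N.+1 = fun w => grid_bracket D N w + D N w ^+ 2 * (tau N.+1 - tau N).
  by apply/funext => w; rewrite /grid_bracket big_ord_recr.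
have es : grid_sum D N.+1 = fun w => grid_sum D N w + D N w * (W k (tau N.+1) w - W k (tau N) w).
  by apply/funext => w; rewrite /grid_sum big_ord_recr.
have FS : F (tau N) `<=` F (tau N.+1) by apply: filt_mono => //; exact: tau_ge0.
have aS' : adm (F (tau N.+1)) (grid_sum D N.+1).
  rewrite es; apply: admD; first exact: adm_sub aS.
  apply: admM; first by apply: adm_sub FS _; case: (DF N).
  by apply: bm_incr_adm => //; exact: tau_ge0.
have [tE|tN] := eqVneq (tau N.+1) (tau N).
  have {}es : grid_sum D N.+1 = grid_sum D N by apply/funext => w; rewrite es /= tE subrr mulr0 addr0.
  have {}eb : grid_bracket D N.+1 = grid_bracket D N by apply/funext => w; rewrite eb /= tE subrr mulr0 addr0.
  by rewrite es eb; split=> //; rewrite -es.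
have tlt : tau N < tau N.+1 by rewrite lt_neqAle eq_sym tN tauS.
have Nx := bm_noise (tau_ge0 N) tlt; set x := incr _ _ in Nx.
set r := Num.sqrt (tau N.+1 - tau N).
have r0 : 0 < r by rewrite sqrtr_gt0 subr_gt0.
have r2 : r ^+ 2 = tau N.+1 - tau N by rewrite sqr_sqrtr // subr_ge0 ltW.
have xE w : W k (tau N.+1) w - W k (tau N) w = r * x k w.
  by rewrite /x /incr -/r mulrA divff ?gt_eqF // mul1r.
have [aD [c Dc]] := DF N.
have lSD : L1 P (fun w => grid_sum D N w * D N w).
  apply: (@L1_dom _ _ _ P _ (fun w => c * (1 + grid_sum D N w ^+ 2))).
  - by apply: (adm_meas (Fm N)); exact: admM.
  - by apply: L1Z; apply: L1D => //; exact: L1_cst.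
  - move=> w; rewrite normrM mulrC ler_pM //.
    have := sqr_ge0 (`|grid_sum D N w| - 1); rewrite sqrrB real_normK ?num_real //.
    by have := normr_ge0 (grid_sum D N w); lra.
have [l1 e1] := Ex_noise1 Nx k (admM aS aD) lSD.
have bDD : bdd_adm (F (tau N)) (fun w => D N w * D N w) by exact: bdd_admM.
have [l2 e2] := Ex_noise2 Nx k k (proj1 bDD) (bdd_adm_L1 P (Fm N) bDD).
have sE : (fun w => grid_sum D N.+1 w ^+ 2) = (fun w => grid_sum D N w ^+ 2 +
    (2 * r * (grid_sum D N w * D N w * x k w) + r ^+ 2 * (D N w * D N w * (x k w * x k w)))).
  by apply/funext => w; rewrite es /= xE; ring.
rewrite sE eb; split.
- exact: aS'.
- by apply: L1D => //; apply: L1D; exact: L1Z.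
- exact: L1D.
- rewrite (ExD lS (L1D (L1Z _ l1) (L1Z _ l2))) (ExD (L1Z _ l1) (L1Z _ l2)) !ExZ // e1 e2 eqxx.
  rewrite mulr0 add0r mulr1 r2 (ExD lb (bD2 N)) eS; congr (_ + _).
  rewrite -ExZ; last exact: bdd_adm_L1 (Fm N) bDD.
  by congr Ex; apply/funext => w; rewrite mulrC expr2.
Qed.
End grid_sums.

(** Stopping the sum as soon as its bracket would exceed delta changes nothing
    where the bracket stays below delta, and leaves a sum whose second moment is
    at most delta. *)
Lemma grid_sum_tail tau k D N (delta eps : R) : 0 <= tau 0%N -> (forall i, tau i <= tau i.+1) ->
  (forall i, bdd_adm (F (tau i)) (D i)) -> 0 <= delta -> 0 < eps ->
  pr P ([set w | grid_bracket tau D N w <= delta] `&` [set w | eps <= `|grid_sum tau k D N w|]) <= delta / eps ^+ 2.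
Proof.
move=> tau0 tauS DF d0 e0.
have t0 i := tau_ge0 tau0 tauS i.
have Fm i := filt_meas (t0 i).
have aB i : adm (F (tau i)) (grid_bracket tau D i.+1).
  apply: adm_sum => l _; apply: admM (adm_cst _ _); apply: admX.
  by apply: adm_sub (proj1 (DF l)); apply: filt_mono => //; exact/tau_nd/(ltn_ord l).
(* the bracket up to tau i.+1 is known at time tau i, so D' is adapted *)
pose A i := [set w | grid_bracket tau D i.+1 w <= delta].
have FA i : F (tau i) (A i) by apply: adm_le_set (aB i) (adm_cst _ _); exact: filt_sa.
pose D' i w := \1_(A i) w * D i w.
have DF' i : bdd_adm (F (tau i)) (D' i).
  by apply: bdd_admM => //; split; [exact: adm_indic|exists 1 => w; rewrite indicE; case: (_ \in _); rewrite ?normr1 ?normr0].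
have brk_nd w i j : (i <= j)%N -> grid_bracket tau D i w <= grid_bracket tau D j w.
  move=> ij; rewrite /grid_bracket -(subnKC ij) big_split_ord /= lerDl sumr_ge0 // => l _.
  by rewrite mulr_ge0 ?sqr_ge0 // subr_ge0.
have brkS D0 j w : grid_bracket tau D0 j.+1 w = grid_bracket tau D0 j w + D0 j w ^+ 2 * (tau j.+1 - tau j).
  by rewrite /grid_bracket big_ord_recr.
have le' w j : grid_bracket tau D' j w <= delta.
  suff: grid_bracket tau D' j w <= delta /\ (grid_bracket tau D j w <= delta -> grid_bracket tau D' j w = grid_bracket tau D j w) by case.
  elim: j => [|j [IH1 IH2]]; first by rewrite /grid_bracket !big_ord0.
  rewrite !brkS /D' indicE; have [|] := boolP (w \in A j).
    rewrite inE /A /= => Aj; rewrite mul1r.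
    have -> := IH2 (le_trans (brk_nd w _ _ (leqnSn j)) Aj).
    by rewrite -brkS.
  rewrite notin_setE /A /= => Aj; rewrite mul0r expr0n mul0r addr0; split=> //.
  by rewrite -brkS.
have eqD w : grid_bracket tau D N w <= delta -> grid_sum tau k D' N w = grid_sum tau k D N w.
  move=> H; apply: eq_bigr => i _; congr (_ * _); rewrite /D' indicE mem_set ?mul1r //.
  by rewrite /A /=; apply: le_trans H; exact/brk_nd/(ltn_ord i).
have [aM l2 lb e2] := grid_sum_L2 k tau0 tauS DF' N.
have [aM0 l20 lb0 _] := grid_sum_L2 k tau0 tauS DF N.
have m1 := L1_meas lb0.
have mA1 : measurable [set w | eps <= `|grid_sum tau k D N w|].
  rewrite -[X in measurable X]setTI; apply: measurable_fun_ler => //.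
  by apply: measurableT_comp => //; exact: adm_meas (Fm N) aM0.
have mA2 : measurable [set w | grid_bracket tau D N w <= delta].
  by rewrite -[X in measurable X]setTI; apply: measurable_fun_ler.
have mA3 : measurable [set w | eps ^+ 2 <= grid_sum tau k D' N w ^+ 2].
  by rewrite -[X in measurable X]setTI; apply: measurable_fun_ler => //; exact: (L1_meas l2).
apply: (@le_trans _ _ (pr P [set w | eps ^+ 2 <= grid_sum tau k D' N w ^+ 2])).
  apply: pr_mono => //; first exact: measurableI.
  by move=> w /= [H we]; rewrite eqD // -[leRHS]real_normK ?num_real // lerXn2r // nnegrE ltW.
have e20 : 0 < eps ^+ 2 by rewrite exprn_gt0.
apply: (le_trans (pr_markov e20 l2 _)) => [w|]; first exact: sqr_ge0.
rewrite ler_wpM2r ?invr_ge0 ?(ltW e20) // e2 -[leRHS](Ex_cst P).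
by apply: Ex_le => //; exact: L1_cst.
Qed.
End brownian_noise.

Section refinement.
Context {R : realType} {disp : measure_display} {Omega : measurableType disp}.
Variables (F : R -> set (set Omega)).

Lemma sp_nd (S : simple_process F) i j : (i <= j)%N -> sp_time S i <= sp_time S j.
Proof. exact: (tau_nd (sp_time_nd S)). Qed.

Definition clip (S : simple_process F) (t : R) i := Num.min (sp_time S i) t.

Record grid (t : R) (N : nat) (tau : nat -> R) : Prop := Grid {
  grid0 : tau 0%N = 0;
  gridS : forall i, tau i <= tau i.+1;
  gridN : tau N = t }.

Definition in_grid (S : simple_process F) t N (tau : nat -> R) :=
  forall l, (l <= sp_size S)%N -> exists2 i, (i <= N)%N & tau i = clip S t l.

Lemma common_grid (S S' : simple_process F) t : 0 <= t -> exists N, exists tau,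
  [/\ grid t N tau, in_grid S t N tau & in_grid S' t N tau].
Proof.
move=> t0; pose s0 := 0 :: [seq clip S t i | i <- iota 0 (sp_size S).+1] ++
  [seq clip S' t i | i <- iota 0 (sp_size S').+1].
pose s := sort <=%R s0; exists (size s), (fun i => nth t s i).
have Sge0 (S1 : simple_process F) i : 0 <= clip S1 t i.
  by rewrite /clip le_min t0 andbT (le_trans (sp_time_ge0 S1)) // sp_nd.
have s_in x : x \in s -> 0 <= x <= t.
  rewrite mem_sort inE mem_cat => /predU1P[->|]; first by rewrite lexx.
  by move=> /orP[] /mapP[i _ ->]; rewrite Sge0 ge_min lexx orbT.
have ss : sorted <=%R s by exact: sort_le_sorted.
have ingr (S1 : simple_process F) : {subset [seq clip S1 t i | i <- iota 0 (sp_size S1).+1] <= s} ->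
    in_grid S1 t (size s) (nth t s).
  move=> sub l lS; have ls : clip S1 t l \in s.
    by apply: sub; apply/mapP; exists l => //; rewrite mem_iota add0n ltnS.
  by exists (index (clip S1 t l) s); [exact: index_size|exact: nth_index].
split; last 2 first.
- by apply: ingr => x xs; rewrite mem_sort inE mem_cat xs orbT.
- by apply: ingr => x xs; rewrite mem_sort inE mem_cat xs !orbT.
have sz : (0 < size s)%N by rewrite size_sort.
split.
- have /(nthP t)[j js j0] : 0 \in s by rewrite mem_sort inE eqxx.
  apply/eqP; rewrite eq_le; apply/andP; split.
    by rewrite -[leRHS]j0; apply: (sorted_leq_nth le_trans le_refl) => //; rewrite inE.
  by have /s_in/andP[] := mem_nth t sz.
- move=> i; have [iS|iS] := ltnP i.+1 (size s).
    by apply: (sorted_leq_nth le_trans le_refl) => //; rewrite inE // ltnW.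
  rewrite [leRHS]nth_default //; have [iS'|iS'] := ltnP i (size s).
    by have /s_in/andP[] := mem_nth t iS'.
  by rewrite nth_default.
- by rewrite nth_default.
Qed.

Variables (t : R) (N : nat) (tau : nat -> R).
Hypothesis t0 : 0 <= t.
Hypothesis gr : grid t N tau.

Let nd i j : (i <= j)%N -> tau i <= tau j.
Proof. exact: tau_nd (gridS gr) _ _. Qed.

Definition cell (S : simple_process F) l i : bool :=
  (sp_time S l <= tau i) && (tau i.+1 <= clip S t l.+1).

Definition cell_coef (S : simple_process F) i w := \sum_(l < sp_size S) sp_coef S l w * (cell S l i)%:R.

Lemma cell_coef_bdd (S : simple_process F) i : 
  (forall s s', 0 <= s -> s <= s' -> F s `<=` F s') ->
  (forall s, 0 <= s -> sigma_algebra setT (F s)) -> bdd_adm (F (tau i)) (cell_coef S i).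
Proof.
move=> Fmono Fsa; have badsum (f : 'I_(sp_size S) -> Omega -> R) :
   (forall l, bdd_adm (F (tau i)) (f l)) -> bdd_adm (F (tau i)) (fun w => \sum_l f l w).
  by move=> bf; apply: (cl_sum (bdd_adm_cst _) (@bdd_admD _ _ _ _)).
apply: badsum => l; rewrite /cell; have [H|H] := boolP (sp_time S l <= tau i); last first.
  by rewrite /=; under eq_fun do rewrite mulr0; exact: bdd_adm_cst.
apply: bdd_admM; last exact: bdd_adm_cst.
have s0 : 0 <= sp_time S l by rewrite (le_trans (sp_time_ge0 S)) // sp_nd.
split; last by have [c Hc] := sp_coef_bdd S l; exists c.
by apply: adm_sub (Fmono _ _ s0 H) _; apply/(admP _ (Fsa _ s0)); exact: sp_coef_meas.
Qed.

Lemma cell_coef_val (S : simple_process F) i s w : in_grid S t N tau -> (i < N)%N ->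
  tau i < s <= tau i.+1 -> sp_val S s w = cell_coef S i w.
Proof.
move=> inS iN /andP[is_ si]; apply: eq_bigr => l _; congr (_ * _).
have st : s <= t by apply: le_trans si _; rewrite -(gridN gr); exact: nd.
have inter l' : (l' <= sp_size S)%N -> (clip S t l' < s) = (clip S t l' <= tau i).
  move=> lS; have [p pN <-] := inS _ lS; apply/idP/idP => [H|H]; last exact: le_lt_trans is_.
  rewrite leNgt; apply/negP => H'; have : tau i.+1 <= tau p.
    by apply: nd; rewrite ltnNge; apply: contraTN H' => /nd; rewrite leNgt.
  by move=> /(le_trans si); rewrite leNgt H.
rewrite indicE /cell; congr (_%:R); congr nat_of_bool.
rewrite (_ : (s \in `]sp_time S l, sp_time S l.+1]%classic) = (sp_time S l < s <= sp_time S l.+1)); last first.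
  by apply/idP/idP; rewrite inE /= in_itv.
congr (_ && _).
  have := inter l (ltnW (ltn_ord l)); rewrite /clip.
  have [H _|H ->] := leP t (sp_time S l); last by [].
  by rewrite !ltNge (le_trans st H) /= leNgt (lt_le_trans is_ (le_trans st H)).
have := inter l.+1 (ltn_ord l); rewrite ltNge => /(congr1 negb); rewrite negbK -ltNge.
have -> : (s <= clip S t l.+1) = (s <= sp_time S l.+1) by rewrite le_min st andbT.
move=> ->.
have [p pN pE] := inS _ (ltn_ord l); rewrite -pE; apply/idP/idP => [H|H].
  by apply: nd; rewrite ltnNge; apply: contraTN H => /nd; rewrite leNgt.
by apply: lt_le_trans H; exact: lt_le_trans is_ si.
Qed.

Lemma cell_coef_int (S : simple_process F) (B : R -> Omega -> R) w : in_grid S t N tau ->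
  sp_int S B t w = \sum_(i < N) cell_coef S i w * (B (tau i.+1) w - B (tau i) w).
Proof.
move=> inS; under [RHS]eq_bigr do rewrite mulr_suml.
rewrite exchange_big /=; apply: eq_bigr => l _.
under eq_bigr do rewrite -mulrA; rewrite -mulr_sumr; congr (_ * _).
have [p pN pE] := inS _ (ltnW (ltn_ord l)); have [q qN qE] := inS _ (ltn_ord l).
rewrite -!/(clip _ _ _) -pE -qE.
have pq : tau p <= tau q.
  by rewrite pE qE /clip le_min !ge_min sp_time_nd lexx orbT.
have cellE i : (i < N)%N -> (cell S l i)%:R * (B (tau i.+1) w - B (tau i) w) =
    ((tau p <= tau i) && (tau i.+1 <= tau q))%:R * (B (tau i.+1) w - B (tau i) w).
  move=> iN; rewrite /cell -qE pE /clip ge_min.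
  have [//|H /=] := boolP (sp_time S l <= tau i).
  have [ti|//] := leP t (tau i).
  have -> : tau i.+1 = tau i; last by rewrite subrr !mulr0.
  apply/eqP; rewrite eq_le (gridS gr) andbT; apply: le_trans ti.
  by rewrite -(gridN gr); exact: nd.
under eq_bigr do rewrite cellE //.
have [qp|pq'] := leqP q p.
  have e : tau p = tau q by apply/eqP; rewrite eq_le pq nd.
  rewrite e subrr big1 // => i _; have [/andP[h1 h2]|_] := boolP (_ && _); last by rewrite mul0r.
  have -> : tau i.+1 = tau i; last by rewrite subrr mulr0.
  by apply/eqP; rewrite eq_le (gridS gr) andbT (le_trans h2).
rewrite -(telescope_sumr (fun i => B (tau i) w) (ltnW pq')).
rewrite (big_nat_widen _ _ _ _ _ qN) (big_nat_widenl _ 0) // big_mkord big_mkcond /=.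
apply: eq_bigr => i _; case: ifPn => [/andP[iq pi]|out]; first by rewrite !nd // mul1r.
have [/andP[h1 h2]|_] := boolP (_ && _); last by rewrite mul0r.
rewrite mul1r; apply/esym/eqP; rewrite subr_eq0; apply/eqP; congr (B _ w).
apply/eqP; rewrite eq_le (gridS gr) andbT.
move: out; rewrite negb_and -!leqNgt -ltnNge => /orP[qi|ip].
  by apply: le_trans h2 _; exact: nd.
by apply: le_trans h1; exact: nd.
Qed.
End refinement.

(** * The Ito integral and simple processes *)

Section ito_approximation.
Context {R : realType} {disp : measure_display} {Omega : measurableType disp}.
Variable P : probability Omega R.
Variables (F : R -> set (set Omega)) (n : nat) (W : 'I_n -> R -> Omega -> R).
Local Notation leb := (@lebesgue_measure R).
Local Notation RL := (measurableTypeR R).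

Let mitv t : @measurable _ RL `[0%R, t].
Proof. exact: measurable_itv. Qed.

Lemma sp_val_meas (S : simple_process F) w (A : set R) : measurable A ->
  measurable_fun A (fun s : R => sp_val S s w).
Proof.
move=> mA; apply: measurable_sum => l.
apply: measurable_funM; first exact: measurable_cst.
by apply: measurable_indic; exact: measurable_itv.
Qed.

(** Only an inequality, since the integrand is not prescribed at the left end of
    the interval nor outside of the cells. *)
Lemma sqr_integral_ge (t : R) N tau (g : R -> R) (D : nat -> R) : grid t N tau ->
  measurable_fun `[0, t] g -> (forall i s, (i < N)%N -> tau i < s <= tau i.+1 -> g s = D i) ->
  ((\sum_(i < N) D i ^+ 2 * (tau i.+1 - tau i))%:E <= \int[leb]_(s in `[0%R, t]) (g s ^+ 2)%:E)%E.
Proof.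
move=> gr mg gD; have nd i j : (i <= j)%N -> tau i <= tau j by exact: tau_nd (gridS gr) _ _.
pose ce i : set R := `]tau i, tau i.+1]%classic.
pose f (i : 'I_N) (s : RL) : \bar R := ((D i ^+ 2)%:E * (\1_(ce i) s)%:E)%E.
have mce i : @measurable _ RL (ce i) by exact: measurable_itv.
have mi i : measurable_fun (`[0, t] : set RL) (fun s : RL => (\1_(ce i) s : R)%:E).
  by apply/measurable_EFinP; exact: measurable_indic.
have mf i : measurable_fun (`[0, t] : set RL) (f i) by exact: measurable_funeM.
have f0 i s : (0 <= f i s)%E by rewrite mule_ge0 // lee_fin ?sqr_ge0.
have <- : (\int[leb]_(s in `[0%R, t]) \sum_(i < N) f i s = (\sum_(i < N) D i ^+ 2 * (tau i.+1 - tau i))%:E)%E.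
  rewrite (ge0_integral_sum _ (mitv t) mf (fun i s _ => f0 i s)).
  rewrite -sumEFin; apply: eq_bigr => i _; rewrite (ge0_integralZl _ (mitv t) (mi i)); last 2 first.
  - by move=> s _; rewrite lee_fin.
  - by rewrite lee_fin sqr_ge0.
  rewrite (integral_indic _ (mitv t) (mce i)).
  rewrite [RHS]EFinM; congr (_ * _)%E.
  have -> : ce i `&` `[0, t] = ce i.
    apply/setIidPl => s; rewrite /ce /= !in_itv /= => /andP[h1 h2]; apply/andP; split.
      by apply: le_trans (ltW h1); rewrite -(grid0 gr); exact: nd.
    by apply: le_trans h2 _; rewrite -(gridN gr); exact: nd.
  rewrite [LHS](lebesgue_measure_itv `]tau i, tau i.+1]) /= lte_fin; case: ifPn => [_|]; first by rewrite -EFinB.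
  by rewrite -leNgt => h; have -> : tau i.+1 = tau i; [apply/eqP; rewrite eq_le h (gridS gr)|rewrite subrr].
apply: ge0_le_integral; first exact: mitv.
- by move=> s _; apply: sume_ge0.
- by apply: emeasurable_sum.
- by apply/measurable_EFinP; exact: measurable_funX.
move=> s _; have [[i si]|no] := pselect (exists i : 'I_N, ce i s); last first.
  rewrite big1 ?lee_fin ?sqr_ge0 // => i _; rewrite /f indicE memNset ?mule0 // => h.
  by apply: no; exists i.
rewrite (bigD1 i) //= big1 => [|j ji].
  rewrite adde0 /f indicE mem_set // mule1 lee_fin (gD i) //.
rewrite /f indicE memNset ?mule0 // /ce /= => h; move: si h; rewrite /ce /= !in_itv /=.
move=> /andP[h1 h2] /andP[h3 h4]; move: ji; rewrite -val_eqE neq_ltn => /orP[ji|ij].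
  by have := le_lt_trans (le_trans h4 (nd _ _ ji)) h1; rewrite ltxx.
by have := le_lt_trans (le_trans h2 (nd _ _ ij)) h3; rewrite ltxx.
Qed.

Hypothesis usualF : usual_filtration P F.
Hypothesis BM : brownian P F W.

Lemma cvg_prob0_le (Y : nat -> Omega -> \bar R) (e : R) (eta : R) : cvg_prob0 P Y -> 0 < e -> 0 < eta ->
  exists j0, forall j, (j0 <= j)%N -> pr P [set w | (e%:E <= Y j w)%E] <= eta.
Proof.
move=> [mY cY] e0 eta0; have := cY e e0.
have h : \forall j \near \oo, (fun j => P [set w | (e%:E <= Y j w)%E]) j \is a fin_num.
  apply: nearW => j; apply: fin_num_measure.
  by rewrite -[X in measurable X]setTI; exact: emeasurable_fun_c_infty.
move=> /fine_cvgP[_ /cvgrPdist_le /(_ _ eta0)[j0 _ H]]; exists j0 => j jj.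
by have := H j jj; rewrite /= sub0r normrN ger0_norm // fine_ge0.
Qed.

(** Two simple processes whose integrands are close on an event have integrals
    that are close there in probability; letting one of them run along the
    sequence defining the Ito integral compares any simple process with the
    integral itself.  The event need not be adapted. *)
Lemma ito_close k (X : R -> Omega -> R) t J (V : simple_process F) (A : set Omega) (delta eps : R) :
  0 <= t -> ito_integral P F (W k) X t J -> measurable A -> 0 < delta -> 0 < eps ->
  (forall w, A w -> measurable_fun `[0, t] (fun s => X s w) /\
     (\int[leb]_(s in `[0%R, t]) ((sp_val V s w - X s w) ^+ 2)%:E <= delta%:E)%E) ->
  pr P (A `&` [set w | 2 * eps <= `|sp_int V (W k) t w - J w|]) <= 4 * delta / eps ^+ 2.
Proof.
move=> t0 [Jm [S [S1 S2]]] mA d0 e0 VX.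
have Fm := filt_meas usualF t0; have Fsa := filt_sa usualF.
have mJ : measurable_fun setT J.
  by apply: (adm_meas Fm); apply/(admP _ (Fsa _ t0)).
have mint (S' : simple_process F) : measurable_fun setT (sp_int S' (W k) t).
  have [N [tau [gr inS _]]] := common_grid S' S' t0.
  rewrite (_ : sp_int _ _ _ = grid_sum W tau k (cell_coef t tau S') N); last first.
    by apply/funext => w; rewrite (cell_coef_int gr _ _ inS).
  have h0 : 0 <= tau 0%N by rewrite (grid0 gr).
  have [|am _ _ _] := @grid_sum_L2 _ _ _ _ _ _ _ usualF BM _ k (cell_coef t tau S') h0 (gridS gr) _ N.
    by move=> i; apply: cell_coef_bdd => // s s'; exact: (filt_mono usualF).
  exact: adm_meas (filt_meas usualF (tau_ge0 h0 (gridS gr) N)) am.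
have mset (f : Omega -> R) c : measurable_fun setT f -> measurable [set w | c <= `|f w|].
  move=> mf; rewrite -[X in measurable X]setTI; apply: measurable_fun_ler => //.
  exact: measurableT_comp.
apply/ler_addgt0Pr => eta eta0; have eta2 : 0 < eta / 2 by rewrite divr_gt0.
have [j1 H1] := cvg_prob0_le S1 d0 eta2; have [j2 H2] := cvg_prob0_le S2 e0 eta2.
pose j := maxn j1 j2; have {}H1 := H1 j (leq_maxl _ _); have {}H2 := H2 j (leq_maxr _ _).
have [N [tau [gr inV inS]]] := common_grid V (S j) t0.
have h0 : 0 <= tau 0%N by rewrite (grid0 gr).
(* on the common grid the difference of V and S j is an adapted step process *)
pose D i w := cell_coef t tau V i w - cell_coef t tau (S j) i w.
have bD i : bdd_adm (F (tau i)) (D i).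
  rewrite (_ : D i = fun w => cell_coef t tau V i w + -1 * cell_coef t tau (S j) i w); last first.
    by apply/funext => w; rewrite mulN1r.
  apply: bdd_admD; last (apply: bdd_admM; first exact: bdd_adm_cst);
    by apply: cell_coef_bdd => // s s'; exact: (filt_mono usualF).
pose B1 := [set w | (delta%:E <= \int[leb]_(s in `[0%R, t]) ((sp_val (S j) s w - X s w) ^+ 2)%:E)%E].
pose B2 := [set w | (eps%:E <= (`|sp_int (S j) (W k) t w - J w|)%:E)%E].
pose B3 := [set w | eps <= `|grid_sum W tau k D N w|].
have mB1 : measurable B1 by rewrite -[B1]setTI; apply: emeasurable_fun_c_infty => //; case: S1.
have mB2 : measurable B2 by rewrite -[B2]setTI; apply: emeasurable_fun_c_infty => //; case: S2.
have [am _ lb _] := @grid_sum_L2 _ _ _ _ _ _ _ usualF BM tau k D h0 (gridS gr) bD N.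
have tg := tau_ge0 h0 (gridS gr) N.
have mB3 : measurable B3 by apply: mset; exact: adm_meas (filt_meas usualF tg) am.
have tail := @grid_sum_tail _ _ _ P F n W usualF BM tau k D N (4 * delta) eps h0 (gridS gr) bD (mulr_ge0 (ler0n _ 4) (ltW d0)) e0.
have mB4 : measurable [set w | grid_bracket tau D N w <= 4 * delta].
  by rewrite -[X in measurable X]setTI; apply: measurable_fun_ler => //; exact: L1_meas lb.
have sub4 : A `&` ~` B1 `<=` [set w | grid_bracket tau D N w <= 4 * delta].
  move=> w /= [Aw /negP]; rewrite /B1 /= -ltNge => lt1; have [mX VXw] := VX w Aw.
  pose g s := sp_val V s w - sp_val (S j) s w.
  have mg : measurable_fun `[0, t] g by apply: measurable_funB; exact: sp_val_meas.
  have := @sqr_integral_ge t N tau g (fun i => D i w) gr mg.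
  have gE i s : (i < N)%N -> tau i < s <= tau i.+1 -> g s = D i w.
    by move=> iN si; rewrite /g (cell_coef_val gr w inV iN si) (cell_coef_val gr w inS iN si).
  move=> /(_ gE); rewrite -/(grid_bracket tau D N w) -lee_fin => /le_trans; apply.
  have m1 (V' : simple_process F) : measurable_fun (`[0, t] : set RL) (fun s : RL => ((sp_val V' s w - X s w) ^+ 2)%:E).
    by apply/measurable_EFinP; apply: measurable_funX; apply: measurable_funB => //; exact: sp_val_meas.
  apply: (@le_trans _ _ (2%:E * (\int[leb]_(s in `[0%R, t]) ((sp_val V s w - X s w) ^+ 2)%:E + 
     \int[leb]_(s in `[0%R, t]) ((sp_val (S j) s w - X s w) ^+ 2)%:E))%E).
    rewrite -(ge0_integralD _ (mitv t)) //; try by move=> s _; rewrite lee_fin sqr_ge0.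
    rewrite -(ge0_integralZl _ (mitv t)) //; last 2 first.
    - exact: emeasurable_funD.
    - by move=> s _; rewrite adde_ge0 // lee_fin sqr_ge0.
    apply: ge0_le_integral; first exact: mitv.
    - by move=> s _; rewrite lee_fin sqr_ge0.
    - by apply/measurable_EFinP; exact: measurable_funX.
    - by apply: measurable_funeM; exact: emeasurable_funD.
    - move=> s _; rewrite -EFinD -EFinM lee_fin /g.
      set a := sp_val V s w; set b := sp_val (S j) s w; set c := X s w.
      by have := sqr_ge0 (a - c + (b - c)); rewrite !expr2; lra.
  have -> : (4 * delta)%:E = (2%:E * (delta%:E + delta%:E))%E.
    by rewrite -EFinD -EFinM; congr EFin; ring.
  by apply: lee_wpmul2l; rewrite ?lee_fin //; apply: leeD => //; exact: ltW.
set S0 := [set w | 2 * eps <= `|sp_int V (W k) t w - J w|].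
have mS0 : measurable S0 by apply: mset; exact: measurable_funB.
apply: (@le_trans _ _ (pr P (([set w | grid_bracket tau D N w <= 4 * delta] `&` B3) `|` (B1 `|` B2)))).
  apply: pr_mono; [exact: measurableI|by apply: measurableU; [exact: measurableI|exact: measurableU]|].
  move=> w /= [Aw]; rewrite /S0 /= (cell_coef_int gr _ _ inV) => H.
  have [h|h] := leP eps `|sp_int (S j) (W k) t w - J w|; first by right; right; rewrite /B2 /= lee_fin.
  have [hB|hB] := pselect (B1 w); [by right; left|left; split; first exact: sub4].
  rewrite /B3 /=; have -> : grid_sum W tau k D N w = \sum_(i < N) cell_coef t tau V i w * (W k (tau i.+1) w - W k (tau i) w)
      - sp_int (S j) (W k) t w.
    rewrite (cell_coef_int gr _ _ inS) -sumrB; apply: eq_bigr => i _; by rewrite mulrBl.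
  set v := \sum_(i < N) _ in H *; set s' := sp_int _ _ _ _ in h *.
  have := ler_normD (v - s') (s' - J w); rewrite addrA subrK => h2.
  move: h h2 H; lra.
apply: (le_trans (pr_setU_le _ (measurableI _ _ mB4 mB3) (measurableU _ _ mB1 mB2))); apply: lerD => //.
apply: (le_trans (pr_setU_le _ mB1 mB2)); rewrite [leRHS](splitr eta); exact: lerD.
Qed.
End ito_approximation.

(** * Moduli of continuity of paths *)

Section modulus.
Context {R : realType}.

Lemma unif_cont (f : R -> R) (T e : R) : {within `[0, +oo[, continuous f} -> 0 < e ->
  \forall d \near 0^'+, forall s s', 0 <= s <= T -> 0 <= s' <= T -> `|s - s'| <= d ->
    `|f s - f s'| <= e.
Proof.
move=> cf e0.
have cpt : compact (`[0, T]%classic : set R) by exact: segment_compact.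
have /near_covering_withinP ncov := (compact_near_coveringP _).1 cpt.
have := ncov R 0^'+ (fun d s => forall s', 0 <= s' <= T -> `|s - s'| <= d -> `|f s - f s'| <= e).
move=> H; have {}H : \forall d \near 0^'+, `[0, T]%classic `<=`
   (fun s => forall s', 0 <= s' <= T -> `|s - s'| <= d -> `|f s - f s'| <= e).
  apply: H => s; rewrite /= in_itv /= => /andP[s0 sT].
  have e2 : 0 < e / 2 by rewrite divr_gt0.
  have [r r0 Hr] : exists2 r, 0 < r & forall s', 0 <= s' -> `|s - s'| < r -> `|f s - f s'| <= e / 2.
    have /subspace_continuousP/(_ s) := cf; rewrite /= in_itv /= s0 => /(_ isT) /cvgrPdist_le/(_ _ e2).
    rewrite /prop_near1 /within /= => /nbhs_ballP[r /= r0 Hr]; exists r => // s' s'0 ss'.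
    by apply: Hr => //; rewrite /= in_itv /= s'0.
  have r2 : 0 < r / 2 by rewrite divr_gt0.
  near=> s' d => s'K s'' s''T ss; rewrite /= in ss s'K *.
  have ds : `|s - s'| < r / 2.
    by near: s'; exists (r / 2).
  have dd : d < r / 2 by near: d; exact: nbhs_right_lt.
  have s'0 : 0 <= s' by move: s'K; rewrite /= in_itv /= => /andP[].
  have s''0 : 0 <= s'' by case/andP: s''T.
  have h1 := Hr s' s'0 (lt_trans ds (_ : r / 2 < r)).
  have {}h1 : `|f s - f s'| <= e / 2 by apply: h1; lra.
  have h2 : `|f s - f s''| <= e / 2.
    apply: Hr => //; have := ler_distD s' s s''; lra.
  have := ler_distD (f s) (f s') (f s''); rewrite (distrC (f s') (f s)); lra.
by apply: filterS H => d H s s' sT; apply: H; rewrite /= in_itv /=.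
Unshelve. all: by end_near.
Qed.

Lemma cont_bounded (f : R -> R) (T : R) : 0 <= T -> {within `[0, +oo[, continuous f} ->
  exists M, forall s, 0 <= s <= T -> `|f s| <= M.
Proof.
move=> T0 cf; have cf' : {within `[0, T], continuous f}.
  by apply: continuous_subspaceW cf; apply: subset_itvl.
have [c1 _ H1] := EVT_max T0 cf'; have [c2 _ H2] := EVT_min T0 cf'.
exists (`|f c1| + `|f c2|) => s sT; have sT' : s \in `[0, T] by rewrite in_itv.
have := H1 s sT'; have := H2 s sT'; have := ler_norm (f c1); have := ler_norm (- f c2).
have := normr_ge0 (f c1); have := normr_ge0 (f c2).
rewrite normrN ler_norml => h1 h2 h3 h4 h5 h6; apply/andP; split; lra.
Qed.

Context {m : nat}.
Implicit Types z : R -> 'cV[R]_m.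

Definition path_cont z := forall i, {within `[0, +oo[, continuous (fun t => z t i 0)}.

Lemma unif_cont_vec z (T e : R) : path_cont z -> 0 < e ->
  \forall d \near 0^'+, forall s s', 0 <= s <= T -> 0 <= s' <= T -> `|s - s'| <= d ->
    nrm (z s - z s') <= e.
Proof.
move=> cz e0; have e1 : 0 < e / m.+1%:R by rewrite divr_gt0.
have H : \forall d \near 0^'+, forall i : 'I_m, forall s s', 0 <= s <= T -> 0 <= s' <= T -> `|s - s'| <= d ->
    `|z s i 0 - z s' i 0| <= e / m.+1%:R.
  by apply: filter_forall => i; exact: unif_cont (cz i) e1.
apply: filterS H => d H s s' sT s'T ss; apply: (le_trans (nrm_le_l1 _)).
apply: (@le_trans _ _ (\sum_(i < m) e / m.+1%:R)).
  by apply: ler_sum => i _; rewrite !mxE; exact: H.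
rewrite sumr_const card_ord -[X in X <= _]mulr_natl mulrCA ler_piMr ?(ltW e0) //.
by rewrite ler_pdivrMr // mul1r ler_nat.
Qed.

Lemma path_bounded z (T : R) : 0 <= T -> path_cont z ->
  exists M, forall s, 0 <= s <= T -> nrm (z s) <= M.
Proof.
move=> T0 cz; have /fin_all_exists [M HM] : forall i, exists M, forall s, 0 <= s <= T -> `|z s i 0| <= M.
  by move=> i; exact: cont_bounded (cz i).
exists (\sum_i M i) => s sT; apply: (le_trans (nrm_le_l1 _)).
by apply: ler_sum => i _; exact: HM.
Qed.

(** Countably many grid points decide the modulus of continuity of a path, which makes the events
    [bounded_paths] and [modulus_paths] measurable. *)
Definition gpt (T : R) b a := T * (a%:R / b.+1%:R).

Lemma gpt_itv T b a : 0 <= T -> (a <= b.+1)%N -> 0 <= gpt T b a <= T.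
Proof.
move=> T0 ab; rewrite /gpt mulr_ge0 ?divr_ge0 //= -[leRHS]mulr1 ler_wpM2l //.
by rewrite ler_pdivrMr // mul1r ler_nat.
Qed.

Lemma gpt_near T b s : 0 < T -> 0 <= s <= T -> exists2 a, (a <= b.+1)%N &
  gpt T b a <= s /\ s < gpt T b a.+1.
Proof.
move=> T0 /andP[s0 sT]; have b0 : 0 < b.+1%:R :> R by rewrite ltr0n.
have x0 : 0 <= s / T * b.+1%:R by rewrite mulr_ge0 ?divr_ge0 // ltW.
have /andP[h1 h2] := truncn_itv x0; set a := Num.truncn _ in h1 h2.
have E (c : R) : T * (c / b.+1%:R) = c / b.+1%:R * T by rewrite mulrC.
have sE : s = s / T * b.+1%:R / b.+1%:R * T by rewrite mulfK ?gt_eqF // divfK // gt_eqF.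
exists a.
  rewrite -(ler_nat R); apply: (le_trans h1); rewrite -[leRHS]mul1r ler_wpM2r ?(ltW b0) //.
  by rewrite ler_pdivrMr // mul1r.
rewrite /gpt !E {1 2}sE; split; first by rewrite ler_wpM2r ?(ltW T0) // ler_wpM2r // invr_ge0 ltW.
by rewrite ltr_pM2r // ltr_pM2r // invr_gt0.
Qed.

Lemma gptS T b a : gpt T b a.+1 = gpt T b a + T / b.+1%:R.
Proof. by rewrite /gpt -natr1 mulrDl mul1r mulrDr. Qed.

Lemma small_mesh (T d : R) : 0 < T -> 0 < d -> exists b, forall b', (b <= b')%N -> T / b'.+1%:R <= d.
Proof.
move=> T0 d0; exists (Num.bound (T / d)) => b' bb'; rewrite ler_pdivrMr ?ltr0n // mulrC -ler_pdivrMr //.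
apply: ltW; apply: (lt_le_trans (archi_boundP _)); first by rewrite divr_ge0 // ltW.
by rewrite ler_nat; exact: leq_trans bb' (leqnSn _).
Qed.

Lemma unif_cont_ex z (T e : R) : path_cont z -> 0 < e ->
  exists2 d, 0 < d & forall s s', 0 <= s <= T -> 0 <= s' <= T -> `|s - s'| <= d ->
    nrm (z s - z s') <= e.
Proof.
move=> cz e0; have H := unif_cont_vec T cz e0.
near (0 : R)^'+ => d; exists d; first by near: d; exact: nbhs_right_gt.
by near: d; exact: H.
Unshelve. all: by end_near.
Qed.

(** A finer grid containing the mesh has a point at arbitrarily small distance
    below [s] in the same cell. *)
Lemma modulus_dense z (T eta : R) N : 0 < T -> path_cont z -> (0 < N)%N ->
  (forall b a a', (a <= b.+1)%N -> (a' <= b.+1)%N -> (a <= a')%N -> ((a' - a) * N <= b.+1)%N ->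
     nrm (z (gpt T b a') - z (gpt T b a)) <= eta) ->
  forall i s, (i < N)%N -> i%:R * (T / N%:R) <= s <= i.+1%:R * (T / N%:R) ->
    nrm (z s - z (i%:R * (T / N%:R))) <= eta.
Proof.
move=> T0 cz N0 H i s iN /andP[s1 s2]; apply/ler_addgt0Pr => e e0.
have [d d0 Hd] := unif_cont_ex T cz e0; have [b0 Hb0] := small_mesh T0 d0.
(* a multiple of N, so that the mesh belongs to the grid *)
pose b := (N * b0.+1).-1.
have bE : b.+1 = (N * b0.+1)%N by rewrite prednK // muln_gt0 N0.
have Nr : 0 < N%:R :> R by rewrite ltr0n.
have gE l : gpt T b (l * b0.+1) = l%:R * (T / N%:R).
  rewrite /gpt bE !natrM; field; rewrite gt_eqF //= pnatr_eq0 //.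
have sT : 0 <= s <= T.
  rewrite (le_trans _ s1) ?mulr_ge0 ?divr_ge0 ?(ltW T0) //=; apply: (le_trans s2).
  by rewrite mulrA ler_pdivrMr // mulrC ler_wpM2l ?(ltW T0) // ler_nat.
have gnd l l' : (gpt T b l < gpt T b l') = (l < l')%N.
  by rewrite /gpt ltr_pM2l // ltr_pM2r ?invr_gt0 ?ltr0n // ltr_nat.
have [a ab [h1 h2]] := gpt_near b T0 sT.
have ia : (i * b0.+1 <= a)%N by rewrite -ltnS -gnd gE; exact: le_lt_trans h2.
have ai : (a <= i.+1 * b0.+1)%N by rewrite leqNgt -gnd gE -leNgt; exact: le_trans s2.
have h3 : nrm (z s - z (gpt T b a)) <= e.
  apply: Hd => //; first exact: gpt_itv (ltW T0) ab.
  rewrite ger0_norm ?subr_ge0 //.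
  have : T / b.+1%:R <= d by apply: Hb0; rewrite -ltnS bE leq_pmull.
  by move: h2; rewrite gptS; set r := T / _; lra.
have h4 : nrm (z (gpt T b a) - z (i%:R * (T / N%:R))) <= eta.
  rewrite -gE; apply: H => //; first by exact: leq_trans ia ab.
  by rewrite bE mulnC leq_mul2l leq_subLR addnC -mulSn ai orbT.
have -> : z s - z (i%:R * (T / N%:R)) = (z s - z (gpt T b a)) + (z (gpt T b a) - z (i%:R * (T / N%:R))).
  by rewrite addrA subrK.
by apply: (le_trans (nrmD _ _)); lra.
Qed.
End modulus.

Section path_events.
Context {R : realType} {disp : measure_display} {Omega : measurableType disp}.
Variable P : probability Omega R.

(** Continuity of the probability from above. *)
Lemma pr_exhaust (E : nat -> set Omega) : (forall j, measurable (E j)) ->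
  (forall j j', (j <= j')%N -> E j `<=` E j') -> {ae P, forall w, exists j, E j w} ->
  forall e, 0 < e -> exists j0, forall j, (j0 <= j)%N -> pr P (~` E j) <= e.
Proof.
move=> mE ndE aE e e0.
have mU : measurable (\bigcup_j E j) by exact: bigcupT_measurable.
have PU : P (\bigcup_j E j) = 1%E.
  have : P (~` \bigcup_j E j) = 0%E.
    apply: measure_negligible; first exact: measurableC.
    by apply: negligibleS aE => w /= nU [j Ej]; apply: nU; exists j.
  rewrite probability_setC // => H; move: (fin_num_measure P _ mU) H => /fineK <-.
  by rewrite -EFinB => -[] /eqP; rewrite subr_eq0 => /eqP <-.
have cv : P \o E @ \oo --> 1%E.
  rewrite -PU; apply: nondecreasing_cvg_mu => // j j' jj'; apply/subsetPset; exact: ndE.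
have /fine_cvgP[_ /cvgrPdist_le/(_ _ e0)[j0 _ H]] := cv.
exists j0 => j jj; rewrite pr_setC //; have := H j jj; rewrite /= -/(pr P (E j)).
by rewrite ger0_norm // subr_ge0 pr_le1.
Qed.

Context {m : nat}.
Variables (Z : R -> Omega -> 'cV[R]_m) (T : R).
Hypothesis T0 : 0 < T.
Hypothesis Zm : forall t, 0 <= t -> vadm measurable (Z t).
Hypothesis Zc : {ae P, forall w, path_cont (fun t => Z t w)}.

(** The bound by [rho] along all grids, hence on [0, T] for continuous paths. *)
Definition bounded_paths (rho : nat) : set Omega :=
  [set w | forall b a, (a <= b.+1)%N -> nrm (Z (gpt T b a) w) <= rho%:R].

(** Oscillation at most [eta] over times at distance at most [T / N]; the condition
    [(a' - a) * N <= b.+1] expresses this for points of the [b]-th grid. *)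
Definition modulus_paths (eta : R) (N : nat) : set Omega :=
  [set w | forall b a a', (a <= b.+1)%N -> (a' <= b.+1)%N -> (a <= a')%N -> ((a' - a) * N <= b.+1)%N ->
     nrm (Z (gpt T b a') w - Z (gpt T b a) w) <= eta].

Lemma meas_all (Q : nat -> set Omega) : (forall b, measurable (Q b)) -> measurable [set w | forall b, Q b w].
Proof.
move=> mQ; rewrite (_ : [set w | _] = \bigcap_b Q b); first exact: bigcapT_measurable.
by apply/seteqP; split => w /= H b; [move=> _; exact: H|exact: H].
Qed.

Lemma meas_imp (p : bool) (Q : set Omega) : (p -> measurable Q) -> measurable [set w | p -> Q w].
Proof.
case: p => mQ; last by rewrite (_ : [set w | _] = setT) //; apply/seteqP; split.
rewrite (_ : [set w | _] = Q); first exact: mQ.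
by apply/seteqP; split => w /= H //; exact: H.
Qed.

Lemma meas_nrm_le (X : Omega -> 'cV[R]_m) c : vadm measurable X -> measurable [set w | nrm (X w) <= c].
Proof.
move=> aX; rewrite -[X in measurable X]setTI; apply: measurable_fun_ler => //.
have Id : (measurable : set (set Omega)) `<=` measurable by [].
exact: adm_meas Id (adm_nrm aX).
Qed.

Lemma gpt_ge0 b a : (a <= b.+1)%N -> 0 <= gpt T b a.
Proof. by move=> /(gpt_itv (ltW T0))/andP[]. Qed.

Lemma bounded_paths_meas rho : measurable (bounded_paths rho).
Proof.
do 2 apply: meas_all => ?; apply: meas_imp => ab; apply: meas_nrm_le; apply: Zm; exact: gpt_ge0.
Qed.

Lemma modulus_paths_meas eta N : measurable (modulus_paths eta N).
Proof.
do 3 apply: meas_all => ?; do 4 apply: meas_imp => ?; apply: meas_nrm_le.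
by apply: (vclB (@adm_cst _ _ _ _) (@admD _ _ _ _) (@admM _ _ _ _)); apply: Zm; exact: gpt_ge0.
Qed.

Lemma bounded_paths_pr e : 0 < e -> exists rho, pr P (~` bounded_paths rho) <= e.
Proof.
move=> e0; have nd j j' : (j <= j')%N -> bounded_paths j `<=` bounded_paths j'.
  by move=> jj w H b a ab; apply: le_trans (H b a ab) _; rewrite ler_nat.
have ae : {ae P, forall w, exists j, bounded_paths j w}.
  apply: filterS Zc => w cz; have [M HM] := path_bounded (ltW T0) cz.
  exists (Num.bound M) => b a ab; apply: (le_trans (HM _ (gpt_itv (ltW T0) ab))).
  have M0 : 0 <= M by apply: le_trans (HM 0 _); rewrite ?nrm_ge0 // lexx ltW.
  exact/ltW/archi_boundP.
have [j0 H] := pr_exhaust bounded_paths_meas nd ae e0.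
by exists j0; exact: H.
Qed.

Lemma modulus_paths_pr eta e : 0 < eta -> 0 < e -> exists N0, forall N, (N0 <= N)%N -> pr P (~` modulus_paths eta N) <= e.
Proof.
move=> eta0; apply: pr_exhaust; first exact: modulus_paths_meas.
  move=> j j' jj w H b a a' h1 h2 h3 h4; apply: H => //.
  by apply: leq_trans h4; rewrite leq_mul2l jj orbT.
apply: filterS Zc => w cz; have [d d0 Hd] := unif_cont_ex T cz eta0.
have [b0 /(_ b0 (leqnn _)) Hb] := small_mesh T0 d0.
exists b0.+1 => b a a' h1 h2 h3 h4; apply: Hd; rewrite ?gpt_itv ?(ltW T0) //.
apply: le_trans Hb; rewrite ger0_norm; last first.
  by rewrite subr_ge0 ler_wpM2l ?(ltW T0) // ler_wpM2r ?invr_ge0 // ler_nat.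
rewrite -mulrBr ler_wpM2l ?(ltW T0) // -mulrBl -natrB // ler_pdivrMr ?ltr0n //.
by rewrite mulrC ler_pdivlMr ?ltr0n // -natrM ler_nat.
Qed.
End path_events.

(** * The frozen-coefficient sums approximate the solution *)

Section path_functions.
Context {R : realType}.
Local Notation leb := (@lebesgue_measure R).
Local Notation RL := (measurableTypeR R).

Definition icont (f : R -> R) := {within `[0, +oo[, continuous f}.

Lemma icont_cst c : icont (fun=> c).
Proof. by apply: continuous_subspaceT => x; exact: cvg_cst. Qed.

Lemma icontD f g : icont f -> icont g -> icont (fun s => f s + g s).
Proof. by move=> cf cg x; apply: cvgD; [exact: cf|exact: cg]. Qed.

Lemma icontM f g : icont f -> icont g -> icont (fun s => f s * g s).
Proof. by move=> cf cg x; apply: cvgM; [exact: cf|exact: cg]. Qed.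

Lemma icont_meas f t : icont f -> measurable_fun (`[0, t] : set RL) (f : RL -> R).
Proof.
move=> cf; apply: (@subspace_continuous_measurable_fun R `[0, t]); first exact: measurable_itv.
by apply: continuous_subspaceW cf; apply: subset_itvl.
Qed.

Lemma icont_int f t : 0 <= t -> icont f -> leb.-integrable (`[0, t] : set RL) (EFin \o f).
Proof.
move=> t0 cf; have [M HM] := cont_bounded t0 cf.
apply: (@measurable_bounded_integrable _ _ _ leb).
- exact: measurable_itv.
- by rewrite /= lebesgue_measure_itv /=; case: ifP => // _; rewrite -EFinB ltry.
- exact: icont_meas.
- exists M; split; first exact: num_real.
  by move=> x Mx s; rewrite /= in_itv /= => sT; apply: (le_trans (HM s sT)); exact: ltW.
Qed.

Lemma riemann_cell f a b e : 0 <= a -> a <= b -> icont f ->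
  (forall s, a <= s <= b -> `|f s - f a| <= e) ->
  `|Rintegral leb `[0, b] f - Rintegral leb `[0, a] f - f a * (b - a)| <= e * (b - a).
Proof.
move=> a0 ab cf fe; have b0 := le_trans a0 ab.
rewrite (@Rintegral_itvB R f (BLeft 0) (BRight b) a); last 3 first.
- exact: icont_int.
- by rewrite bnd_simp.
- by rewrite bnd_simp.
have mab : @measurable _ RL `]a, b] by exact: measurable_itv.
have sub : (`]a, b]%classic : set RL) `<=` `[0, b].
  by move=> s; rewrite /= !in_itv /= => /andP[h1 ->]; rewrite (le_trans a0 (ltW h1)).
have fi : leb.-integrable (`]a, b] : set RL) (EFin \o f).
  by apply: integrableS (icont_int b0 cf) => //; exact: measurable_itv.
have mE : fine (leb `]a, b]) = b - a.
  rewrite lebesgue_measure_itv /= lte_fin; case: ifPn => [_|]; first by rewrite -EFinB.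
  by rewrite -leNgt => ba; have -> : a = b; [apply/eqP; rewrite eq_le ab|rewrite subrr].
have ci (c : R) : leb.-integrable (`]a, b] : set RL) (EFin \o (fun=> c)).
  have := icont_int b0 (@icont_cst c); apply: integrableS => //; exact: measurable_itv.
rewrite -mE -(Rintegral_cst leb mab) -RintegralB //.
have fai : leb.-integrable (`]a, b] : set RL) (EFin \o (fun s => f s - f a)).
  have := integrableB mab fi (ci (f a)); apply: eq_integrable => //.
apply: (le_trans (le_normr_Rintegral _ fai)) => //.
rewrite -(Rintegral_cst leb mab); apply: le_Rintegral => //.
  exact: integrable_norm fai.
by move=> s; rewrite /= in_itv /= => /andP[h1 h2]; apply: fe; rewrite (ltW h1).
Qed.
End path_functions.

Section solution_sums.
Context {R : realType} {disp : measure_display} {Omega : measurableType disp}.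
Variable P : probability Omega R.
Variables (F : R -> set (set Omega)) (n m : nat) (W : 'I_n -> R -> Omega -> R).
Hypothesis usualF : usual_filtration P F.
Hypothesis BM : brownian P F W.
Variables (G : 'M[R]_m) (L : 'I_n -> 'M[R]_m) (T : R).
Hypothesis T0 : 0 < T.
Variables (Z0 : Omega -> 'cV[R]_m) (Z : R -> Omega -> 'cV[R]_m).
Local Notation leb := (@lebesgue_measure R).
Local Notation RL := (measurableTypeR R).

(** The form of the equation used below: coordinates indexed by ['I_m] and
    continuity of paths as [path_cont]. *)
Record real_solution : Prop := RealSolution {
  rs_init : vadm (F 0) Z0;
  rs_adm : forall t, 0 <= t -> vadm (F t) (Z t);
  rs_cont : {ae P, forall w, path_cont (fun t => Z t w)};
  rs_eq : forall t, 0 <= t -> exists J : 'I_n -> 'I_m -> Omega -> R,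
    (forall k i, ito_integral P F (W k) (fun s w => dif L k (Z s w) i 0) t (J k i)) /\
    {ae P, forall w, forall i, Z t w i 0 = Z0 w i 0
       + Rintegral leb `[0, t] (fun s => dri G L (Z s w) i 0) + \sum_(k < n) J k i w} }.
Hypothesis sol : real_solution.

Variables (N : nat) (rho : nat).
Hypothesis N0 : (0 < N)%N.
Let h := T / N%:R.
Definition mesh i := i%:R * h.

Lemma step_gt0 : 0 < h.
Proof. by rewrite divr_gt0 // ltr0n. Qed.

Lemma mesh_ge0 i : 0 <= mesh i.
Proof. by rewrite mulr_ge0 // ltW // step_gt0. Qed.

Lemma meshS i : mesh i.+1 = mesh i + h.
Proof. by rewrite /mesh -natr1 mulrDl mul1r. Qed.

Lemma mesh_lt i : mesh i < mesh i.+1.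
Proof. by rewrite meshS ltrDl step_gt0. Qed.

Lemma mesh_le i j : (i <= j)%N -> mesh i <= mesh j.
Proof. by move=> ij; rewrite ler_wpM2r ?ler_nat // ltW // step_gt0. Qed.

Lemma meshN : mesh N = T.
Proof. by rewrite /mesh /h mulrCA divff ?mulr1 // pnatr_eq0 -lt0n. Qed.

Lemma mesh_itv i : (i <= N)%N -> 0 <= mesh i <= T.
Proof. by move=> iN; rewrite mesh_ge0 -meshN mesh_le. Qed.

Lemma mesh_cell j s : 0 < s -> s <= mesh j -> exists l, (l < j)%N /\ mesh l < s <= mesh l.+1.
Proof.
move=> s0; elim: j => [|j IH sj]; first by rewrite /mesh mul0r leNgt s0.
have [/IH[l [lj sl]]|js] := leP s (mesh j); first by exists l; split=> //; exact: leqW.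
by exists j; rewrite js sj.
Qed.

Lemma mesh_gpt i : (i <= N)%N -> mesh i = gpt T N.-1 i.
Proof. by move=> iN; rewrite /gpt prednK // /mesh /h mulrCA. Qed.

(** The coefficients are only locally Lipschitz; all estimates are made on the
    event that the solution has stayed bounded by [rho] on the mesh so far. *)
Definition stay i : set Omega := [set w | forall l, (l <= i)%N -> nrm (Z (mesh l) w) <= rho%:R].

Lemma stay_le i j : (i <= j)%N -> stay j `<=` stay i.
Proof. by move=> ij w H l li; apply: H; exact: leq_trans ij. Qed.

Lemma sa_setI (H : set (set Omega)) A B : sigma_algebra setT H -> H A -> H B -> H (A `&` B).
Proof.
move=> sH HA HB; have HE : <<s H >> = H by rewrite sigma_algebra_id.
rewrite -HE; apply: (@measurableI _ (g_sigma_algebraType H)); exact: sub_sigma_algebra.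
Qed.

Lemma stay_F i : F (mesh i) (stay i).
Proof.
have Fs l : F (mesh l) [set w | nrm (Z (mesh l) w) <= rho%:R].
  apply: (adm_le_set (filt_sa usualF (mesh_ge0 l)) _ (adm_cst _ _)).
  exact: adm_nrm (rs_adm sol (mesh_ge0 l)).
elim: i => [|i IH].
  rewrite (_ : stay 0 = [set w | nrm (Z (mesh 0) w) <= rho%:R]) //.
  by apply/seteqP; split => w /= H; [exact: H|move=> l; rewrite leqn0 => /eqP ->].
rewrite (_ : stay i.+1 = stay i `&` [set w | nrm (Z (mesh i.+1) w) <= rho%:R]).
  apply: sa_setI => //; first exact: (filt_sa usualF (mesh_ge0 _)).
  by apply: (filt_mono usualF (mesh_ge0 i) _ IH); exact: mesh_le.
apply/seteqP; split => w /=.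
  by move=> H; split; [move=> l li; apply: H; exact: leqW|exact: H].
by move=> [H1 H2] l; rewrite leq_eqVlt => /predU1P[->//|]; exact: H1.
Qed.

(** Euler's method with the coefficients frozen at the solution on the mesh,
    stopped when the solution leaves the ball of radius [rho]. It is close to the
    solution by the approximation of its integrals, and to the chain by
    [strong_step_Ex]. *)
Fixpoint frozen i : Omega -> 'cV[R]_m :=
  if i is i'.+1 then frozen_step G L (stay i') h (incr W (mesh i') (mesh i)) (frozen i') (Z (mesh i'))
  else Z0.

Lemma stay_Z i w : stay i w -> nrm (Z (mesh i) w) <= rho%:R.
Proof. by apply. Qed.

Lemma grid_noise i : noise P (F (mesh i)) (incr W (mesh i) (mesh i.+1)) gauss8.
Proof. exact: (bm_noise usualF BM (mesh_ge0 i) (mesh_lt i)). Qed.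

Lemma incr_adm i k : adm (F (mesh i.+1)) (incr W (mesh i) (mesh i.+1) k).
Proof.
apply: admM; first exact: adm_cst.
exact: (bm_incr_adm usualF BM k (mesh_ge0 i) (ltW (mesh_lt i))).
Qed.

Lemma grid_mono i : F (mesh i) `<=` F (mesh i.+1).
Proof. by apply: (filt_mono usualF (mesh_ge0 i)); exact: ltW (mesh_lt i). Qed.

Lemma frozen_adm i : vadm (F (mesh i)) (frozen i) /\
  (L1 P (fun w => dot (Z0 w) (Z0 w)) -> L1 P (fun w => dot (frozen i w) (frozen i w))).
Proof.
elim: i => [|i [IH IL]].
  by split=> //; rewrite /mesh mul0r; exact: rs_init sol.
have Fi := @grid_mono i; set FF := F (mesh i.+1).
have aZ := rs_adm sol (mesh_ge0 i).
split; last first.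
  move=> /IL LU; exact: (frozen_step_L2 G L (grid_noise i) IH aZ LU (stay_F i) (@stay_Z i) (ltW step_gt0)).
have c := @adm_cst R _ _ FF; have D := @admD R _ _ FF; have M := @admM R _ _ FF.
have aZ' : vadm FF (Z (mesh i)) by exact: vadm_sub aZ.
apply: vclD => //; first exact: vadm_sub IH.
apply: vclZ => //; first by apply: adm_indic; apply: Fi; exact: stay_F.
apply: vclD => //.
  by apply: (vclZ M (c h)); exact: vcl_dri.
apply: (vclZ M (c (Num.sqrt h))); apply: vcl_dife => // k; exact: incr_adm.
Qed.

Lemma incr_sqrt i k w : Num.sqrt h * incr W (mesh i) (mesh i.+1) k w = W k (mesh i.+1) w - W k (mesh i) w.
Proof.
rewrite /incr; have -> : mesh i.+1 - mesh i = h by rewrite meshS addrAC subrr add0r.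
by rewrite mulrA divff ?mul1r // gt_eqF // sqrtr_gt0 step_gt0.
Qed.

Lemma frozen_sum i w c : frozen i w c 0 = Z0 w c 0 +
  \sum_(l < i) \1_(stay l) w * (h * dri G L (Z (mesh l) w) c 0) +
  \sum_(k < n) \sum_(l < i) \1_(stay l) w * dif L k (Z (mesh l) w) c 0 * (W k (mesh l.+1) w - W k (mesh l) w).
Proof.
elim: i => [|i IH].
  by rewrite big_ord0 addr0 big1 ?addr0 // => k _; rewrite big_ord0.
rewrite /= /frozen_step mxE IH big_ord_recr /= -!addrA; congr (_ + (_ + _)).
under [in RHS]eq_bigr do rewrite big_ord_recr /=.
rewrite big_split /= addrCA; congr (_ + _); rewrite !mxE mulrDr; congr (_ + _).
rewrite summxE !mulr_sumr; apply: eq_bigr => k _.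
by rewrite mxE -incr_sqrt; ring.
Qed.

Variable i : nat.
Hypothesis iN : (i <= N)%N.

Lemma diff_coef_meas k c l : meas_wrt (F (mesh l)) (fun w => \1_(stay l) w * dif L k (Z (mesh l) w) c 0).
Proof.
apply/(admP _ (filt_sa usualF (mesh_ge0 l))); apply: admM; first exact: adm_indic (stay_F l).
have a := rs_adm sol (mesh_ge0 l).
exact: (vcl_dif (@adm_cst _ _ _ _) (@admD _ _ _ _) (@admM _ _ _ _)).
Qed.

Lemma diff_coef_bdd k c l : exists b : R, forall w, `|\1_(stay l) w * dif L k (Z (mesh l) w) c 0| <= b.
Proof.
have [b b0 H] := coef_bound G L rho%:R; exists b => w; rewrite normrM indicE.
have [|] := boolP (w \in stay l); last by rewrite normr0 mul0r.
rewrite inE => /stay_Z Zr; rewrite normr1 mul1r; have [h1 _] := H _ Zr.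
exact: le_trans (coord_le _ _) (h1 k).
Qed.

(** The integrand of the stochastic part of [frozen], as a simple process; its Ito
    integral is compared with the one in the equation by [ito_close]. *)
Definition diff_process k c : simple_process F :=
  @SimpleProcess R _ Omega F i mesh (fun l w => \1_(stay l) w * dif L k (Z (mesh l) w) c 0)
   (mesh_ge0 0) (fun l => ltW (mesh_lt l)) (diff_coef_meas k c) (diff_coef_bdd k c).

Lemma diff_process_int k c w : sp_int (diff_process k c) (W k) (mesh i) w =
  \sum_(l < i) \1_(stay l) w * dif L k (Z (mesh l) w) c 0 * (W k (mesh l.+1) w - W k (mesh l) w).
Proof.
apply: eq_bigr => l _ /=; congr (_ * (W k _ w - W k _ w)); rewrite min_l //; apply: mesh_le => //.
exact: ltnW.
Qed.

Variable eta : R.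
Hypothesis eta0 : 0 < eta.

Hypothesis eta1 : eta <= 1.

(** On this event, which is not adapted, the path oscillates little over each
    cell. *)
Definition good := stay i `&` modulus_paths Z T eta N.

Lemma good_mod w l s : path_cont (fun t => Z t w) -> good w -> (l < i)%N -> mesh l <= s <= mesh l.+1 ->
  nrm (Z s w - Z (mesh l) w) <= eta.
Proof. by move=> cz [_ Mw] li; exact: (modulus_dense T0 cz N0 Mw (leq_trans li iN)). Qed.

Variables (cl : R).
Hypothesis cl0 : 0 <= cl.
(** The radius [rho + 1] leaves room for the oscillation inside a cell. *)
Hypothesis lip : forall x y, nrm x <= rho%:R + 1 -> nrm y <= rho%:R + 1 ->
  (forall k, nrm (dif L k x - dif L k y) <= cl * nrm (x - y)) /\
  nrm (dri G L x - dri G L y) <= cl * nrm (x - y).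

Lemma good_coef w l s : path_cont (fun t => Z t w) -> good w -> (l < i)%N -> mesh l <= s <= mesh l.+1 ->
  (forall k c, `|dif L k (Z s w) c 0 - dif L k (Z (mesh l) w) c 0| <= cl * eta) /\
  forall c, `|dri G L (Z s w) c 0 - dri G L (Z (mesh l) w) c 0| <= cl * eta.
Proof.
move=> cz gw li sl; have md := good_mod cz gw li sl.
have Zl : nrm (Z (mesh l) w) <= rho%:R by case: gw => sw _; apply: sw; exact: ltnW.
have Zs : nrm (Z s w) <= rho%:R + 1.
  have := nrmD (Z (mesh l) w) (Z s w - Z (mesh l) w); rewrite addrC subrK.
  by move: md Zl eta1; lra.
have Zl' : nrm (Z (mesh l) w) <= rho%:R + 1 by rewrite (le_trans Zl) // lerDl.
have [h1 h2] := lip Zs Zl'.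
have cle : cl * nrm (Z s w - Z (mesh l) w) <= cl * eta by rewrite ler_wpM2l.
split=> [k c|c].
  apply: le_trans cle; apply: le_trans (h1 k); have := coord_le (dif L k (Z s w) - dif L k (Z (mesh l) w)) c.
  by rewrite !mxE.
apply: le_trans cle; apply: le_trans h2; have := coord_le (dri G L (Z s w) - dri G L (Z (mesh l) w)) c.
by rewrite !mxE.
Qed.

Lemma good_stay w l : good w -> (l < i)%N -> stay l w.
Proof. by move=> [sw _] li; exact: stay_le (ltnW li) _ sw. Qed.

Lemma path_icont w c : path_cont (fun t => Z t w) ->
  icont (fun s => dri G L (Z s w) c 0) /\ forall k, icont (fun s => dif L k (Z s w) c 0).
Proof.
move=> cz; have C := @icont_cst R; have D := @icontD R; have M := @icontM R.
have vz : vcl icont (fun s => Z s w) by move=> j; exact: cz.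
split; first exact: (vcl_dri C D M G L vz).
by move=> k; exact: (vcl_dif C D M L k vz).
Qed.

Lemma drift_err w c : path_cont (fun t => Z t w) -> good w ->
  `|Rintegral leb `[0, mesh i] (fun s => dri G L (Z s w) c 0) -
    \sum_(l < i) \1_(stay l) w * (h * dri G L (Z (mesh l) w) c 0)| <= T * (cl * eta).
Proof.
move=> cz gw; have [ci _] := path_icont c cz; set f := (fun s => _) in ci *.
have ce : 0 <= cl * eta by rewrite mulr_ge0 // ltW.
suff H j : (j <= i)%N -> `|Rintegral leb `[0, mesh j] f - 
    \sum_(l < j) \1_(stay l) w * (h * f (mesh l))| <= mesh j * (cl * eta).
  apply: (le_trans (H i (leqnn i))); rewrite ler_wpM2r //; by case/andP: (mesh_itv iN).
elim: j => [_|j IH jN].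
  rewrite big_ord0 subr0 /mesh mul0r mul0r set_itv1 Rintegral_set1 normr0 //.
have cell := @riemann_cell R f (mesh j) (mesh j.+1) (cl * eta) (mesh_ge0 j) (ltW (mesh_lt j)) ci.
have {}cell := cell (fun s sj => (good_coef cz gw jN sj).2 c).
rewrite big_ord_recr /= indicE mem_set ?mul1r; last exact: good_stay jN.
have hE : mesh j.+1 - mesh j = h by rewrite meshS addrAC subrr add0r.
have {}IH := IH (ltnW jN); rewrite hE in cell.
set I1 := Rintegral _ _ _ in cell *; set I0 := Rintegral _ _ _ in cell IH.
set S := \sum_(l < j) _ in IH *.
have -> : I1 - (S + h * f (mesh j)) = (I0 - S) + (I1 - I0 - f (mesh j) * h) by ring.
by apply: (le_trans (ler_normD _ _)); rewrite meshS [_ * (cl * eta)]mulrDl [h * _]mulrC lerD.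
Qed.

Lemma diff_err k c w : path_cont (fun t => Z t w) -> good w ->
  measurable_fun (`[0, mesh i] : set RL) (fun s : RL => dif L k (Z s w) c 0) /\
  (\int[leb]_(s in `[0%R, mesh i]) ((sp_val (diff_process k c) s w - dif L k (Z s w) c 0) ^+ 2)%:E
    <= (T * (cl * eta) ^+ 2)%:E)%E.
Proof.
move=> cz gw; have [_ /(_ k) ci] := path_icont c cz.
have mf := @icont_meas _ _ (mesh i) ci; split=> //.
have m2 : measurable_fun (`[0, mesh i] : set RL)
    (fun s : RL => ((sp_val (diff_process k c) s w - dif L k (Z s w) c 0) ^+ 2)%:E).
  apply/measurable_EFinP; apply: measurable_funX; apply: measurable_funB => //.
  by apply: sp_val_meas; exact: measurable_itv.
have mo : @measurable _ RL `]0, mesh i] by exact: measurable_itv.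
have sub : (`]0, mesh i]%classic : set RL) `<=` `[0, mesh i].
  by move=> s; rewrite /= !in_itv /= => /andP[h1 ->]; rewrite ltW.
have m3 := measurable_funS (measurable_itv `[0, mesh i]) sub m2.
rewrite -(integral_itv_obnd_cbnd m3).
apply: (@le_trans _ _ (\int[leb]_(s in `]0%R, mesh i]) ((cl * eta) ^+ 2)%:E)%E).
  apply: ge0_le_integral => //.
  - by move=> s _; rewrite lee_fin sqr_ge0.
  - move=> s; rewrite /= in_itv /= => /andP[s0 si]; rewrite lee_fin.
    have [l [li sl]] : exists l, (l < i)%N /\ mesh l < s <= mesh l.+1 by exact: mesh_cell.
    have lN := leq_trans li iN.
    have sl' : mesh l <= s <= mesh l.+1 by case/andP: sl => /ltW -> ->.
    have -> : sp_val (diff_process k c) s w = dif L k (Z (mesh l) w) c 0.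
      rewrite /sp_val /= (bigD1 (Ordinal li)) //= big1 => [|j].
        rewrite addr0 indicE mem_set ?mul1r; last exact: good_stay li.
        by rewrite indicE mem_set ?mulr1 //= in_itv.
      rewrite -val_eqE neq_ltn /= => jl.
      rewrite [X in _ * X](_ : _ = 0) ?mulr0 // indicE memNset //= in_itv /=.
      move=> /andP[j1 j2]; case/andP: sl => l1 l2; case/orP: jl => [jl|lj].
        by have := le_lt_trans (le_trans j2 (mesh_le jl)) l1; rewrite ltxx.
      by have := le_lt_trans (le_trans l2 (mesh_le lj)) j1; rewrite ltxx.
    have [hd _] := good_coef cz gw li sl'.
    rewrite -[leLHS]real_normK ?num_real // lerXn2r ?nnegrE ?mulr_ge0 ?(ltW eta0) //.
    by rewrite distrC.
rewrite integral_cst //= [leb _](lebesgue_measure_itv `]0, mesh i]) /= lte_fin.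
case: ifP => [_|_]; last by rewrite mule0 lee_fin mulr_ge0 ?sqr_ge0 ?(ltW T0).
rewrite -EFinB -EFinM lee_fin subr0 mulrC ler_wpM2r ?sqr_ge0 //.
by case/andP: (mesh_itv iN).
Qed.

Hypothesis cl1 : 0 < cl.

(** Itô's approximation lemma at one grid time, restricted to the paths that
    have stayed bounded so far. *)
Lemma frozen_close eps : 0 < eps ->
  pr P (stay i `&` [set w | m%:R * (T * (cl * eta) + 2 * n%:R * eps) < nrm (Z (mesh i) w - frozen i w)]) <=
  pr P (~` modulus_paths Z T eta N) + m%:R * n%:R * (4 * (T * (cl * eta) ^+ 2) / eps ^+ 2).
Proof.
move=> e0; set th := m%:R * _; have i0 := mesh_ge0 i.
have [J [JI Jeq]] := rs_eq sol i0.
have [Nl [mNl PNl Nsub]] := filterI (rs_cont sol) Jeq.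
have Fm l := filt_meas usualF (mesh_ge0 l).
have Zm t : 0 <= t -> vadm measurable (Z t).
  by move=> t0; apply: vadm_sub (rs_adm sol t0); exact: (filt_meas usualF t0).
have mM : measurable (modulus_paths Z T eta N) by exact: modulus_paths_meas.
have mst : measurable (stay i) by apply: (Fm i); exact: stay_F.
pose A := good `&` ~` Nl.
have mA : measurable A by apply: measurableI; [exact: measurableI|exact: measurableC].
have Ac w : A w -> path_cont (fun t => Z t w).
  by move=> [_ nN]; apply: contrapT => nc; apply: nN; apply: Nsub => -[/= hc _]; exact: nc.
have Ae w : A w -> forall c, Z (mesh i) w c 0 = Z0 w c 0
       + Rintegral leb `[0, mesh i] (fun s => dri G L (Z s w) c 0) + \sum_(k < n) J k c w.
  by move=> [_ nN]; apply: contrapT => nc; apply: nN; apply: Nsub => -[/= _ he]; exact: nc.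
pose dlt := T * (cl * eta) ^+ 2.
have d0 : 0 < dlt by rewrite mulr_gt0 // exprn_gt0 // mulr_gt0.
(* the exceptional events where a stochastic integral is badly approximated *)
pose B k c := A `&` [set w | 2 * eps <= `|sp_int (diff_process k c) (W k) (mesh i) w - J k c w|].
have Bpr k c : pr P (B k c) <= 4 * dlt / eps ^+ 2.
  by apply: (ito_close usualF BM i0 (JI k c) mA d0 e0) => w Aw; apply: diff_err; [exact: Ac|case: Aw].
have mB k c : measurable (B k c).
  apply: measurableI => //; rewrite -[X in measurable X]setTI; apply: measurable_fun_ler => //.
  apply: measurableT_comp => //; apply: measurable_funB; last first.
    by apply: (adm_meas (Fm i)); apply/(admP _ (filt_sa usualF i0)); case: (JI k c).
  have /funext -> := diff_process_int k c.
  apply: measurable_sum => l; apply: measurable_funM.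
    apply: (adm_meas (Fm l)); apply/(admP _ (filt_sa usualF (mesh_ge0 l))); exact: diff_coef_meas.
  exact: (adm_meas (Fm l.+1) (bm_incr_adm usualF BM k (mesh_ge0 l) (ltW (mesh_lt l)))).
have Im : (measurable : set (set Omega)) `<=` measurable by [].
pose S := [set w | th < nrm (Z (mesh i) w - frozen i w)].
have mS : measurable S.
  rewrite -[S]setTI; apply: measurable_fun_ltr => //; apply: (adm_meas (Fm i)); apply: adm_nrm.
  apply: (vclB (@adm_cst _ _ _ _) (@admD _ _ _ _) (@admM _ _ _ _)); first exact: (rs_adm sol i0).
  by case: (frozen_adm i).
have key w : \1_(stay i `&` S) w <= \1_(~` (modulus_paths Z T eta N)) w + \1_Nl w + \sum_(c < m) \sum_(k < n) \1_(B k c) w :> R.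
  have s0 : 0 <= \sum_(c < m) \sum_(k < n) \1_(B k c) w :> R.
    by do 2 apply: sumr_ge0 => ? _.
  have [[sw Sw]|nS] := pselect ((stay i `&` S) w); last by rewrite indicE memNset // addr_ge0 // addr_ge0.
  rewrite indicE mem_set //; have [Mw|nM] := pselect (modulus_paths Z T eta N w); last first.
    by rewrite [\1_(~` _) w]indicE mem_set // -addrA lerDl addr_ge0.
  have [Nw|nN] := pselect (Nl w).
    by rewrite [\1_Nl w]indicE mem_set // addrAC lerDr addr_ge0.
  have Aw : A w by [].
  have [[c [k Bkc]]|no] := pselect (exists c, exists k, B k c w).
    rewrite (bigD1 c) //= (bigD1 k) //= [\1_(B k c) w]indicE mem_set //.
    rewrite addrCA -addrA lerDl !addr_ge0 //; first by apply: sumr_ge0.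
    by do 2 apply: sumr_ge0 => ? _.
  exfalso; move: Sw; rewrite /S /= ltNge => /negP; apply.
  have small k c : `|sp_int (diff_process k c) (W k) (mesh i) w - J k c w| < 2 * eps.
    by rewrite ltNge; apply/negP => H; apply: no; exists c, k.
  have gw : good w by [].
  apply: (le_trans (nrm_le_l1 _)); apply: (@le_trans _ _ (\sum_(c < m) (T * (cl * eta) + 2 * n%:R * eps))); last first.
    by rewrite sumr_const card_ord -[leLHS]mulr_natl.
  apply: ler_sum => c _; rewrite !mxE (Ae w Aw c) frozen_sum.
  under [X in _ - (_ + _ + X)]eq_bigr do rewrite -diff_process_int.
  have := drift_err c (Ac w Aw) gw; set I := Rintegral _ _ _; set SD := \sum_(l < i) _ => hd.
  have hJ : `|\sum_(k < n) J k c w - \sum_(k < n) sp_int (diff_process k c) (W k) (mesh i) w| <= 2 * n%:R * eps.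
    rewrite -sumrB; apply: (le_trans (ler_norm_sum _ _ _)).
    apply: (@le_trans _ _ (\sum_(k < n) 2 * eps)); last by rewrite sumr_const card_ord -[leLHS]mulr_natl; lra.
    by apply: ler_sum => k _; rewrite distrC ltW.
  set SJ := \sum_(k < n) J k c w in hJ *; set SV := \sum_(k < n) sp_int _ _ _ _ in hJ *.
  have -> : Z0 w c 0 + I + SJ - (Z0 w c 0 + SD + SV) = (I - SD) + (SJ - SV) by ring.
  by apply: (le_trans (ler_normD _ _)); exact: lerD.
have mC := measurableC mM.
have iB : L1 P (fun w => \sum_(c < m) \sum_(k < n) (\1_(B k c) w : R)).
  by do 2 apply: L1_sum => ? _; exact: L1_indic.
have i1 := L1D (L1_indic P mC) (L1_indic P mNl).
have := Ex_le (L1_indic P (measurableI _ _ mst mS)) (L1D i1 iB) key.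
rewrite (ExD i1 iB) (ExD (L1_indic P mC) (L1_indic P mNl)) (pr_indic P (measurableI _ _ mst mS)).
rewrite (pr_indic P mC) (pr_indic P mNl).
have -> : pr P Nl = 0 by rewrite /pr PNl.
rewrite addr0 => /le_trans; apply; rewrite lerD2l.
rewrite Ex_sum => [|c _]; last by apply: L1_sum => k _; exact: L1_indic.
apply: (@le_trans _ _ (\sum_(c < m) \sum_(k < n) (4 * dlt / eps ^+ 2))); last first.
  by rewrite !sumr_const !card_ord -mulrnA -[leLHS]mulr_natl natrM [n%:R * m%:R]mulrC.
apply: ler_sum => c _; rewrite Ex_sum => [|k _]; last exact: L1_indic.
by apply: ler_sum => k _; rewrite pr_indic.
Qed.
End solution_sums.

(** * The solution is the limit of the chain driven by Brownian increments *)

Lemma gronwall_seq {R : realType} (a : nat -> R) (C h e : R) N : 0 <= C -> 0 <= h -> 0 <= e ->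
  a 0%N <= 0 -> (forall i, (i < N)%N -> a i.+1 <= (1 + C * h) * a i + C * h * e) ->
  a N <= C * (N%:R * h) * e * (1 + C * h) ^+ N.
Proof.
move=> C0 h0 e0 a0 aS; have Ch : 0 <= C * h by exact: mulr_ge0.
have q1 : 1 <= 1 + C * h by rewrite lerDl.
suff H i : (i <= N)%N -> a i <= i%:R * (C * h * e) * (1 + C * h) ^+ i.
  by apply: (le_trans (H N (leqnn N))); rewrite le_eqVlt; apply/orP; left; apply/eqP; ring.
elim: i => [_|i IH iN]; first by rewrite mul0r mul0r.
apply: (le_trans (aS i iN)); have := ler_wpM2l (le_trans ler01 q1) (IH (ltnW iN)).
have : C * h * e <= C * h * e * (1 + C * h) ^+ i.+1.
  by rewrite ler_peMr ?mulr_ge0 // exprn_ege1.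
by rewrite exprS -natr1; lra.
Qed.

Lemma gauss8_ge0 (R : realType) : 0 <= gauss8 :> R.
Proof. by rewrite /gauss8 mulr_ge0 // addr_ge0 // expR_ge0. Qed.

Lemma pow_le_expR {R : realType} (x : R) N : 0 <= x -> (1 + x) ^+ N <= expR (N%:R * x).
Proof.
by move=> x0; rewrite expRM_natl lerXn2r ?nnegrE ?expR_ge0 ?addr_ge0 // expR_ge1Dx.
Qed.

Lemma small_mul {R : realType} (a b : R) : 0 <= a -> 0 < b ->
  exists2 x, 0 < x & forall y, 0 <= y <= x -> a * y <= b.
Proof.
move=> a0 b0; have a1 : 0 < a + 1 by rewrite ltr_wpDl.
exists (b / (a + 1)); first by rewrite divr_gt0.
move=> y /andP[y0 yx]; apply: (@le_trans _ _ ((a + 1) * y)); first by rewrite mulrDl lerDl mul1r.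
by rewrite mulrC -ler_pdivlMr.
Qed.

Section strong_limit.
Context {R : realType} {disp : measure_display} {Omega : measurableType disp}.
Variable P : probability Omega R.
Variables (F : R -> set (set Omega)) (n m : nat) (W : 'I_n -> R -> Omega -> R).
Hypothesis usualF : usual_filtration P F.
Hypothesis BM : brownian P F W.
Variables (G : 'M[R]_m) (L : 'I_n -> 'M[R]_m) (ex : R -> 'M[R]_m) (T Cex : R).
Hypothesis T0 : 0 < T.
Hypothesis Cex0 : 0 <= Cex.
Hypothesis exP : forall h v, 0 <= h <= T ->
  nrm (ex h *m v - v - h *: (G *m v)) <= Cex * h ^+ 2 * nrm v.
Hypothesis dissip : forall z, dot z (lindblad G L 1%:M *m z) = 0.
Variables (Z0 : Omega -> 'cV[R]_m) (Z : R -> Omega -> 'cV[R]_m).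
Hypothesis sol : real_solution P F W G L Z0 Z.
Hypothesis Z01 : forall w, unit0 (Z0 w).

Definition brown_chain N i w := chain L ex (T / N%:R)
  (fun j k => incr W (mesh T N j) (mesh T N j.+1) k w) (Z0 w) i.

Lemma brown_chain_unit0 N i w : unit0 (brown_chain N i w).
Proof. exact: chain_unit0. Qed.

Lemma brown_chain_adm N i : (0 < N)%N -> vadm (F (mesh T N i)) (brown_chain N i).
Proof.
move=> N0; have aY0 : vadm (F (mesh T N 0)) Z0 by rewrite /mesh mul0r; exact: rs_init sol.
apply: (vadm_chain L ex (T / N%:R) (F := fun j => F (mesh T N j))
  (x := fun j => incr W (mesh T N j) (mesh T N j.+1)) _ _ aY0 (leqnn i)) => [j _|j k _].
  exact: (grid_mono usualF T0 N0).
exact: (incr_adm usualF BM T0 N0).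
Qed.

Lemma unit0_L1 (X : Omega -> 'cV[R]_m) : vadm measurable X -> (forall w, unit0 (X w)) ->
  L1 P (fun w => dot (X w) (X w)).
Proof.
move=> aX X1; have Im : (measurable : set (set Omega)) `<=` measurable by [].
apply: (@L1_bdd _ _ _ P _ 1).
  apply: (adm_meas Im); exact: (cl_dot (@adm_cst _ _ _ _) (@admD _ _ _ _) (@admM _ _ _ _)).
move=> w; rewrite ger0_norm ?dot_ge0 //; have := sq_le ler01 (unit0_nrm (X1 w)).
by rewrite expr1n.
Qed.

(** Discrete Gronwall inequality for the mean square distance of the frozen sums
    to the chain. The one-step estimate involves the distance of the solution to
    the chain, which is at most the distance wanted plus [th] off an event of
    probability [pb], where it is bounded by [rho + 1]. *)
Lemma strong_bound (rho : nat) : exists2 C, 0 <= C & forall N (th pb : R), (0 < N)%N -> 0 <= th -> 0 <= pb ->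
  (forall i, (i < N)%N -> pr P (stay T Z N rho i `&`
     [set w | th < nrm (Z (mesh T N i) w - frozen W G L T Z0 Z N rho i w)]) <= pb) ->
  let D w := frozen W G L T Z0 Z N rho N w - brown_chain N N w in
  L1 P (fun w => \1_(stay T Z N rho N) w * dot (D w) (D w)) /\
  Ex P (fun w => \1_(stay T Z N rho N) w * dot (D w) (D w)) <=
    C * (2 * th ^+ 2 + (rho%:R + 1) ^+ 2 * pb + T / N%:R).
Proof.
have [C C0 stp] := strong_step_Ex P T0 Cex0 exP dissip rho%:R (gauss8_ge0 R).
exists (3 * C * T * expR (3 * C * T)) => [|N th pb N0 th0 pb0 Hp D].
  by rewrite mulr_ge0 ?expR_ge0 // !mulr_ge0 // ltW.
set h := T / N%:R; have h0 : 0 < h by exact: step_gt0.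
have hT : h <= T by rewrite ler_pdivrMr ?ltr0n // ler_peMr ?ler1n // ltW.
pose U i := frozen W G L T Z0 Z N rho i; pose Y i := brown_chain N i; pose A i := stay T Z N rho i.
pose ti := mesh T N; have ti0 i : 0 <= ti i by exact: mesh_ge0.
have Fm i := filt_meas usualF (ti0 i).
have aY i : vadm (F (ti i)) (Y i) by exact: brown_chain_adm.
have [aU iU] : (forall i, vadm (F (ti i)) (U i)) /\ (forall i, L1 P (fun w => dot (U i w) (U i w))).
  split=> i; have [a l] := frozen_adm usualF BM T0 sol rho N0 i => //; apply: l.
  by apply: unit0_L1 => //; apply: vadm_sub (rs_init sol); exact: (filt_meas usualF (lexx 0)).
have aZ i : vadm (F (ti i)) (Z (ti i)) by exact: rs_adm sol _ (ti0 i).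
have FA i : F (ti i) (A i) by exact: (stay_F usualF T0 sol rho N0 i).
have mA i : measurable (A i) by exact: (Fm i _ (FA i)).
have Im : (measurable : set (set Omega)) `<=` measurable by [].
have c := @adm_cst R _ _ (measurable : set (set Omega)); have pD := @admD R _ _ (measurable : set (set Omega)).
have pM := @admM R _ _ (measurable : set (set Omega)).
have mU i : vadm measurable (U i) by exact: (vadm_sub (Fm i) (aU i)).
have mY i : vadm measurable (Y i) by exact: (vadm_sub (Fm i) (aY i)).
have mZ i : vadm measurable (Z (ti i)) by exact: (vadm_sub (Fm i) (aZ i)).
have Yn i w : nrm (Y i w) <= 1 by apply: unit0_nrm; exact: brown_chain_unit0.
have ind01 (S : set Omega) w : 0 <= (\1_S w : R) <= 1 by rewrite indicE; case: (w \in S); rewrite /= ?ler01 ?lexx.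
have indm (S : set Omega) : measurable S -> adm measurable (\1_S : Omega -> R) by move=> mS; exact: adm_indic.
have dm (S : set Omega) (X1 X2 : Omega -> 'cV[R]_m) : measurable S -> vadm measurable X1 -> vadm measurable X2 ->
    measurable_fun setT (fun w => \1_S w * dot (X1 w - X2 w) (X1 w - X2 w)).
  move=> mS m1 m2; apply: (adm_meas Im); apply: (pM); first exact: indm.
  by apply: (cl_dot c pD pM); exact: (vclB c pD pM).
have iUY (S : set Omega) i : measurable S -> L1 P (fun w => \1_S w * dot (U i w - Y i w) (U i w - Y i w)).
  move=> mS; apply: (@L1_dom _ _ _ P _ (fun w => 2 * dot (U i w) (U i w) + 2)).
  - exact: dm.
  - by apply: L1D; [exact: L1Z|exact: L1_cst].
  - move=> w; have /andP[s0 s1] := ind01 S w; rewrite ger0_norm ?mulr_ge0 ?dot_ge0 //.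
    apply: (@le_trans _ _ (dot (U i w - Y i w) (U i w - Y i w))); first by rewrite ler_piMl // dot_ge0.
    apply: (le_trans (sqB_le _ _)); have := sq_le ler01 (Yn i w); rewrite expr1n; lra.
split; first exact: iUY.
pose a i := Ex P (fun w => \1_(A i) w * dot (U i w - Y i w) (U i w - Y i w)).
pose e := 2 * th ^+ 2 + (rho%:R + 1) ^+ 2 * pb + h.
have e0 : 0 <= e by rewrite !addr_ge0 ?(ltW h0) // mulr_ge0 ?sqr_ge0.
have aS i : (i < N)%N -> a i.+1 <= (1 + 3 * C * h) * a i + 3 * C * h * e.
  move=> iN.
  have st := stp _ _ (Y i) (U i) (Z (ti i)) (A i) h (grid_noise usualF BM T0 N0 i) (aY i)
    (brown_chain_unit0 N i) (aU i) (iU i) (aZ i) (FA i) (@stay_Z _ _ _ _ T Z N rho i).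
  rewrite h0 hT in st; have {}st := st isT.
  apply: (@le_trans _ _ (Ex P (fun w => \1_(A i) w * dot (U i.+1 w - Y i.+1 w) (U i.+1 w - Y i.+1 w)))).
    apply: Ex_le; [exact: iUY|exact: iUY|] => w; rewrite ler_wpM2r ?dot_ge0 //.
    rewrite !indicE; case: (boolP (w \in A i.+1)) => [|_]; last by case: (_ \in _).
    by rewrite inE => /(stay_le (leqnSn i)) /mem_set ->.
  apply: (le_trans st); rewrite -/(a i).
  set z := Ex P (fun w => \1_(A i) w * dot (Z (ti i) w - Y i w) (Z (ti i) w - Y i w)).
  pose S := A i `&` [set w | th < nrm (Z (ti i) w - U i w)].
  have mS : measurable S.
    apply: measurableI => //; rewrite -[X in measurable X]setTI; apply: measurable_fun_ltr => //.
    by apply: (adm_meas Im); apply: adm_nrm; exact: (vclB c pD pM (mZ i) (mU i)).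
  have zle : z <= 2 * a i + (2 * th ^+ 2 + (rho%:R + 1) ^+ 2 * pb).
    apply: (@le_trans _ _ (Ex P (fun w => 2 * (\1_(A i) w * dot (U i w - Y i w) (U i w - Y i w)) +
        (2 * th ^+ 2 + (rho%:R + 1) ^+ 2 * \1_S w)))).
      have r0 : 0 <= (rho%:R + 1) ^+ 2 :> R by exact: sqr_ge0.
      have ZYr w : A i w -> dot (Z (ti i) w - Y i w) (Z (ti i) w - Y i w) <= (rho%:R + 1) ^+ 2.
        move=> Aw; apply: sq_le; first by rewrite addr_ge0.
        by apply: (le_trans (nrmB _ _)); rewrite lerD //; exact: stay_Z.
      apply: Ex_le.
      - apply: (@L1_bdd _ _ _ P _ ((rho%:R + 1) ^+ 2)); first exact: dm.
        move=> w; rewrite indicE; case: (boolP (w \in A i)); last by rewrite mul0r normr0.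
        by rewrite inE => Aw; rewrite mul1r ger0_norm ?dot_ge0 // ZYr.
      - apply: L1D; first by apply: L1Z; exact: iUY.
        by apply: L1D; [exact: L1_cst|apply: L1Z; exact: L1_indic].
      move=> w; rewrite [\1_(A i) w]indicE; case: (boolP (w \in A i)); last first.
        by move=> _; rewrite !mul0r mulr0 add0r addr_ge0 ?mulr_ge0 ?sqr_ge0.
      rewrite inE => Aw; rewrite !mul1r.
      have [H|H] := leP (nrm (Z (ti i) w - U i w)) th; last first.
        rewrite indicE mem_set //= mulr1; apply: (le_trans (ZYr w Aw)).
        have := dot_ge0 (U i w - Y i w); have := sqr_ge0 th; lra.
      have -> : Z (ti i) w - Y i w = (Z (ti i) w - U i w) + (U i w - Y i w) by rewrite addrA subrK.
      apply: (le_trans (sqD_le _ _)); have := sq_le th0 H.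
      have /andP[s0 _] := ind01 S w; have := mulr_ge0 r0 s0; lra.
    rewrite ExD ?ExZ ?ExD ?Ex_cst ?ExZ ?pr_indic //; try exact: L1_indic; try exact: L1_cst; try exact: iUY.
    - by rewrite lerD2l lerD2l ler_wpM2l ?sqr_ge0 //; exact: Hp.
    - by apply: L1Z; exact: L1_indic.
    - by apply: L1Z; exact: iUY.
    - by apply: L1D; [exact: L1_cst|apply: L1Z; exact: L1_indic].
  have Ch : 0 <= C * h by rewrite mulr_ge0 // ltW.
  have := ler_wpM2l Ch zle; rewrite /e.
  have q0 : 0 <= C * h * (2 * th ^+ 2 + (rho%:R + 1) ^+ 2 * pb) by rewrite mulr_ge0 // addr_ge0 ?mulr_ge0 ?sqr_ge0.
  have q1 : 0 <= C * h * h by rewrite mulr_ge0 // ltW.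
  by rewrite expr2; lra.
have a0 : a 0%N <= 0.
  rewrite /a -[leRHS](Ex_cst P); apply: Ex_le; [exact: iUY|exact: L1_cst|].
  by move=> w; rewrite /= subrr dot0l mulr0.
have C30 : 0 <= 3 * C by rewrite mulr_ge0.
have := gronwall_seq C30 (ltW h0) e0 a0 aS.
move=> /le_trans; apply; have Nh : N%:R * h = T by exact: meshN.
rewrite Nh -/e [leRHS]mulrAC ler_wpM2l //; first by rewrite !mulr_ge0 // ltW.
have -> : 3 * C * T = N%:R * (3 * C * h) by rewrite -Nh; ring.
by rewrite pow_le_expR // mulr_ge0 // ltW.
Qed.

(** Three small events are discarded: the path leaves a large ball, a stochastic
    integral is badly approximated, or the frozen sum is far from the chain. *)
Lemma brown_chain_cvg (kap e : R) : 0 < kap -> 0 < e -> exists N0, forall N, (N0 <= N)%N -> (0 < N)%N ->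
  pr P [set w | 2 * kap < nrm (Z T w - brown_chain N N w)] <= e.
Proof.
move=> k0 e0; have e3 : 0 < e / 3 by rewrite divr_gt0.
have Zm t : 0 <= t -> vadm measurable (Z t).
  by move=> t0; apply: vadm_sub (rs_adm sol t0); exact: (filt_meas usualF t0).
have [rho Brho] := bounded_paths_pr T0 Zm (rs_cont sol) e3.
have [C C0 HC] := strong_bound rho.
have [cl' cl'0 lip'] := coef_lip G L (rho%:R + 1); pose cl := cl' + 1.
have cl0 : 0 < cl by rewrite ltr_wpDl.
have lip x y : nrm x <= rho%:R + 1 -> nrm y <= rho%:R + 1 ->
    (forall k, nrm (dif L k x - dif L k y) <= cl * nrm (x - y)) /\
    nrm (dri G L x - dri G L y) <= cl * nrm (x - y).
  move=> hx hy; have [h1 h2] := lip' x y hx hy.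
  have h3 : cl' * nrm (x - y) <= cl * nrm (x - y) by rewrite ler_wpM2r ?nrm_ge0 // lerDl.
  by split=> [k|]; [exact: le_trans (h1 k) h3|exact: le_trans h2 h3].
(* the three terms of the strong bound are made smaller than e1 *)
pose e1 := e / 3 * kap ^+ 2 / (3 * (C + 1)).
have C1 : 0 < 3 * (C + 1) by rewrite mulr_gt0 // ltr_wpDl.
have e10 : 0 < e1 by rewrite divr_gt0 // mulr_gt0 // exprn_gt0.
have [x1 x10 H1] := small_mul (ler0n R 2) e10.
pose th := Num.min kap (Num.min 1 x1).
have th0 : 0 < th by rewrite !lt_min k0 ltr01 x10.
have thk : th <= kap by rewrite ge_min lexx.
have th1 : 2 * th ^+ 2 <= e1.
  apply: H1; rewrite sqr_ge0 /=; apply: (@le_trans _ _ th); last by rewrite !ge_min lexx !orbT.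
  by rewrite expr2 ler_piMl ?(ltW th0) // !ge_min lexx orbT.
have r0 : 0 <= (rho%:R + 1) ^+ 2 :> R by exact: sqr_ge0.
have [x2 x20 H2] := small_mul r0 e10.
pose pb := Num.min (e / 3) x2.
have pb0 : 0 < pb by rewrite lt_min e3.
have pbe : pb <= e / 3 by rewrite ge_min lexx.
have pb1 : (rho%:R + 1) ^+ 2 * pb <= e1 by apply: H2; rewrite (ltW pb0) ge_min lexx orbT.
have th2 : 0 < th / 2 by rewrite divr_gt0.
have [eps eps0 H3] := small_mul (mulr_ge0 (ler0n R m) (mulr_ge0 (ler0n R 2) (ler0n R n))) th2.
have Tcl : 0 <= T * cl by rewrite mulr_ge0 // ltW.
have [x4 x40 H4] := small_mul (mulr_ge0 (ler0n R m) Tcl) th2.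
have pb2 : 0 < pb / 2 by rewrite divr_gt0.
have a5 : 0 <= m%:R * n%:R * (4 * (T * cl ^+ 2) / eps ^+ 2).
  by rewrite mulr_ge0 ?divr_ge0 ?mulr_ge0 ?sqr_ge0 // ltW.
have [x5 x50 H5] := small_mul a5 pb2.
pose eta := Num.min 1 (Num.min x4 x5).
have eta0 : 0 < eta by rewrite !lt_min ltr01 x40.
have eta1 : eta <= 1 by rewrite ge_min lexx.
have eta4 : m%:R * (T * cl) * eta <= th / 2 by apply: H4; rewrite (ltW eta0) !ge_min lexx orbT.
have eta5 : m%:R * n%:R * (4 * (T * cl ^+ 2) / eps ^+ 2) * eta ^+ 2 <= pb / 2.
  apply: H5; rewrite sqr_ge0 /=; apply: (@le_trans _ _ eta); last by rewrite !ge_min lexx !orbT.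
  by rewrite expr2 ler_piMl // ltW.
have [N1 HN1] := modulus_paths_pr T0 Zm (rs_cont sol) eta0 pb2.
have [N2 HN2] := small_mesh T0 e10.
exists (maxn N1 N2.+1) => N; rewrite geq_max => /andP[NN1 NN2] N0.
have riem i : (i <= N)%N -> pr P (stay T Z N rho i `&`
     [set w | th < nrm (Z (mesh T N i) w - frozen W G L T Z0 Z N rho i w)]) <= pb.
  move=> iN; have := @frozen_close _ _ _ P F n m W usualF BM G L T T0 Z0 Z sol N rho N0 i iN eta eta0 eta1 cl
    (ltW cl0) lip cl0 eps eps0.
  set b := m%:R * (T * (cl * eta) + _); set q := m%:R * n%:R * _ => H.
  have bth : b <= th.
    have := H3 eps (_ : 0 <= eps <= eps); rewrite lexx (ltW eps0) => /(_ isT).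
    by move: eta4; rewrite /b; lra.
  have qpb : q <= pb / 2.
    apply: le_trans eta5; rewrite le_eqVlt; apply/orP; left; apply/eqP; rewrite /q; field.
    by rewrite gt_eqF.
  have H6 := HN1 N NN1.
  apply: (@le_trans _ _ (pb / 2 + pb / 2)); last by rewrite -splitr.
  apply: le_trans (lerD H6 qpb); apply: le_trans H.
  have Fm := filt_meas usualF (mesh_ge0 T0 N0 i).
  have mst : measurable (stay T Z N rho i) by apply: Fm; exact: (stay_F usualF T0 sol rho N0 i).
  have mn : measurable_fun setT (fun w => nrm (Z (mesh T N i) w - frozen W G L T Z0 Z N rho i w)).
    apply: (adm_meas Fm); apply: adm_nrm.
    apply: (vclB (@adm_cst _ _ _ _) (@admD _ _ _ _) (@admM _ _ _ _)); first exact: (rs_adm sol (mesh_ge0 T0 N0 i)).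
    by case: (frozen_adm usualF BM T0 sol rho N0 i).
  have mS c : measurable [set w | c < nrm (Z (mesh T N i) w - frozen W G L T Z0 Z N rho i w)].
    by rewrite -[X in measurable X]setTI; exact: measurable_fun_ltr.
  apply: pr_mono; [exact: measurableI|exact: measurableI|].
  by move=> w [sw /= tw]; split=> //=; exact: le_lt_trans bth tw.
have [lN EN] := HC N th pb N0 (ltW th0) (ltW pb0) (fun i iN => riem i (ltnW iN)).
pose D w := frozen W G L T Z0 Z N rho N w - brown_chain N N w.
have k20 : 0 < kap ^+ 2 by rewrite exprn_gt0.
have := pr_markov k20 lN (fun w => mulr_ge0 _ (dot_ge0 _)).
have ind0 w : 0 <= (\1_(stay T Z N rho N) w : R) by rewrite indicE; case: (_ \in _).
move=> /(_ ind0); set S3 := [set w | _] => prS3.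
set S2 := stay T Z N rho N `&` [set w | th < nrm (Z (mesh T N N) w - frozen W G L T Z0 Z N rho N w)].
have prS2 : pr P S2 <= pb by exact: riem.
have Fm := filt_meas usualF (mesh_ge0 T0 N0 N).
have mst : measurable (stay T Z N rho N) by apply: Fm; exact: (stay_F usualF T0 sol rho N0 N).
have aU : vadm measurable (frozen W G L T Z0 Z N rho N).
  by apply: (vadm_sub Fm); case: (frozen_adm usualF BM T0 sol rho N0 N).
have aY : vadm measurable (brown_chain N N) by apply: (vadm_sub Fm); exact: brown_chain_adm.
have Im : (measurable : set (set Omega)) `<=` measurable by [].
have mn (X1 X2 : Omega -> 'cV[R]_m) c : vadm measurable X1 -> vadm measurable X2 ->
    measurable [set w | c < nrm (X1 w - X2 w)].
  move=> a1 a2; rewrite -[X in measurable X]setTI; apply: measurable_fun_ltr => //.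
  apply: (adm_meas Im); apply: adm_nrm.
  exact: (vclB (@adm_cst _ _ _ _) (@admD _ _ _ _) (@admM _ _ _ _) a1 a2).
have mS2 : measurable S2 by apply: measurableI => //; apply: mn => //; exact/Zm/mesh_ge0.
have mS3 : measurable S3.
  rewrite -[S3]setTI; apply: measurable_fun_ler => //; exact: (L1_meas lN).
have mB := bounded_paths_meas T0 Zm rho.
apply: (@le_trans _ _ (pr P (~` bounded_paths Z T rho `|` (S2 `|` S3)))).
  apply: pr_mono; first by apply: mn => //; exact/Zm/ltW.
    by apply: measurableU; [exact: measurableC|exact: measurableU].
  move=> w /= kw; have [Bw|] := pselect (bounded_paths Z T rho w); last by left.
  have sw : stay T Z N rho N w.
    by move=> l lN'; rewrite (mesh_gpt T N0) //; apply: Bw; rewrite prednK.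
  have [H|H] := leP (nrm (Z T w - frozen W G L T Z0 Z N rho N w)) th; last first.
    by right; left; split=> //=; rewrite (meshN T N0).
  right; right; rewrite /S3 /= indicE mem_set // mul1r -nrm_sqr lerXn2r ?nnegrE ?nrm_ge0 ?(ltW k0) //.
  have := nrmD (Z T w - frozen W G L T Z0 Z N rho N w) (D w).
  by rewrite /D addrA subrK => h; move: h kw H thk; lra.
apply: (le_trans (pr_setU_le _ (measurableC mB) (measurableU _ _ mS2 mS3))).
apply: (le_trans (lerD Brho (pr_setU_le _ mS2 mS3))).
have S3e : pr P S3 <= e / 3.
  apply: (le_trans prS3); rewrite ler_pdivrMr //; apply: (le_trans EN).
  have TN : T / N%:R <= e1 by have := HN2 N.-1; rewrite prednK //; apply; rewrite -ltnS prednK.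
  apply: (@le_trans _ _ ((C + 1) * (e1 + e1 + e1))).
    apply: ler_pM => //; rewrite ?lerDl //; last by rewrite !lerD.
    apply: addr_ge0; last by rewrite divr_ge0 // ltW.
    by apply: addr_ge0; apply: mulr_ge0; rewrite ?sqr_ge0 ?(ltW pb0).
  rewrite le_eqVlt; apply/orP; left; apply/eqP; rewrite /e1; field.
  by rewrite gt_eqF // ltr_wpDl.
by move: prS2 S3e pbe; lra.
Qed.

Let Im : (measurable : set (set Omega)) `<=` measurable. Proof. by []. Qed.

Let ZTm : vadm measurable (Z T).
Proof.
have T0' := ltW T0.
by apply: vadm_sub (rs_adm sol T0'); exact: (filt_meas usualF T0').
Qed.

Let bchm N : (0 < N)%N -> vadm measurable (brown_chain N N).
Proof. by move=> N0; apply: vadm_sub (brown_chain_adm N N0); exact: (filt_meas usualF (mesh_ge0 T0 N0 N)). Qed.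

Let mnrm (X : Omega -> 'cV[R]_m) c : vadm measurable X -> measurable [set w | c < nrm (X w)].
Proof.
move=> aX; rewrite -[X in measurable X]setTI; apply: measurable_fun_ltr => //.
exact: (adm_meas Im (adm_nrm aX)).
Qed.

Let msub (X1 X2 : Omega -> 'cV[R]_m) : vadm measurable X1 -> vadm measurable X2 ->
  vadm measurable (fun w => X1 w - X2 w).
Proof. exact: (vclB (@adm_cst _ _ _ _) (@admD _ _ _ _) (@admM _ _ _ _)). Qed.

(** Being a limit of points of the unit ball, the solution stays in it. *)
Lemma solution_unit : pr P [set w | 1 < nrm (Z T w)] = 0.
Proof.
have out kap : 0 < kap -> P [set w | 1 + 2 * kap < nrm (Z T w)] = 0%E.
  move=> k0; have mS := mnrm (1 + 2 * kap) ZTm.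
  rewrite (prE P mS); congr EFin; apply/eqP; rewrite eq_le pr_ge0 andbT.
  apply/ler_addgt0Pr => e e0; rewrite add0r; have [N0 /(_ N0.+1 (leqnSn _) isT)] := brown_chain_cvg k0 e0.
  apply: le_trans; apply: pr_mono => //; first by apply: mnrm; apply: msub => //; exact: bchm.
  move=> w /= H; have := nrmD (Z T w - brown_chain N0.+1 N0.+1 w) (brown_chain N0.+1 N0.+1 w).
  by rewrite subrK; have := unit0_nrm (brown_chain_unit0 N0.+1 N0.+1 w); move: H; lra.
rewrite /pr; have -> : P [set w | 1 < nrm (Z T w)] = 0%E; last by [].
apply: measure_negligible; first exact: mnrm.
rewrite (_ : [set w | _] = \bigcup_j [set w | 1 + 2 * j.+1%:R^-1 < nrm (Z T w)]).
  apply: negligible_bigcup => j; apply/negligibleP; first exact: mnrm.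
  by apply: out; rewrite invr_gt0.
apply/seteqP; split => w /=; last by move=> [j _ /=]; apply: le_lt_trans; rewrite lerDl mulr_ge0 ?invr_ge0.
move=> H; have d0 : 0 < (nrm (Z T w) - 1) / 4 by rewrite divr_gt0 // subr_gt0.
have [j /(_ j (leqnn _))] := small_mesh ltr01 d0; rewrite mul1r => Hj; exists j => //=.
by move: Hj; set q := _^-1; move: H; lra.
Qed.

(** Convergence in probability of bounded variables implies convergence of the
    expectations; the solution is replaced by a version that stays in the unit
    ball. *)
Lemma brown_chain_quad_cvg B : L1 P (fun w => quad B (Z T w)) /\
  forall e, 0 < e -> exists N0, forall N, (N0 <= N)%N -> (0 < N)%N ->
    `|Ex P (fun w => quad B (Z T w)) - Ex P (fun w => quad B (brown_chain N N w))| <= e.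
Proof.
pose U := [set w | 1 < nrm (Z T w)]; have mU : measurable U by exact: mnrm.
pose Z' w := \1_(~` U) w *: Z T w.
have aZ' : vadm measurable Z'.
  by apply: vclZ; [exact: admM|apply: adm_indic; exact: measurableC|exact: ZTm].
have Z'E w : ~ U w -> Z' w = Z T w by move=> nU; rewrite /Z' indicE mem_set // scale1r.
have Z'n w : nrm (Z' w) <= 1.
  have [nU|] := pselect (U w); last by move=> nU; rewrite Z'E // leNgt; apply/negP.
  by rewrite /Z' indicE memNset ?scale0r ?nrm0 // => /(_ nU).
have aeZ : {ae P, forall w, quad B (Z' w) = quad B (Z T w)}.
  exists U; split=> //; first by have := solution_unit; rewrite /pr => H; rewrite (prE P mU) /pr H.
  by move=> w /= H; apply: contrapT => nU; apply: H; rewrite Z'E.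
have iZ' := quad_L1 P B aZ' Z'n; split; first by apply: L1_ae aeZ; [exact: iZ'|exact: quad_meas].
move=> e e0; have b0 : 0 <= 4 * mn B by rewrite mulr_ge0 // mn_ge0.
have e2 : 0 < e / 2 by rewrite divr_gt0.
have [x x0 Hx] := small_mul b0 e2; have Bx : 4 * mn B * x <= e / 2 by apply: Hx; rewrite (ltW x0) lexx.
have [N0 HN] := brown_chain_cvg x0 x0; exists N0 => N NN Npos; have {HN} HN := HN N NN Npos.
set S := [set w | _] in HN.
have mS : measurable S by apply: mnrm; apply: msub => //; exact: bchm.
have Yn w : nrm (brown_chain N N w) <= 1 by apply: unit0_nrm; exact: brown_chain_unit0.
have iY := quad_L1 P B (bchm Npos) Yn.
rewrite -(Ex_ae (quad_meas B aZ') (quad_meas B ZTm) aeZ) -ExB //.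
have pt w : `|quad B (Z' w) - quad B (brown_chain N N w)| <= 4 * mn B * x + (4 * mn B * \1_S w + 4 * mn B * \1_U w).
  set y := brown_chain N N w; set z := Z' w.
  have -> : quad B z - quad B y = dot (z - y) (B *m z) + dot y (B *m (z - y)).
    by rewrite /quad mulmxBr dotBl dotBr addrA subrK.
  have h0 : `|dot (z - y) (B *m z) + dot y (B *m (z - y))| <= mn B * (2 * nrm (z - y)).
    apply: (le_trans (ler_normD _ _)); rewrite mulr_natl mulr2n mulrDr; apply: lerD; apply: (le_trans (dotM_le _ _ _));
      rewrite ler_wpM2l ?mn_ge0 //.
      by rewrite ler_piMr ?nrm_ge0 // Z'n.
    by rewrite ler_piMl ?nrm_ge0 // Yn.
  apply: (le_trans h0); have B0 := mn_ge0 B.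
  have s0 : 0 <= (\1_S w : R) by rewrite indicE; case: (_ \in _).
  have u0 : 0 <= (\1_U w : R) by rewrite indicE; case: (_ \in _).
  have n2 : nrm (z - y) <= 2 by apply: (le_trans (nrmB _ _)); have := Z'n w; have := Yn w; rewrite -/y -/z; lra.
  have key : nrm (z - y) <= 2 * x + 2 * (\1_S w + \1_U w).
    have [Uw|nU] := pselect (U w).
      by rewrite [\1_U w]indicE mem_set //=; move: s0 x0 n2; lra.
    have [Sw|nS] := pselect (S w).
      by rewrite [\1_S w]indicE mem_set //=; move: u0 x0 n2; lra.
    have : nrm (z - y) <= 2 * x by rewrite leNgt; apply/negP => H; apply: nS; rewrite /S /= -Z'E.
    by move: s0 u0; lra.
  by have := ler_wpM2l B0 key; lra.
have i1 : L1 P (fun w => 4 * mn B * (\1_S w : R) + 4 * mn B * (\1_U w : R)).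
  by apply: L1D; apply: L1Z; exact: L1_indic.
apply: (le_trans (Ex_abs_le (L1B iZ' iY) (L1D (L1_cst P _) i1) pt)).
rewrite (ExD (L1_cst P _) i1) Ex_cst (ExD (L1Z _ (L1_indic P mS)) (L1Z _ (L1_indic P mU))).
rewrite !ExZ ?pr_indic //; try exact: L1_indic.
rewrite /U solution_unit mulr0 addr0.
have : 4 * mn B * pr P S <= e / 2 by apply: Hx; rewrite pr_ge0.
by move: Bx; lra.
Qed.
End strong_limit.

(** * Linear evolution of the observable *)

Section evolution.
Context {R : realType} {m n : nat}.
Variables (G : 'M[R]_m) (L : 'I_n -> 'M[R]_m).
Local Notation ev := (evol G L).
Local Notation lam := (growth G L).

Lemma lindbladB B B' : lindblad G L (B - B') = lindblad G L B - lindblad G L B'.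
Proof.
rewrite /lindblad !(mulmxBr, mulmxBl).
have -> : \sum_k (L k)^T *m (B - B') *m L k = \sum_k (L k)^T *m B *m L k - \sum_k (L k)^T *m B' *m L k.
  by rewrite -sumrB; apply: eq_bigr => k _; rewrite mulmxBr mulmxBl.
move: (G^T *m B) (G^T *m B') (B *m G) (B' *m G) (\sum_k _) (\sum_k _) => x1 x2 x3 x4 x5 x6.
by apply/matrixP => i j; rewrite !mxE; ring.
Qed.

Lemma evolB h B B' : ev h (B - B') = ev h B - ev h B'.
Proof. by rewrite /evol lindbladB scalerBr opprD addrACA. Qed.

Let lam0 : 0 <= lam. Proof. exact: growth_ge0. Qed.

Lemma iter_evol_exp h B i : 0 <= h -> mn (iter i (ev h) B) <= expR (lam * (i%:R * h)) * mn B.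
Proof.
move=> h0; apply: (le_trans (iter_evol_le G L B i h0)); rewrite ler_wpM2r ?mn_ge0 //.
by rewrite mulrCA pow_le_expR // mulr_ge0.
Qed.

(** Many small Euler steps differ from a single one of the same total length by
    a term of second order. *)
Lemma iter_evol_block d B K : 0 <= d ->
  mn (iter K (ev d) B - ev (K%:R * d) B) <= (lam * (K%:R * d)) ^+ 2 * expR (lam * (K%:R * d)) * mn B.
Proof.
move=> d0; have Kd0 : 0 <= K%:R * d by rewrite mulr_ge0.
set E := expR _; have E0 : 0 <= E by exact: expR_ge0.
have it j : (j <= K)%N -> mn (iter j (ev d) B) <= E * mn B.
  move=> jK; apply: (le_trans (iter_evol_exp B j d0)); rewrite ler_wpM2r ?mn_ge0 // ler_expR.
  by rewrite ler_wpM2l // ler_wpM2r // ler_nat.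
have B0 := mn_ge0 B.
have dif j : (j <= K)%N -> mn (iter j (ev d) B - B) <= j%:R * (d * lam * (E * mn B)).
  elim: j => [_|j IH jK]; first by rewrite subrr mn0 mul0r.
  rewrite iterS /evol addrAC; apply: (le_trans (mnD _ _)).
  rewrite -natr1 mulrDl mul1r lerD ?IH ?(ltnW jK) // mnZ ger0_norm // -mulrA ler_wpM2l //.
  by apply: (le_trans (lindblad_le _ _ _)); rewrite ler_wpM2l // it // ltnW.
have rem j : (j <= K)%N -> mn (iter j (ev d) B - ev (j%:R * d) B) <= j%:R * (d * lam * (K%:R * (d * lam * (E * mn B)))).
  elim: j => [_|j IH jK]; first by rewrite /evol mul0r scale0r addr0 subrr mn0 mul0r.
  have -> : iter j.+1 (ev d) B - ev (j.+1%:R * d) B =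
      (iter j (ev d) B - ev (j%:R * d) B) + d *: lindblad G L (iter j (ev d) B - B).
    rewrite iterS lindbladB /evol; set X := iter _ _ _; set c1 := lindblad G L X; set c2 := lindblad G L B.
    by clearbody X c1 c2; rewrite -natr1 mulrDl mul1r; apply/matrixP => a b; rewrite !mxE; ring.
  apply: (le_trans (mnD _ _)); rewrite -natr1 mulrDl mul1r lerD ?IH ?(ltnW jK) //.
  rewrite mnZ ger0_norm // -mulrA ler_wpM2l //; apply: (le_trans (lindblad_le _ _ _)).
  rewrite ler_wpM2l //; apply: (le_trans (dif j (ltnW jK))); rewrite ler_wpM2r ?ler_nat ?(ltnW jK) //.
  by rewrite !mulr_ge0.
by apply: (le_trans (rem K (leqnn K))); rewrite le_eqVlt; apply/orP; left; apply/eqP; ring.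
Qed.

Lemma iter_evol_refine h B M K : 0 <= h -> (0 < K)%N ->
  mn (iter (M * K) (ev (h / K%:R)) B - iter M (ev h) B) <=
    M%:R * (lam * h) ^+ 2 * expR (lam * h) * expR (lam * (M%:R * h)) ^+ 2 * mn B.
Proof.
move=> h0 K0; have Kr : 0 < K%:R :> R by rewrite ltr0n.
have d0 : 0 <= h / K%:R by rewrite divr_ge0.
have Kd : K%:R * (h / K%:R) = h by rewrite mulrC divfK // gt_eqF.
have B0 := mn_ge0 B; have lh : 0 <= lam * h by rewrite mulr_ge0.
set d := h / K%:R in d0 Kd *.
have q1 : 1 <= 1 + lam * h by rewrite lerDl.
set e := (lam * h) ^+ 2 * expR (lam * h); set E := expR (lam * (M%:R * h)).
have e0 : 0 <= e by rewrite mulr_ge0 ?sqr_ge0 // expR_ge0.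
have E0 : 0 <= E by exact: expR_ge0.
suff H i : (i <= M)%N -> mn (iter (i * K) (ev d) B - iter i (ev h) B) <= i%:R * (e * (E * mn B)) * (1 + lam * h) ^+ i.
  apply: (le_trans (H M (leqnn M))).
  have := pow_le_expR M lh; rewrite mulrCA -/E => HE.
  apply: (@le_trans _ _ (M%:R * (e * (E * mn B)) * E)); first by rewrite ler_wpM2l // !mulr_ge0.
  by rewrite le_eqVlt; apply/orP; left; apply/eqP; rewrite /e; ring.
elim: i => [_|i IH iM]; first by rewrite subrr mn0 mul0r mul0r.
rewrite mulSn iterD iterS; set X := iter (i * K) _ B.
have -> : iter K (ev d) X - ev h (iter i (ev h) B) = (iter K (ev d) X - ev h X) + ev h (X - iter i (ev h) B).
  by rewrite evolB addrA subrK.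
apply: (le_trans (mnD _ _)).
have h1 : mn (iter K (ev d) X - ev h X) <= e * (E * mn B).
  have := iter_evol_block X K d0; rewrite Kd => /le_trans; apply; rewrite ler_wpM2l //.
  apply: (le_trans (iter_evol_exp B (i * K) d0)); rewrite ler_wpM2r // ler_expR ler_wpM2l //.
  by rewrite natrM -mulrA Kd ler_wpM2r // ler_nat ltnW.
have h2 := le_trans (evol_le G L (X - iter i (ev h) B) h0) (ler_wpM2l (le_trans ler01 q1) (IH (ltnW iM))).
have h3 : e * (E * mn B) <= e * (E * mn B) * (1 + lam * h) ^+ i.+1 by rewrite ler_peMr ?mulr_ge0 // exprn_ege1.
apply: (le_trans (lerD h1 h2)); rewrite -natr1 exprS in h3 *; lra.
Qed.
End evolution.

Section exact_weak_error.
Context {R : realType} {disp : measure_display} {Omega : measurableType disp}.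
Variable P : probability Omega R.
Variables (F : R -> set (set Omega)) (n m : nat) (W : 'I_n -> R -> Omega -> R).
Hypothesis usualF : usual_filtration P F.
Hypothesis BM : brownian P F W.
Variables (G : 'M[R]_m) (L : 'I_n -> 'M[R]_m) (ex : R -> 'M[R]_m) (T Cex : R).
Hypothesis T0 : 0 < T.
Hypothesis Cex0 : 0 <= Cex.
Hypothesis exP : forall h v, 0 <= h <= T ->
  nrm (ex h *m v - v - h *: (G *m v)) <= Cex * h ^+ 2 * nrm v.
Hypothesis dissip : forall z, dot z (lindblad G L 1%:M *m z) = 0.
Variables (Z0 : Omega -> 'cV[R]_m) (Z : R -> Omega -> 'cV[R]_m).
Hypothesis sol : real_solution P F W G L Z0 Z.
Hypothesis Z01 : forall w, unit0 (Z0 w).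
Local Notation lam := (growth G L).

Lemma Ex_quadB (X : Omega -> 'cV[R]_m) B B' : vadm measurable X -> (forall w, nrm (X w) <= 1) ->
  `|Ex P (fun w => quad B (X w)) - Ex P (fun w => quad B' (X w))| <= mn (B - B').
Proof.
move=> aX X1; rewrite -ExB; try exact: quad_L1.
rewrite -[leRHS](Ex_cst P); apply: Ex_abs_le; [by apply: L1B; exact: quad_L1|exact: L1_cst|].
by move=> w; rewrite /quad -dotBr -mulmxBl; exact: quad_le.
Qed.

(** The expectation of a quadratic form of the exact solution is, up to first
    order, given by the Euler iterates of its backward equation: insert the
    chain on a finer and finer subdivision of the mesh. *)
Lemma exact_weak : exists2 C, 0 <= C & forall B M, (0 < M)%N ->
  `|Ex P (fun w => quad B (Z T w)) - Ex P (fun w => quad (iter M (evol G L (T / M%:R)) B) (Z0 w))|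
    <= C * mn B * (T / M%:R).
Proof.
have [C1 C10 wk] := @weak_chain_Ex _ _ _ P m n G L ex T Cex T0 Cex0 exP dissip.
pose E := expR (lam * T); have E0 : 0 <= E by exact: expR_ge0.
have lam0 : 0 <= lam by exact: growth_ge0.
have g0 := gauss8_ge0 R; have g1 : 0 <= 1 + gauss8 :> R by rewrite addr_ge0.
exists (C1 * (1 + gauss8) * T * E + T * lam ^+ 2 * E ^+ 3) => [|B M M0].
  by nneg.
set h := T / M%:R; have Mr : 0 < M%:R :> R by rewrite ltr0n.
have h0 : 0 < h by rewrite divr_gt0.
have Mh : M%:R * h = T by rewrite mulrC divfK // gt_eqF.
apply/ler_addgt0Pr => e e0.
have [_ HN] := brown_chain_quad_cvg usualF BM T0 Cex0 exP dissip sol Z01 B.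
have [N0 {}HN] := HN e e0.
pose K := N0.+1; pose N := (M * K)%N.
have NK : (N0 <= N)%N by rewrite ltnW // leq_pmull.
have Npos : (0 < N)%N by rewrite muln_gt0 M0.
have {}HN := HN N NK Npos.
pose d := T / N%:R; have hN : d = h / K%:R by rewrite /d /h natrM invfM mulrA.
have d0 : 0 < d by rewrite divr_gt0 // ltr0n.
have dh : d <= h by rewrite hN ler_pdivrMr ?ltr0n // ler_peMr ?ler1n // ltW.
have hT : h <= T by rewrite ler_pdivrMr // ler_peMr ?ler1n // ltW.
have Nd : N%:R * d = T by rewrite mulrC divfK // gt_eqF // ltr0n.
have dT : 0 <= d <= T by rewrite (ltW d0) (le_trans dh).
have FF i : (i < N)%N -> F (mesh T N i) `<=` F (mesh T N i.+1) by move=> _; exact: (grid_mono usualF T0 Npos).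
have aZ0 : vadm (F (mesh T N 0)) Z0 by rewrite /mesh mul0r; exact: (rs_init sol).
have {}wk := wk gauss8 N (fun i => F (mesh T N i)) (fun i => incr W (mesh T N i) (mesh T N i.+1)) Z0 d
  g0 dT (fun i _ => grid_noise usualF BM T0 Npos i) FF (fun i k _ => incr_adm usualF BM T0 Npos i k) aZ0 Z01 N B (leqnn N).
have aZ0' : vadm measurable Z0 by apply: vadm_sub (rs_init sol); exact: (filt_meas usualF (lexx 0)).
have Z0n w : nrm (Z0 w) <= 1 by exact: unit0_nrm.
have ref := iter_evol_refine G L B M (ltW h0) (isT : (0 < K)%N).
rewrite -hN -/N Mh -/E in ref.
have qq := Ex_quadB (iter N (evol G L d) B) (iter M (evol G L h) B) aZ0' Z0n.
have B0 := mn_ge0 B.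
have pE : (1 + lam * d) ^+ N <= E.
  apply: (le_trans (pow_le_expR N (mulr_ge0 lam0 (ltW d0)))); rewrite ler_expR mulrCA Nd //.
have w1 : C1 * (1 + gauss8) * N%:R * d ^+ 2 * (1 + lam * d) ^+ N * mn B <= C1 * (1 + gauss8) * T * E * mn B * h.
  have -> : C1 * (1 + gauss8) * N%:R * d ^+ 2 * (1 + lam * d) ^+ N * mn B =
     C1 * (1 + gauss8) * (N%:R * d) * mn B * (d * (1 + lam * d) ^+ N) by ring.
  rewrite Nd; have -> : C1 * (1 + gauss8) * T * E * mn B * h = C1 * (1 + gauss8) * T * mn B * (h * E) by ring.
  apply: ler_wpM2l; first by nneg.
  by apply: ler_pM => //; rewrite ?(ltW d0) // exprn_ge0 // addr_ge0 // mulr_ge0 // ltW.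
have w2 : M%:R * (lam * h) ^+ 2 * expR (lam * h) * E ^+ 2 * mn B <= T * lam ^+ 2 * E ^+ 3 * mn B * h.
  have -> : M%:R * (lam * h) ^+ 2 * expR (lam * h) * E ^+ 2 * mn B = (M%:R * h) * lam ^+ 2 * E ^+ 2 * mn B * h * expR (lam * h) by ring.
  have -> : T * lam ^+ 2 * E ^+ 3 * mn B * h = T * lam ^+ 2 * E ^+ 2 * mn B * h * E by ring.
  rewrite Mh; apply: ler_wpM2l; first by nneg.
  by rewrite ler_expR ler_wpM2l.
set X1 := Ex P _ in HN *; set X2 := Ex P _ in HN wk; set X3 := Ex P _ in wk qq; set X4 := Ex P _ in qq *.
have -> : X1 - X4 = (X1 - X2) + ((X2 - X3) + (X3 - X4)) by ring.
apply: (le_trans (ler_normD _ _)); rewrite addrC; apply: lerD => //.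
apply: (le_trans (ler_normD _ _)); rewrite !mulrDl; apply: lerD; first exact: le_trans wk w1.
exact: le_trans qq (le_trans ref w2).
Qed.
End exact_weak_error.

(** * Real coordinates *)

Section real_coordinates.
Context {R : realType} {d : nat}.
Local Notation C := R[i].
Implicit Types (z y : 'cV[C]_d) (A B : 'M[C]_d).
Local Notation cRe := (@complex.Re R).
Local Notation cIm := (@complex.Im R).

(** Complex vectors as real vectors of double size, and the corresponding
    embedding of the algebra of complex matrices; the real part of the hermitian
    product is the Euclidean product. *)
Definition to_real z : 'cV[R]_(d + d) := col_mx (map_mx cRe z) (map_mx cIm z).
Definition realify A : 'M[R]_(d + d) :=
  block_mx (map_mx cRe A) (- map_mx cIm A) (map_mx cIm A) (map_mx cRe A).

Lemma to_real_l z k : to_real z (lshift d k) 0 = cRe (z k 0).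
Proof. by rewrite col_mxEu mxE. Qed.

Lemma to_real_r z k : to_real z (rshift d k) 0 = cIm (z k 0).
Proof. by rewrite col_mxEd mxE. Qed.

Lemma ReM (x y : C) : cRe (x * y) = cRe x * cRe y - cIm x * cIm y.
Proof. by case: x => a b; case: y. Qed.

Lemma ImM (x y : C) : cIm (x * y) = cRe x * cIm y + cIm x * cRe y.
Proof. by case: x => a b; case: y. Qed.

Lemma ReD (x y : C) : cRe (x + y) = cRe x + cRe y. Proof. by case: x; case: y. Qed.
Lemma ImD (x y : C) : cIm (x + y) = cIm x + cIm y. Proof. by case: x; case: y. Qed.
Lemma ReN (x : C) : cRe (- x) = - cRe x. Proof. by case: x. Qed.
Lemma ImN (x : C) : cIm (- x) = - cIm x. Proof. by case: x. Qed.
Lemma ReC (x : C) : cRe (x^*) = cRe x. Proof. by case: x. Qed.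
Lemma ImC (x : C) : cIm (x^*) = - cIm x. Proof. by case: x. Qed.

Lemma Re_sum (I : Type) (s : seq I) (Q : pred I) (f : I -> C) :
  cRe (\sum_(i <- s | Q i) f i) = \sum_(i <- s | Q i) cRe (f i).
Proof. by apply: (big_morph cRe ReD). Qed.

Lemma Im_sum (I : Type) (s : seq I) (Q : pred I) (f : I -> C) :
  cIm (\sum_(i <- s | Q i) f i) = \sum_(i <- s | Q i) cIm (f i).
Proof. by apply: (big_morph cIm ImD). Qed.

Lemma to_real_ext (u v : 'cV[R]_(d + d)) :
  (forall k, u (lshift d k) 0 = v (lshift d k) 0) ->
  (forall k, u (rshift d k) 0 = v (rshift d k) 0) -> u = v.
Proof.
move=> ul ur; apply/matrixP => i j; rewrite ord1.
by case: (split_ordP i) => k ->; [exact: ul|exact: ur].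
Qed.

Lemma to_realD z y : to_real (z + y) = to_real z + to_real y.
Proof. by apply: to_real_ext => k; rewrite [RHS]mxE !(to_real_l, to_real_r) mxE ?ReD ?ImD. Qed.

Lemma to_realN z : to_real (- z) = - to_real z.
Proof. by apply: to_real_ext => k; rewrite [RHS]mxE !(to_real_l, to_real_r) mxE ?ReN ?ImN. Qed.

Lemma to_realZ (r : R) z : to_real (r%:C%C *: z) = r *: to_real z.
Proof. by apply: to_real_ext => k; rewrite [RHS]mxE !(to_real_l, to_real_r) mxE ?ReM ?ImM /= mul0r ?subr0 ?addr0. Qed.

Lemma to_real0 : to_real 0 = 0.
Proof. by apply: to_real_ext => k; rewrite !(to_real_l, to_real_r) !mxE. Qed.

Lemma to_real_sum (I : Type) (s : seq I) (Q : pred I) (f : I -> 'cV[C]_d) :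
  to_real (\sum_(i <- s | Q i) f i) = \sum_(i <- s | Q i) to_real (f i).
Proof. by apply: (big_morph to_real to_realD to_real0). Qed.

Lemma to_realM A z : to_real (A *m z) = realify A *m to_real z.
Proof.
rewrite /to_real /realify mul_block_col; congr col_mx; apply/matrixP => i j; rewrite ord1 !mxE.
  by rewrite Re_sum -big_split /=; apply: eq_bigr => k _; rewrite !mxE ReM mulNr.
by rewrite Im_sum -big_split /=; apply: eq_bigr => k _; rewrite !mxE ImM addrC.
Qed.

Lemma realifyD A B : realify (A + B) = realify A + realify B.
Proof.
rewrite /realify add_block_mx; congr block_mx; apply/matrixP => i j; rewrite !mxE ?ReD ?ImD //.
by rewrite opprD.
Qed.

Lemma realifyZ (r : R) A : realify (r%:C%C *: A) = r *: realify A.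
Proof.
rewrite /realify scale_block_mx; congr block_mx; apply/matrixP => i j; rewrite !mxE ?ReM ?ImM /= mul0r ?subr0 ?addr0 //.
by rewrite mulrN.
Qed.

Lemma realify0 : realify 0 = 0.
Proof.
by rewrite /realify -block_mx0; congr block_mx; apply/matrixP => i j; rewrite !mxE ?oppr0.
Qed.

Lemma realify_sum (I : Type) (s : seq I) (Q : pred I) (f : I -> 'M[C]_d) :
  realify (\sum_(i <- s | Q i) f i) = \sum_(i <- s | Q i) realify (f i).
Proof. by apply: (big_morph realify realifyD realify0). Qed.

Lemma realifyM A B : realify (A *m B) = realify A *m realify B.
Proof.
rewrite /realify mulmx_block; congr block_mx; apply/matrixP => i j; rewrite !mxE;
  rewrite ?Re_sum ?Im_sum -?sumrN -big_split /=; apply: eq_bigr => k _;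
  rewrite !mxE ?ReM ?ImM; ring.
Qed.

Lemma realifyT A : realify (A ^t*) = (realify A)^T.
Proof.
rewrite /realify tr_block_mx; congr block_mx; apply/matrixP => i j; rewrite !mxE ?ReC ?ImC ?opprK //.
Qed.

Lemma Re_dotc z y : cRe (dotc z y) = dot (to_real z) (to_real y).
Proof.
rewrite /dotc Re_sum /dot big_split_ord /= -big_split /=; apply: eq_bigr => k _.
by rewrite !(to_real_l, to_real_r) ReM ReC ImC; ring.
Qed.

Lemma vnorm_nrm z : vnorm z = nrm (to_real z).
Proof. by rewrite /vnorm Re_dotc. Qed.

Lemma to_real_vproj z : to_real (vproj z) = sphproj (to_real z).
Proof.
rewrite /vproj; case: eqP => [->|_]; first by rewrite to_real0 sphproj0.
by rewrite to_realZ vnorm_nrm.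
Qed.

Lemma Re_quad B z : cRe (dotc z (B *m z)) = quad (realify B) (to_real z).
Proof. by rewrite Re_dotc to_realM. Qed.

Lemma dotcZ (c : C) z y : dotc z (c *: y) = c * dotc z y.
Proof. by rewrite /dotc mulr_sumr; apply: eq_bigr => k _; rewrite mxE; ring. Qed.

(** The imaginary part of an expectation is the real part for the observable
    [- 'i *: B]. *)
Lemma Im_quad B z : cIm (dotc z (B *m z)) = quad (realify (- 'i%C *: B)) (to_real z).
Proof.
rewrite -Re_quad -scalemxAl dotcZ ReM /= ; case: (dotc _ _) => a b /=; ring.
Qed.

Lemma normc_le (x : C) : Normc.normc x <= `|cRe x| + `|cIm x|.
Proof.
case: x => a b /=; rewrite -[leRHS]ger0_norm ?addr_ge0 // -sqrtr_sqr ler_wsqrtr //.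
rewrite sqrrD !real_normK ?num_real //; have := mulr_ge0 (normr_ge0 a) (normr_ge0 b); lra.
Qed.

Lemma frob_le B : frob B <= mn (realify B).
Proof.
have nc0 (x : C) : 0 <= Normc.normc x by case: x => a b; exact: sqrtr_ge0.
apply: (@le_trans _ _ (\sum_(k < d) \sum_(j < d) Normc.normc (B k j))).
  have s0 : 0 <= \sum_(k < d) \sum_(j < d) Normc.normc (B k j) by do 2 apply: sumr_ge0 => ? _.
  rewrite -[leRHS]ger0_norm // -sqrtr_sqr ler_wsqrtr //.
  have sq_sum (I : finType) (f : I -> R) : (forall i, 0 <= f i) -> \sum_i f i ^+ 2 <= (\sum_i f i) ^+ 2.
    move=> f0; rewrite [leRHS]expr2 mulr_suml; apply: ler_sum => i _.
    by rewrite expr2 ler_wpM2l // (bigD1 i) //= lerDl sumr_ge0.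
  apply: le_trans (sq_sum _ _ _); last by move=> k; apply: sumr_ge0.
  by apply: ler_sum => k _; exact: sq_sum.
rewrite /mn big_split_ord /= ; apply: (@le_trans _ _ (\sum_(k < d) \sum_(j < d + d) `|realify B (lshift d k) j|)); last first.
  by rewrite lerDl; do 2 apply: sumr_ge0 => ? _.
apply: ler_sum => k _; rewrite big_split_ord /= -big_split /=; apply: ler_sum => j _.
by rewrite /realify block_mxEul block_mxEur !mxE normrN; exact: normc_le.
Qed.

Context {n : nat}.
Variables (H : 'M[C]_d) (L : 'I_n -> 'M[C]_d).
Hypothesis H_sa : H ^t* = H.
Let Lr k := realify (L k).
Let Gr := realify (Gcoef H L).

Lemma to_real_Ecoef k z : to_real (Ecoef L k z) = dif Lr k (to_real z).
Proof. by rewrite /Ecoef to_realD to_realN to_realZ to_realM /Rell Re_quad. Qed.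

Lemma to_real_Dcoef z : to_real (Dcoef L z) = drD Lr (to_real z).
Proof.
rewrite /Dcoef to_real_sum; apply: eq_bigr => k _.
by rewrite to_realD to_realN !to_realZ to_realM /Rell Re_quad.
Qed.

Lemma to_real_drift z : to_real (Gcoef H L *m z + Dcoef L z) = dri Gr Lr (to_real z).
Proof. by rewrite to_realD to_realM to_real_Dcoef. Qed.

Definition real_exp (h : R) := realify (expmx (h%:C%C *: Gcoef H L)).

Lemma to_real_scheme h x z m :
  to_real (scheme H L h x z m) = chain Lr real_exp h x (to_real z) m.
Proof.
elim: m => [//|m IH] /=; rewrite to_real_vproj to_realM !to_realD !to_realZ to_real_Dcoef to_real_sum -IH.
rewrite /step; congr (sphproj (_ *m (_ + _ *: _))).
by apply: eq_bigr => k _; rewrite to_realZ to_real_Ecoef.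
Qed.

(** The backward evolution carried out on complex observables, since the
    hypothesis on the initial values only concerns these. *)
Definition lindbladC B := (Gcoef H L) ^t* *m B + B *m Gcoef H L + \sum_k (L k) ^t* *m B *m L k.
Definition evolC (h : R) B := B + h%:C%C *: lindbladC B.

Lemma real_lindblad B : realify (lindbladC B) = lindblad Gr Lr (realify B).
Proof.
rewrite /lindbladC !realifyD !realifyM realifyT realify_sum; congr (_ + _).
by apply: eq_bigr => k _; rewrite !realifyM realifyT.
Qed.

Lemma real_evol h B i : realify (iter i (evolC h) B) = iter i (evol Gr Lr h) (realify B).
Proof.
by elim: i => [//|i IH]; rewrite !iterS -IH /evol realifyD realifyZ real_lindblad.
Qed.

Lemma realify1 : realify 1%:M = 1%:M.
Proof.
rewrite /realify [RHS]scalar_mx_block; congr block_mx; apply/matrixP => i j; rewrite !mxE;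
  by case: (i == j); rewrite /= ?oppr0.
Qed.

(** The unitary part of the drift preserves the norm and the Lindblad terms
    compensate the noise. *)
Lemma dissipative (z : 'cV[R]_(d + d)) : dot z (lindblad Gr Lr 1%:M *m z) = 0.
Proof.
rewrite -realify1 -real_lindblad; suff -> : lindbladC 1%:M = 0 by rewrite realify0 mul0mx dot0r.
rewrite /lindbladC mulmx1 mul1mx; under eq_bigr do rewrite mulmx1.
rewrite /Gcoef; set S := \sum_k _.
have ST : S ^t* = S.
  rewrite /S; apply/matrixP => i j; rewrite !mxE !summxE rmorph_sum; apply: eq_bigr => k _.
  rewrite !mxE rmorph_sum; apply: eq_bigr => l _; rewrite !mxE rmorphM /= conjCK mulrC //.
have GT : (- ('i%C *: H) - 2%:R^-1 *: S) ^t* = 'i%C *: H - 2%:R^-1 *: S.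
  rewrite -[in RHS]H_sa -[in RHS]ST; apply/matrixP => i j; rewrite !mxE rmorphB rmorphN !rmorphM /=.
  congr (_ - _ * _).
    by rewrite -mulNr; congr (_ * _); apply/eqP; rewrite eq_complex /= oppr0 opprK !eqxx.
  by rewrite fmorphV rmorph_nat.
rewrite GT addrACA subrr add0r -opprD -scalerDl.
have -> : 2%:R^-1 + 2%:R^-1 = 1 :> C by rewrite -mulr2n -[LHS]mulr_natr mulVf // pnatr_eq0.
by rewrite scale1r addNr.
Qed.
End real_coordinates.

(** * The matrix exponential to first order *)

Section matrix_limits.
Context {K : numFieldType} {d : nat}.
Implicit Types (u : nat -> 'M[K]_d) (M : 'M[K]_d).

(** The exponential is defined as a limit in the space of complex matrices, which
    is here related to the real and imaginary parts of the entries. *)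
Lemma mx_cvg u M : (forall i j, (fun k => u k i j) @ \oo --> M i j) -> u @ \oo --> M.
Proof.
move=> H A [Q QM QA].
have : \forall k \near \oo, forall i j, Q i j (u k i j).
  by apply: filter_forall => i; apply: filter_forall => j; exact: (H i j _ (QM i j)).
by apply: filterS => k Hk; apply: QA; exact: Hk.
Qed.

Lemma cvg_coord u M i j : u @ \oo --> M -> (fun k => u k i j) @ \oo --> M i j.
Proof.
move=> uM B nB; apply: (uM [set N : 'M[K]_d | B (N i j)]).
exact: (@coord_continuous K d d i j M B nB).
Qed.
End matrix_limits.

Section complex_limits.
Context {R : realType}.
Local Notation C := (R[i] : numFieldType).
Local Notation cRe := (@complex.Re R).
Local Notation cIm := (@complex.Im R).

Lemma complex_norm (x : R[i]) : `|x| = (Normc.normc x)%:C%C.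
Proof. by case: x => a b; rewrite normc_def. Qed.

Lemma Re_le_normc (x : R[i]) : `|cRe x| <= Normc.normc x.
Proof.
case: x => a b /=; rewrite -sqrtr_sqr ler_wsqrtr // lerDl sqr_ge0 //.
Qed.

Lemma Im_le_normc (x : R[i]) : `|cIm x| <= Normc.normc x.
Proof. by case: x => a b /=; rewrite -sqrtr_sqr ler_wsqrtr // lerDr sqr_ge0. Qed.

Lemma cvg_complex (u : nat -> C) (c : C) :
  (fun k => cRe (u k)) @ \oo --> cRe c -> (fun k => cIm (u k)) @ \oo --> cIm c -> u @ \oo --> c.
Proof.
move=> /cvgrPdist_lt h1 /cvgrPdist_lt h2; apply/cvgrPdist_lt => e; case: e => a b.
rewrite ltcE /= => /andP[/eqP b0 a0]; rewrite b0 {b b0}.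
have a2 : 0 < a / 2 by rewrite divr_gt0.
near=> k; have k1 : `|cRe c - cRe (u k)| < a / 2 by near: k; exact: h1.
have k2 : `|cIm c - cIm (u k)| < a / 2 by near: k; exact: h2.
rewrite complex_norm ltcR; apply: (le_lt_trans (normc_le _)).
by rewrite ReD ImD ReN ImN; move: k1 k2; lra.
Unshelve. all: by end_near.
Qed.

Lemma cvg_Re_Im (u : nat -> C) (c : C) : u @ \oo --> c ->
  (fun k => cRe (u k)) @ \oo --> cRe c /\ (fun k => cIm (u k)) @ \oo --> cIm c.
Proof.
move=> /cvgrPdist_lt h; split; apply/cvgrPdist_lt => e e0.
  have := h e%:C%C; rewrite ltcR => /(_ e0); apply: filterS => k.
  rewrite complex_norm ltcR => /le_lt_trans; apply; apply: le_trans (Re_le_normc _).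
  by rewrite ReD ReN.
have := h e%:C%C; rewrite ltcR => /(_ e0); apply: filterS => k.
rewrite complex_norm ltcR => /le_lt_trans; apply; apply: le_trans (Im_le_normc _).
by rewrite ImD ImN.
Qed.
End complex_limits.

Lemma realifyN {R : realType} {d : nat} (A : 'M[R[i]]_d) : realify (- A) = - realify A.
Proof.
rewrite /realify opp_block_mx; congr block_mx; apply/matrixP => i j; rewrite !mxE ?ReN ?ImN //.
Qed.

Section exponential.
Context {R : realType} {d : nat}.
Local Notation C := R[i].
Local Notation cRe := (@complex.Re R).
Local Notation cIm := (@complex.Im R).
Variable A : 'M[C]_d.

Let S N : 'M[C]_d := series (fun k => (k`!%:R)^-1 *: A ^+ k) N.
Let r := mn (realify A).

Lemma mn_real_le (B : 'M[C]_d) i j : `|cRe (B i j)| <= mn (realify B) /\ `|cIm (B i j)| <= mn (realify B).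
Proof.
have H (B' : 'M[R]_(d + d)) i' j' : `|B' i' j'| <= mn B'.
  rewrite /mn (bigD1 i') //= (bigD1 j') //= -addrA lerDl addr_ge0 ?sumr_ge0 // => k _.
  by rewrite sumr_ge0.
by have := H (realify B) (lshift d i) (lshift d j); have := H (realify B) (rshift d i) (lshift d j);
  rewrite /realify block_mxEul block_mxEdl !mxE.
Qed.

Let c0 := 1 + mn (realify (1%:M : 'M[C]_d)).

Lemma mn_pow k : mn (realify (A ^+ k)) <= c0 * r ^+ k.
Proof.
have m1 := mn_ge0 (realify (1%:M : 'M[C]_d)).
elim: k => [|k IH]; first by rewrite !expr0 mulr1 lerDr.
have -> : A ^+ k.+1 = A *m A ^+ k by rewrite exprS.
rewrite realifyM exprS; apply: (le_trans (mnM _ _)).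
by rewrite mulrCA ler_wpM2l ?mn_ge0.
Qed.

Lemma real_term k : realify ((k`!%:R)^-1 *: A ^+ k) = (k`!%:R)^-1 *: realify (A ^+ k).
Proof.
rewrite -realifyZ; congr (realify (_ *: _)).
by rewrite fmorphV rmorph_nat.
Qed.

Lemma term_le k : mn (realify ((k`!%:R)^-1 *: A ^+ k)) <= c0 * exp_coeff r k.
Proof.
rewrite real_term mnZ ger0_norm ?invr_ge0 // /exp_coeff /= mulrC mulrA.
by rewrite ler_wpM2r ?invr_ge0 // mn_pow.
Qed.

Lemma cvg_part (p : C -> R) : (forall x y, p (x + y) = p x + p y) -> p 0 = 0 ->
  (forall (B : 'M[C]_d) i j, `|p (B i j)| <= mn (realify B)) ->
  forall i j, cvgn (fun N => p (S N i j)).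
Proof.
move=> pD p0 pB i j; have r0 : 0 <= r by exact: mn_ge0.
pose f k := p (((k`!%:R)^-1 *: A ^+ k) i j).
have -> : (fun N => p (S N i j)) = series f.
  by apply/funext => N; rewrite /S /series /= summxE (big_morph p pD p0).
apply: normed_cvg.
have c00 : 0 <= c0 by rewrite addr_ge0 // mn_ge0.
apply: (@series_le_cvg R _ (c0 *: exp_coeff r)).
- by move=> k; exact: normr_ge0.
- by move=> k; rewrite /= mulr_ge0 // exp_coeff_ge0.
- by move=> k; apply: (le_trans (pB _ _ _)); exact: term_le.
- by apply: is_cvg_seriesZ; exact: is_cvg_series_exp_coeff.
Qed.

Lemma expmx_cvg : (S : nat -> 'M[(C : numFieldType)]_d) @ \oo --> (expmx A : 'M[(C : numFieldType)]_d).
Proof.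
have cR := cvg_part (@ReD R) erefl (fun B i j => (mn_real_le B i j).1).
have cI := cvg_part (@ImD R) erefl (fun B i j => (mn_real_le B i j).2).
pose E : 'M[C]_d := \matrix_(i, j) (limn (fun N => cRe (S N i j)) +i* limn (fun N => cIm (S N i j)))%C.
have SE : (S : nat -> 'M[(C : numFieldType)]_d) @ \oo --> (E : 'M[(C : numFieldType)]_d).
  apply: mx_cvg => i j; apply: cvg_complex; rewrite mxE /=; [exact: cR|exact: cI].
exact: (cvgP _ SE).
Qed.

(** Comparison with the exponential series of the norm. *)
Lemma exp_tail N : mn (realify (S N.+2 - 1%:M - A)) <= c0 * r ^+ 2 * expR r.
Proof.
have r0 : 0 <= r by exact: mn_ge0.
have c00 : 0 <= c0 by rewrite addr_ge0 // mn_ge0.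
have -> : S N.+2 - 1%:M - A = \sum_(k < N) (k.+2`!%:R)^-1 *: A ^+ k.+2.
  rewrite /S /series /= big_mkord !big_ord_recl /= !fact0 expr0 expr1.
  have -> : (bump 0 0)`! = 1%N by [].
  have gen (x y z : 'M[C]_d) : x + (y + z) - x - y = z.
    by rewrite [x + _]addrC addrK [y + _]addrC addrK.
  by rewrite invr1 !scale1r gen.
have ek k : exp_coeff r k.+2 <= r ^+ 2 * exp_coeff r k.
  rewrite /exp_coeff /= -[k.+2]addn2 exprD mulrAC [leRHS]mulrC ler_wpM2r ?sqr_ge0 //.
  rewrite ler_wpM2l ?exprn_ge0 // lef_pV2 ?posrE ?ltr0n ?fact_gt0 // ler_nat addn2 !factS.
  by rewrite mulnA leq_pmull.
apply: (@le_trans _ _ (c0 * (r ^+ 2 * series (exp_coeff r) N))).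
  rewrite realify_sum; apply: (le_trans (mn_sum _ _ _)).
  rewrite /series /= big_mkord !mulr_sumr; apply: ler_sum => k _.
  by apply: (le_trans (term_le _)); rewrite ler_wpM2l.
rewrite -mulrA !ler_wpM2l ?sqr_ge0 // /expR.
apply: nondecreasing_cvgn_le; last exact: is_cvg_series_exp_coeff.
by apply: nondecreasing_series => k _ _; exact: exp_coeff_ge0.
Qed.

Lemma exp_close i j : `|cRe ((expmx A - 1%:M - A) i j)| <= c0 * r ^+ 2 * expR r /\
  `|cIm ((expmx A - 1%:M - A) i j)| <= c0 * r ^+ 2 * expR r.
Proof.
have lim (x : nat -> R) (l c b : R) : x @ \oo --> l -> (forall N, `|x N.+2 - c| <= b) -> `|l - c| <= b.
  move=> /cvgrPdist_lt xl xb; apply/ler_addgt0Pr => e e0.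
  have [N0 _ HN] := xl e e0; have := HN N0.+2 (leq_trans (leqnSn _) (leqnSn _)) => /= h1.
  have -> : l - c = (x N0.+2 - c) + (l - x N0.+2) by ring.
  by apply: (le_trans (ler_normD _ _)); rewrite lerD // ltW.
have [cR cI] := cvg_Re_Im (@cvg_coord _ _ _ _ i j expmx_cvg).
have tail N := mn_real_le (S N.+2 - 1%:M - A) i j.
split; [have := lim _ _ (cRe ((1%:M + A) i j)) (c0 * r ^+ 2 * expR r) cR
       |have := lim _ _ (cIm ((1%:M + A) i j)) (c0 * r ^+ 2 * expR r) cI];
  rewrite !mxE ?ReD ?ImD ?ReN ?ImN -!addrA -?opprD; apply=> N; apply: le_trans (exp_tail N);
  case: (tail N); rewrite !mxE ?ReD ?ImD ?ReN ?ImN -!addrA -?opprD //.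
Qed.

Lemma real_exp_close : mn (realify (expmx A - 1%:M - A)) <=
  (d + d)%:R ^+ 2 * (c0 * r ^+ 2 * expR r).
Proof.
rewrite /mn; apply: (@le_trans _ _ (\sum_(i < d + d) \sum_(j < d + d) (c0 * r ^+ 2 * expR r))).
  apply: ler_sum => i _; apply: ler_sum => j _.
  case: (split_ordP i) => i' ->; case: (split_ordP j) => j' ->; have [h1 h2] := exp_close i' j';
   rewrite /realify ?block_mxEul ?block_mxEur ?block_mxEdl ?block_mxEdr !mxE ?normrN in h1 h2 *; done.
by rewrite !sumr_const !card_ord -mulrnA -[leLHS]mulr_natl natrM expr2.
Qed.
End exponential.

Section exponential_step.
Context {R : realType} {d n : nat}.
Variables (H : 'M[R[i]]_d) (L : 'I_n -> 'M[R[i]]_d) (T : R).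

Lemma real_exp_step : exists2 c, 0 <= c & forall h v, 0 <= h <= T ->
  nrm (real_exp H L h *m v - v - h *: (realify (Gcoef H L) *m v)) <= c * h ^+ 2 * nrm v.
Proof.
set g := mn (realify (Gcoef H L)); have g0 : 0 <= g by exact: mn_ge0.
set k := 1 + mn (realify (1%:M : 'M[R[i]]_d)).
have k0 : 0 <= k by rewrite addr_ge0 // mn_ge0.
exists ((d + d)%:R ^+ 2 * (k * g ^+ 2 * expR (T * g))) => [|h v /andP[h0 hT]].
  by nneg; exact: expR_ge0.
have -> : real_exp H L h *m v - v - h *: (realify (Gcoef H L) *m v) =
   realify (expmx (h%:C%C *: Gcoef H L) - 1%:M - h%:C%C *: Gcoef H L) *m v.
  rewrite /real_exp; set X := expmx _; set Y := Gcoef H L; clearbody X Y.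
  by rewrite !realifyD !realifyN realifyZ realify1 !mulmxDl !mulNmx mul1mx -scalemxAl.
apply: (le_trans (nrmM _ _)); rewrite ler_wpM2r ?nrm_ge0 //.
apply: (le_trans (real_exp_close _)); rewrite realifyZ mnZ ger0_norm // -/g -/k -[leRHS]mulrA ler_wpM2l ?sqr_ge0 //.
rewrite exprMn; have -> : k * (h ^+ 2 * g ^+ 2) * expR (h * g) = k * g ^+ 2 * h ^+ 2 * expR (h * g) by ring.
have -> : k * g ^+ 2 * expR (T * g) * h ^+ 2 = k * g ^+ 2 * h ^+ 2 * expR (T * g) by ring.
by rewrite ler_wpM2l ?mulr_ge0 ?sqr_ge0 // ler_expR ler_wpM2r.
Qed.
End exponential_step.

(** * The noise of the scheme *)

Section discrete_noise.
Context {R : realType} {disp : measure_display} {Omega : measurableType disp}.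
Variable P : probability Omega R.

(** Indices outside the image of [f] are given the trivial event. *)
Lemma indep_rvs_inj (I J : finType) (X : I -> Omega -> R) (f : J -> I) : injective f ->
  indep_rvs P X -> indep_rvs P (fun j => X (f j)).
Proof.
move=> fI iX B mB; pose B' i := if [pick j | f j == i] is Some j then B j else setT.
have B'f j : B' (f j) = B j.
  rewrite /B'; case: pickP => [j' /eqP /fI -> //|/(_ j)]; by rewrite eqxx.
have B'n i : i \notin codom f -> B' i = setT.
  by move=> ni; rewrite /B'; case: pickP => [j /eqP fj|//]; move: ni; rewrite -fj codom_f.
have mB' i : measurable (B' i) by rewrite /B'; case: pickP => [j _|_] //; exact: mB.
have := iX B' mB'.
have -> : \bigcap_(i in [set: I]) X i @^-1` B' i = \bigcap_(j in [set: J]) X (f j) @^-1` B j.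
  apply/seteqP; split => w /= H.
    by move=> j _; have := H (f j) Logic.I; rewrite /= B'f.
  move=> i _ /=; have [/codomP[j ->]|ni] := boolP (i \in codom f); first by rewrite B'f; exact: H.
  by rewrite B'n.
move=> ->; rewrite (bigID (fun i => i \in codom f)) /= [X in (_ * X)%E]big1 ?mule1; last first.
  by move=> i ni; rewrite B'n // preimage_setT probability_setT.
rewrite (reindex_omap f (fun i => [pick j | f j == i])); last first.
  move=> i /codomP[j ->]; case: pickP => [j' /eqP <- //|/(_ j)]; by rewrite eqxx.
apply: eq_big => [j|j _]; last by rewrite B'f.
by rewrite codom_f /=; case: pickP => [j' /eqP /fI ->|/(_ j)]; rewrite ?eqxx.
Qed.

Section past.
Variables (I0 : Type) (X0 : I0 -> Omega -> R) (M : nat) (n : nat) (xi : nat -> 'I_n -> Omega -> R).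
Hypothesis mX0 : forall i, measurable_fun setT (X0 i).
Hypothesis mxi : forall m k, measurable_fun setT (xi m k).
Let xiM (mk : 'I_M * 'I_n) w := xi mk.1 mk.2 w.
Hypothesis xiM_rvs : indep_rvs P xiM.
Hypothesis X0_indep : indep_sys P (sigma_gen X0) (sigma_gen xiM).

Definition before (m : nat) := {mk : 'I_M * 'I_n | (mk.1 < m)%N}.
Definition past_noise m := sigma_gen (fun b : before m => xiM (val b)).

(** The pi-system generating the information of the scheme before step [m]. *)
Definition past_gen m : set (set Omega) :=
  [set A | exists B B', [/\ sigma_gen X0 B, past_noise m B' & A = B `&` B']].
Definition past m := <<s past_gen m >>.

Let sgI (J : Type) (Y : J -> Omega -> R) A B : sigma_gen Y A -> sigma_gen Y B -> sigma_gen Y (A `&` B).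
Proof. exact: sa_setI (sigma_gen_sa Y). Qed.

Let sgT (J : Type) (Y : J -> Omega -> R) : sigma_gen Y setT.
Proof. by case: (sigma_gen_sa Y) => s0 sC _; have := sC _ s0; rewrite setD0. Qed.

Lemma past_gen_meas m : past_gen m `<=` measurable.
Proof.
move=> _ [B [B' [sB sB' ->]]]; apply: measurableI.
  exact: (sigma_gen_meas mX0 sB).
by apply: (sigma_gen_meas _ sB') => b; exact: mxi.
Qed.

Lemma past_sa m : sigma_algebra setT (past m).
Proof. exact: smallest_sigma_algebra. Qed.

Lemma past_meas m : past m `<=` measurable.
Proof. by apply: smallest_sub; [exact: sigma_algebra_measurable|exact: past_gen_meas]. Qed.

Lemma past_init m : sigma_gen X0 `<=` past m.
Proof.
move=> A sA; apply: sub_sigma_algebra; exists A, setT; split=> //; last by rewrite setIT.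
exact: sgT.
Qed.

Lemma past_noise_sub m : past_noise m `<=` past m.
Proof.
move=> A sA; apply: sub_sigma_algebra; exists setT, A; split=> //; rewrite ?setTI //.
Qed.

Lemma past_xi m m' k : (m' < m)%N -> (m <= M)%N -> adm (past m) (xi m' k).
Proof.
move=> mm mM; apply: (adm_sub (@past_noise_sub m)).
have mk : ((Ordinal (leq_trans mm mM), k).1 < m)%N by [].
exact: (sigma_gen_adm (fun b : before m => xiM (val b)) (exist _ (Ordinal (leq_trans mm mM), k) mk)).
Qed.

Lemma past_S m : past m `<=` past m.+1.
Proof.
apply: sub_sigma_algebra2 => _ [B [B' [sB sB' ->]]]; exists B, B'; split=> //.
move: B' sB'; apply: sigma_gen_min; first exact: sigma_gen_sa.
move=> [mk mkm]; have mkS : (mk.1 < m.+1)%N by exact: leqW.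
exact: (sigma_gen_adm (fun b : before m.+1 => xiM (val b)) (exist _ mk mkS)).
Qed.

(** The initial value is independent of all the noise, and the noise of step [m] of
    the earlier noise. *)
Lemma past_indep m (mM : (m < M)%N) : indep_sys P (past m) (sigma_gen (xi m)).
Proof.
have sE : <<s sigma_gen (xi m) >> = sigma_gen (xi m) by rewrite sigma_algebra_id //; exact: sigma_gen_sa.
rewrite -sE; apply: indep_sys_gen.
- move=> _ _ [B [B' [sB sB' ->]]] [C [C' [sC sC' ->]]]; exists (B `&` C), (B' `&` C'); split.
  + exact: sgI.
  + exact: sgI.
  + by rewrite setIACA.
- by move=> A B; exact: sgI.
- exact: past_gen_meas.
- by apply: sigma_gen_meas => k; exact: mxi.
move=> _ E [B [B' [sB sB' ->]]] sE'.
have sub : past_noise m `<=` sigma_gen xiM.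
  apply: sigma_gen_min; first exact: sigma_gen_sa.
  by move=> b; exact: (sigma_gen_adm xiM (val b)).
have sub' : sigma_gen (xi m) `<=` sigma_gen xiM.
  apply: sigma_gen_min; first exact: sigma_gen_sa.
  by move=> k; exact: (sigma_gen_adm xiM (Ordinal mM, k)).
have ind : indep_sys P (past_noise m) (sigma_gen (xi m)).
  apply: (@indep_rvs_groups _ _ _ P _ xiM (fun mk => (mk.1 < m)%N) (fun mk => nat_of_ord mk.1 == m)
    (before m) 'I_n val (fun k => (Ordinal mM, k))) => //.
  - by move=> mk; exact: mxi.
  - by move=> mk /= lt /eqP e; move: lt; rewrite e ltnn.
  - by case.
rewrite -setIA X0_indep //; last by apply: sgI; [exact: sub|exact: sub'].
have -> : P (B `&` B') = (P B * P B')%E by apply: X0_indep => //; exact: sub.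
by rewrite ind // muleA.
Qed.

Variable nu : probability R R.
Hypothesis nuP : noise_law nu.
Hypothesis xi_law : forall m k, (m < M)%N -> forall B : set R, measurable B -> P (xi m k @^-1` B) = nu B.

Definition nu8 := Ex nu (fun x => x ^+ 8).

Lemma nu8_ge0 : 0 <= nu8.
Proof. by apply: Ex_ge0 => x; exact: (@exprn_even_ge0 _ 8). Qed.

Lemma past_is_noise m : (m < M)%N -> noise P (past m) (xi m) nu8.
Proof.
case: nuP => sym var int mM.
have mom (f : R -> R) k : L1 nu f -> L1 P (fun w => f (xi m k w)) /\ Ex P (fun w => f (xi m k w)) = Ex nu f.
  by apply: Ex_law; [exact: mxi|exact: xi_law].
have i1 : L1 nu (fun x => x).
  by have := int 1%N; rewrite /L1; apply: eq_integrable => // x _ /=; rewrite expr1.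
have e1 : Ex nu (fun x => x) = 0 by exact: Ex_odd.
split.
- exact: past_sa.
- exact: past_meas.
- exact: mxi.
- exact: past_indep.
- apply: (@indep_rvs_inj _ _ xiM (fun k => (Ordinal mM, k))) => //.
  by move=> k k' [].
- by move=> k; case: (mom (fun x => x ^+ 8) k (int 8%N)).
- by move=> k; case: (mom (fun x => x ^+ 8) k (int 8%N)) => _ ->.
- by move=> k; case: (mom (fun x => x) k i1) => _ ->.
- move=> k; case: (mom (fun x => x ^+ 2) k (int 2%N)) => _ ->.
  move: var; rewrite /variance unlock => /(congr1 fine) /= <-.
  have c0 : fine 'E_nu[(fun x : R => x)] = 0 by rewrite ExE; exact: e1.
  rewrite c0 ExE; congr Ex; apply/funext => x /=.
  by rewrite /GRing.mul /= !subr0 expr2.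
- move=> k; case: (mom (fun x => x ^+ 3) k (int 3%N)) => _ ->.
  by apply: Ex_odd => //; [exact: (int 3%N)|move=> x; rewrite !exprS expr0; ring].
Qed.
End past.
End discrete_noise.

(** * From complex to real coordinates *)

Section sphere_values.
Context {R : realType} {disp : measure_display} {Omega : measurableType disp} {d : nat}.
Variable P : probability Omega R.
Implicit Types (X : Omega -> 'cV[R[i]]_d) (B : 'M[R[i]]_d).

Lemma to_real_adm F X : (forall i, adm F (fun w => rcoord i (X w))) -> vadm F (fun w => to_real (X w)).
Proof.
move=> aX i; case: (split_ordP i) => k ->.
  by under eq_fun do rewrite to_real_l; exact: (aX (k, false)).
by under eq_fun do rewrite to_real_r; exact: (aX (k, true)).
Qed.

(** The initial values have unit norm only almost surely; this version satisfies
    [unit0] everywhere. *)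
Definition on_sphere X w : 'cV[R]_(d + d) :=
  (\1_[set w' | vnorm (X w') = 1] w : R) *: to_real (X w).

Lemma on_sphere_unit0 X w : unit0 (on_sphere X w).
Proof.
rewrite /on_sphere indicE; have [|_] := boolP (w \in _); last by right; rewrite scale0r.
by rewrite inE /= vnorm_nrm => nX; left; rewrite scale1r -nrm_sqr nX expr1n.
Qed.

Lemma on_sphere_ae X : {ae P, forall w, vnorm (X w) = 1} ->
  {ae P, forall w, on_sphere X w = to_real (X w)}.
Proof. by apply: filterS => w nX; rewrite /on_sphere indicE mem_set // scale1r. Qed.

Lemma on_sphere_adm F X : sigma_algebra setT F -> (forall i, adm F (fun w => rcoord i (X w))) ->
  vadm F (on_sphere X).
Proof.
move=> sF aX; have aI := to_real_adm aX.
apply: (vclZ (@admM _ _ _ F)) => //; apply: adm_indic.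
have := (admP _ sF).1 (adm_nrm aI) [set 1] (measurable_set1 _).
by congr F; apply/seteqP; split => w /=; rewrite vnorm_nrm.
Qed.

Lemma cexpect_quad B X : cexpect P (fun w => dotc (X w) (B *m X w)) =
  (Ex P (fun w => quad (realify B) (to_real (X w)))
   +i* Ex P (fun w => quad (realify (- 'i%C *: B)) (to_real (X w))))%C.
Proof.
rewrite /cexpect !ExE; congr (Ex P _ +i* Ex P _)%C; apply/funext => w.
  exact: Re_quad.
exact: Im_quad.
Qed.

End sphere_values.

Section real_equation.
Context {R : realType} {disp : measure_display} {Omega : measurableType disp}.
Variables (P : probability Omega R) (F : R -> set (set Omega)) (n d : nat).
Variables (W : 'I_n -> R -> Omega -> R) (H : 'M[R[i]]_d) (L : 'I_n -> 'M[R[i]]_d).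
Hypothesis usualF : usual_filtration P F.
Variables (Z0 : Omega -> 'cV[R[i]]_d) (Z : R -> Omega -> 'cV[R[i]]_d).
Hypothesis Z0_meas : forall i, meas_wrt (F 0) (fun w => rcoord i (Z0 w)).
Hypothesis Z0_norm : {ae P, forall w, vnorm (Z0 w) = 1}.
Hypothesis solZ : sde_solution P F W H L Z0 Z.

Lemma init_adm i : adm (F 0) (fun w => rcoord i (Z0 w)).
Proof. by apply/(admP _ (filt_sa usualF (lexx 0))); exact: Z0_meas. Qed.

Lemma real_equation : real_solution P F W (realify (Gcoef H L)) (fun k => realify (L k))
  (on_sphere Z0) (fun t w => to_real (Z t w)).
Proof.
pose idx (i : 'I_(d + d)) := match fintype.split i with inl k => (k, false) | inr k => (k, true) end.
have idxE z i : to_real z i 0 = rcoord (idx i) z.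
  rewrite /idx; case: splitP => k kE.
    by rewrite (_ : i = lshift d k) ?to_real_l //; apply: val_inj.
  by rewrite (_ : i = rshift d k) ?to_real_r //; apply: val_inj.
case: solZ => aZ cZ eqZ; split.
- by apply: on_sphere_adm; [exact: (filt_sa usualF (lexx 0))|exact: init_adm].
- move=> t t0; apply: to_real_adm => i; apply/(admP _ (filt_sa usualF t0)); exact: aZ.
- apply: filterS cZ => w cw i.
  have -> : (fun t => to_real (Z t w) i 0) = (fun t => rcoord (idx i) (Z t w)) by apply/funext => t; exact: idxE.
  exact: (cw (idx i)).
move=> t t0; have [J [itoJ eqJ]] := eqZ t t0.
exists (fun k i => J k (idx i)); split=> [k i|].
  have := itoJ k (idx i); congr (ito_integral P F _ _ _ _).
  by apply/funext => s; apply/funext => w; rewrite -idxE to_real_Ecoef.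
apply: filterS2 (on_sphere_ae Z0_norm) eqJ => w s0 eJ i.
rewrite s0 !idxE eJ; congr (_ + _ + _); congr Rintegral.
by apply/funext => s; rewrite -idxE to_real_drift.
Qed.
End real_equation.

(** * The weak error in real coordinates *)

Section real_weak_error.
Context {R : realType} {disp : measure_display} {Omega : measurableType disp}.
Variables (P : probability Omega R) (F : R -> set (set Omega)) (n d : nat).
Hypothesis usualF : usual_filtration P F.
Variable W : 'I_n -> R -> Omega -> R.
Hypothesis BM : brownian P F W.
Variable T : R.
Hypothesis T0 : 0 < T.
Variables (H : 'M[R[i]]_d) (L : 'I_n -> 'M[R[i]]_d).
Hypothesis H_sa : H ^t* = H.
Variables (Z0 : Omega -> 'cV[R[i]]_d) (Z : R -> Omega -> 'cV[R[i]]_d).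
Hypothesis Z0_meas : forall i, meas_wrt (F 0) (fun w => rcoord i (Z0 w)).
Hypothesis Z0_norm : {ae P, forall w, vnorm (Z0 w) = 1}.
Hypothesis solZ : sde_solution P F W H L Z0 Z.
Variable nu : probability R R.
Hypothesis nuP : noise_law nu.
Variable xi : nat -> nat -> 'I_n -> {RV P >-> R}.
Hypothesis xi_law : forall M m k, (m < M)%N ->
  forall B : set R, measurable B -> distribution P (xi M m k) B = nu B.
Hypothesis xi_indep : forall M, indep_rvs P (fun (mk : 'I_M * 'I_n) w => xi M mk.1 mk.2 w).
Variable Zh0 : nat -> Omega -> 'cV[R[i]]_d.
Hypothesis Zh0_meas : forall M i, (0 < M)%N -> measurable_fun setT (fun w => rcoord i (Zh0 M w)).
Hypothesis Zh0_norm : forall M, (0 < M)%N -> {ae P, forall w, vnorm (Zh0 M w) = 1}.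
Hypothesis Zh0_indep : forall M, (0 < M)%N ->
  indep_sys P (sigma_gen (fun (i : 'I_d * bool) w => rcoord i (Zh0 M w)))
    (sigma_gen (fun (mk : 'I_M * 'I_n) w => xi M mk.1 mk.2 w)).
Let Zh M m w := scheme H L (T / M%:R) (fun m' k => xi M m' k w) (Zh0 M w) m.
Variable K : R.
Hypothesis K0 : 0 < K.
Hypothesis init_error : forall (B : 'M[R[i]]_d) (M : nat), (0 < M)%N ->
  Normc.normc (cexpect P (fun w => dotc (Z0 w) (B *m Z0 w))
               - cexpect P (fun w => dotc (Zh0 M w) (B *m Zh0 M w)))
    <= frob B * K * (T / M%:R).

Let G := realify (Gcoef H L).
Let Lr k := realify (L k).
Let ex := real_exp H L.
Let qE B (X : Omega -> 'cV[R[i]]_d) := Ex P (fun w => quad (realify B) (to_real (X w))).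

Lemma step_size M : (0 < M)%N -> 0 < T / M%:R <= T /\ M%:R * (T / M%:R) = T.
Proof.
move=> M0; have Mr : 0 < M%:R :> R by rewrite ltr0n.
split; last by rewrite mulrC divfK // gt_eqF.
by rewrite divr_gt0 //= ler_pdivrMr // ler_peMr ?ler1n // ltW.
Qed.

Lemma init_quad B M : (0 < M)%N -> `|qE B Z0 - qE B (Zh0 M)| <= mn (realify B) * K * (T / M%:R).
Proof.
move=> M0; have [/andP[h0 _] _] := step_size M0.
apply: (@le_trans _ _ (frob B * K * (T / M%:R))); last first.
  by rewrite -!mulrA ler_wpM2r ?frob_le // mulr_ge0 // ltW.
by apply: le_trans (init_error B M0); rewrite !cexpect_quad; apply: le_trans (Re_le_normc _).
Qed.

(** Two initial values that agree almost surely give the same expectations, so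
    the chain may be started from [on_sphere (Zh0 M)]. *)
Lemma scheme_quad : exists2 C, 0 <= C & forall B M, (0 < M)%N ->
  `|qE B (Zh M M) - qE (iter M (evolC H L (T / M%:R)) B) (Zh0 M)| <= C * mn (realify B) * (T / M%:R).
Proof.
have [Cex Cex0 exP] := real_exp_step H L T.
have [C C0 wk] := @weak_chain_Ex _ _ _ P _ _ G Lr ex T Cex T0 Cex0 exP (dissipative L H_sa).
pose lam := growth G Lr; have lam0 : 0 <= lam by exact: growth_ge0.
have c0 := nu8_ge0 nu.
exists (C * (1 + nu8 nu) * T * expR (lam * T)) => [|B M M0].
  by nneg; exact: expR_ge0.
have [/andP[h0 hT] Mh] := step_size M0; set h := T / M%:R in h0 hT Mh *.
pose X0 (i : 'I_d * bool) w := rcoord i (Zh0 M w).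
have mX0 i : measurable_fun setT (X0 i) by exact: Zh0_meas.
have mxi m k : measurable_fun setT (xi M m k) by exact: measurable_funPT.
pose Fm := past X0 M (fun m k => xi M m k : Omega -> R).
have aX0 i : adm (Fm 0%N) (X0 i) by apply: adm_sub (sigma_gen_adm X0 i); exact: past_init.
have nz i : (i < M)%N -> noise P (Fm i) (xi M i) (nu8 nu).
  move=> iM; apply: (past_is_noise mX0 mxi (@xi_indep M) (Zh0_indep M0) nuP _ iM) => m k mM B0 mB0; exact: (@xi_law M m k mM B0 mB0).
have FF i : (i < M)%N -> Fm i `<=` Fm i.+1 by move=> _; exact: past_S.
have ax i k : (i < M)%N -> adm (Fm i.+1) (xi M i k) by move=> iM; exact: past_xi.
have aY0 : vadm (Fm 0%N) (on_sphere (Zh0 M)) by apply: on_sphere_adm; [exact: past_sa|exact: aX0].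
have sub i : Fm i `<=` measurable by apply: past_meas.
have {}wk := wk (nu8 nu) M Fm (fun m k => xi M m k : Omega -> R) (on_sphere (Zh0 M)) h c0
  (introT andP (conj (ltW h0) hT)) nz FF ax aY0 (on_sphere_unit0 (Zh0 M)) M (realify B).
have aeZ := on_sphere_ae (Zh0_norm M0).
have aI : vadm (Fm 0%N) (fun w => to_real (Zh0 M w)) by apply: to_real_adm.
have swap B' : Ex P (fun w => quad (realify B') (on_sphere (Zh0 M) w)) = qE B' (Zh0 M).
  apply: Ex_ae; try by apply: quad_meas; apply: vadm_sub (sub 0%N) _.
  by apply: filterS aeZ => w ->.
have swapM : Ex P (fun w => quad (realify B) (chain Lr ex h (fun j k => xi M j k w) (on_sphere (Zh0 M) w) M))
    = qE B (Zh M M).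
  have mc (Y0 : Omega -> 'cV[R]_(d + d)) : vadm (Fm 0%N) Y0 ->
      vadm measurable (fun w => chain Lr ex h (fun j k => xi M j k w) (Y0 w) M).
    by move=> aY; apply: vadm_sub (sub M) _; exact: (vadm_chain Lr ex h FF ax aY (leqnn M)).
  have eZ w : to_real (Zh M M w) = chain Lr ex h (fun j k => xi M j k w) (to_real (Zh0 M w)) M.
    exact: to_real_scheme.
  rewrite /qE; under [X in _ = Ex P X]eq_fun do rewrite eZ.
  apply: Ex_ae; try by apply: quad_meas; exact: mc.
  by apply: filterS aeZ => w ->.
move: (wk (leqnn M)); rewrite swapM -real_evol swap => /le_trans; apply.
have pE : (1 + lam * h) ^+ M <= expR (lam * T).
  by apply: (le_trans (pow_le_expR M (mulr_ge0 lam0 (ltW h0)))); rewrite mulrCA Mh.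
rewrite -/lam; have -> : C * (1 + nu8 nu) * M%:R * h ^+ 2 * (1 + lam * h) ^+ M * mn (realify B) =
  C * (1 + nu8 nu) * (M%:R * h) * mn (realify B) * h * (1 + lam * h) ^+ M by ring.
rewrite Mh; have -> : C * (1 + nu8 nu) * T * expR (lam * T) * mn (realify B) * h =
  C * (1 + nu8 nu) * T * mn (realify B) * h * expR (lam * T) by ring.
by apply: ler_wpM2l => //; nneg.
Qed.

Lemma solution_quad : exists2 C, 0 <= C & forall B M, (0 < M)%N ->
  `|qE B (Z T) - qE (iter M (evolC H L (T / M%:R)) B) Z0| <= C * mn (realify B) * (T / M%:R).
Proof.
have [Cex Cex0 exP] := real_exp_step H L T.
have [C C0 wk] := exact_weak usualF BM T0 Cex0 exP (dissipative L H_sa)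
  (real_equation usualF Z0_meas Z0_norm solZ) (on_sphere_unit0 Z0).
exists C => // B M M0; have := wk (realify B) M M0; rewrite -real_evol.
rewrite (_ : Ex P (fun w => quad _ (on_sphere Z0 w)) = qE (iter M (evolC H L (T / M%:R)) B) Z0) //.
have sub := filt_meas usualF (lexx 0).
have aZ := init_adm usualF Z0_meas.
apply: Ex_ae; try apply: quad_meas.
- by apply: vadm_sub sub _; apply: on_sphere_adm => //; exact: (filt_sa usualF (lexx 0)).
- by apply: vadm_sub sub _; exact: to_real_adm.
- by apply: filterS (on_sphere_ae Z0_norm) => w ->.
Qed.

(** Both expectations are pulled back to time 0 by the same [M] Euler steps of the
    backward equation; there the hypothesis on the initial values applies to the
    evolved observable, whose norm is bounded uniformly in [M]. *)
Lemma weak_quad : exists2 C, 0 <= C & forall B M, (0 < M)%N ->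
  `|qE B (Z T) - qE B (Zh M M)| <= C * mn (realify B) * (T / M%:R).
Proof.
have [C1 C10 sol] := solution_quad; have [C2 C20 sch] := scheme_quad.
pose lam := growth G Lr; have lam0 : 0 <= lam by exact: growth_ge0.
exists (C1 + expR (lam * T) * K + C2) => [|B M M0]; first by nneg; exact: expR_ge0.
have [/andP[h0 hT] Mh] := step_size M0.
have w1 := sol B M M0; have w2 := sch B M M0.
set h := T / M%:R in h0 hT Mh w1 w2 *; set B' := iter M _ B in w1 w2.
have w3 := init_quad B' M0; rewrite -/h in w3.
have w4 : mn (realify B') <= expR (lam * T) * mn (realify B).
  by rewrite /B' real_evol -Mh; apply: iter_evol_exp; exact: ltW.
have {}w3 := le_trans w3 (ler_wpM2r (ltW h0) (ler_wpM2r (ltW K0) w4)).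
set E := expR (lam * T) in w3 w4 *; set q1 := qE B (Z T) in w1 *; set q2 := qE B' Z0 in w1 w3; set q3 := qE B' (Zh0 M) in w2 w3.
set q4 := qE B (Zh M M) in w2 *.
have -> : q1 - q4 = (q1 - q2) + (q2 - q3) - (q4 - q3) by ring.
apply: (le_trans (ler_normB _ _)); rewrite !mulrDl; apply: lerD => //.
apply: (le_trans (ler_normD _ _)); apply: lerD => //.
by apply: (le_trans w3); rewrite le_eqVlt; apply/orP; left; apply/eqP; ring.
Qed.

End real_weak_error.

Theorem theorem2 (R : realType) (disp : measure_display)
  (Omega : measurableType disp) (P : probability Omega R)
  (F : R -> set (set Omega)) (usualF : usual_filtration P F)
  (n d : nat) (n_gt0 : (0 < n)%N) (d_gt0 : (0 < d)%N)
  (W : 'I_n -> R -> Omega -> R) (BM_W : brownian P F W)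
  (T : R) (T_gt0 : 0 < T)
  (A H : 'M[R[i]]_d) (L : 'I_n -> 'M[R[i]]_d) (H_sa : H ^t* = H)
  (Z0 : Omega -> 'cV[R[i]]_d)
  (Z0_meas : forall i, meas_wrt (F 0) (fun w => rcoord i (Z0 w)))
  (Z0_norm : {ae P, forall w, vnorm (Z0 w) = 1})
  (Z : R -> Omega -> 'cV[R[i]]_d) (solZ : sde_solution P F W H L Z0 Z)
  (nu : probability R R) (nuP : noise_law nu)
  (xi : nat -> nat -> 'I_n -> {RV P >-> R})
  (xi_law : forall M m k, (m < M)%N ->
     forall B : set R, measurable B -> distribution P (xi M m k) B = nu B)
  (xi_indep : forall M,
     indep_rvs P (fun (mk : 'I_M * 'I_n) w => xi M mk.1 mk.2 w))
  (Zh0 : nat -> Omega -> 'cV[R[i]]_d)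
  (Zh0_meas : forall M i, (0 < M)%N ->
     measurable_fun setT (fun w => rcoord i (Zh0 M w)))
  (Zh0_norm : forall M, (0 < M)%N -> {ae P, forall w, vnorm (Zh0 M w) = 1})
  (Zh0_indep : forall M, (0 < M)%N ->
     indep_sys P
       (sigma_gen (fun (i : 'I_d * bool) w => rcoord i (Zh0 M w)))
       (sigma_gen (fun (mk : 'I_M * 'I_n) w => xi M mk.1 mk.2 w))) :
  let Zh M m w :=
    scheme H L (T / M%:R) (fun m' k => xi M m' k w) (Zh0 M w) m in
  (exists K : R, 0 < K /\
     forall (B : 'M[R[i]]_d) (M : nat), (0 < M)%N ->
       Normc.normc (cexpect P (fun w => dotc (Z0 w) (B *m Z0 w))
                    - cexpect P (fun w => dotc (Zh M 0%N w) (B *m Zh M 0%N w)))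
         <= frob B * K * (T / M%:R)) ->
  compact (msupport nu) ->
  exists K : R, 0 < K /\
    forall M : nat, (0 < M)%N ->
      Normc.normc (cexpect P (fun w => dotc (Z T w) (A *m Z T w))
                   - cexpect P (fun w => dotc (Zh M M w) (A *m Zh M M w)))
        <= K * (T / M%:R).
Proof.
move=> Zh [K [K0 init]] _.
have [C C0 wk] := weak_quad usualF BM_W T_gt0 H_sa Z0_meas Z0_norm solZ nuP xi_law xi_indep
  Zh0_meas Zh0_norm Zh0_indep K0 init.
exists (C * mn (realify A) + C * mn (realify (- 'i%C *: A)) + 1); split.
  by rewrite ltr_wpDl // addr_ge0 // mulr_ge0 // mn_ge0.
move=> M M0; have h0 : 0 <= T / M%:R by rewrite divr_ge0 // ltW.
apply: (le_trans (normc_le _)); rewrite !cexpect_quad !mulrDl mul1r -[leLHS]addr0.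
by apply: lerD => //; apply: lerD; exact: wk.
Qed.
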